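(* There is an algorithm which, given a $C_{ab}$ code $\mathcal{C}_H(\mathcal{P},m)\subseteq\mathbb{F}^n$ of dimension $k$ with $a<b$ and $\mathcal{P}=\{P_1,\dots,P_n\}$ distinct finite rational places, and a message $\mathbf{m}\in\mathbb{F}^k$, computes the codeword $\phi(\mathbf{m})$, where $\phi$ is the evaluation-encoding map of the code, and which has the following complexity: let $q=|\mathbb{F}|$, assume $n\ge q$, and assume that the genus $g$ of the $C_{ab}$ curve satisfies $g\le n$; then the algorithm uses $\tilde{O}(q\sqrt n)\subset\tilde{O}(n^{3/2})$ operations in $\mathbb{F}$.
   Context: Let $\mathbb{F}$ be a finite field, $a,b$ coprime positive integers, and $\deg_{a,b}$ the weighted degree with $\deg_{a,b}(X^iY^j)=ai+bj$. Let $\operatorname{supp}(H)$ be the set of monomials with non-zero coefficient in $H$. A polynomial $H\in\mathbb{F}[X,Y]$ is a $C_{ab}$ polynomial if: (i) $X^b,Y^a\in\operatorname{supp}(H)$; (ii) $X^iY^j\in\operatorname{supp}(H)$ implies $ai+bj\le ab$; (iii) $\langle H,\partial H/\partial X,\partial H/\partial Y\rangle=\mathbb{F}[X,Y]$. Such $H$ is absolutely irreducible; its function field $\mathbb{F}(x,y)$, $H(x,y)=0$, has genus $g=(a-1)(b-1)/2$ and a unique rational place $P_\infty$ that is the only pole of $x$ and of $y$; $x^iy^j$ has pole order $ai+bj$ there. The rational places other than $P_\infty$ (finite rational places) are identified with the points $(\alpha,\beta)\in\mathbb{F}^2$ with $H(\alpha,\beta)=0$. Each $f\in\mathbb{F}[x,y]=\mathbb{F}[X,Y]/\langle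 H\rangle$ has a unique representation with $y$-degree at most $a-1$, its standard form. The Riemann–Roch space $\mathcal{L}(mP_\infty)$ is the $\mathbb{F}$-span of $B=\{x^iy^j\mid ai+bj\le m,\ 0\le j\le a-1\}$. For distinct finite rational places $P_1,\dots,P_n$ and an integer $m\ge0$, $\mathcal{C}_H(\mathcal{P},m)=\{\operatorname{ev}_{\mathcal{P}}(f)\mid f\in\mathcal{L}(mP_\infty)\}$ with $\operatorname{ev}_{\mathcal{P}}(f)=(f(P_1),\dots,f(P_n))$. It is always assumed that $m\le n+2g-1$. Evaluation-encoding map: let $k=\dim\mathcal{C}_H(\mathcal{P},m)$ and fix an ordered subset $\hat B\subseteq B$ of $k$ monomials whose images under $\operatorname{ev}_{\mathcal{P}}$ are linearly independent ($\hat B=B$ if $k=|B|$). Then $\phi=\operatorname{ev}_{\mathcal{P}}\circ\varphi$, where $\varphi:\mathbb{F}^k\to\mathcal{L}(mP_\infty)$ uses the entries of $\mathbf{m}$ as coefficients of the monomials in $\hat B$. Complexity is the number of arithmetic operations in $\mathbb{F}$ in an algebraic RAM model (table lookup and insertion cost $O(1)$); implied constants are absolute. $\tilde{O}(h)=\bigcup_{c\ge0}O(h\log^c h)$, and $\log t$ is read as $\max(1,\log t)$. *)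

(* Defs.v *)
From HB Require Import structures.
From mathcomp Require Import all_boot all_order all_algebra.
From mathcomp Require Import polyXY.
From mathcomp Require Import reals exp.

Set Implicit Arguments.
Unset Strict Implicit.
Unset Printing Implicit Defensive.
Import Order.TTheory GRing.Theory Num.Theory.
Local Open Scope ring_scope.

(** * C_ab curves and codes *)

(* F[X, Y] is {poly {poly F}} with the conventions of polyXY: the outer
   variable is X, the inner one is Y := 'X%:P, the coefficient of X^i Y^j in H
   is H`_i`_j, and H.[x, y] is the value of H at (x, y). *)

Definition in_suppXY (F : fieldType) (H : {poly {poly F}}) (i j : nat) : bool :=
  H`_i`_j != 0.

Definition dX (F : fieldType) (H : {poly {poly F}}) : {poly {poly F}} := H^`().

Definition dY (F : fieldType) (H : {poly {poly F}}) : {poly {poly F}} :=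
  map_poly (@deriv F) H.

Definition monXY (F : fieldType) (ij : nat * nat) : {poly {poly F}} :=
  'X^(ij.1) * 'Y ^+ ij.2.

Definition wdeg (a b : nat) (ij : nat * nat) : nat := (a * ij.1 + b * ij.2)%N.

Definition is_Cab (F : fieldType) (a b : nat) (H : {poly {poly F}}) : Prop :=
  [/\ in_suppXY H b 0 /\ in_suppXY H 0 a,
      forall i j, in_suppXY H i j -> (wdeg a b (i, j) <= a * b)%N
    & forall G : {poly {poly F}},
        exists U V W, G = U * H + V * dX H + W * dY H].

(* For coprime a, b the number (a-1)(b-1) is even, so nothing is lost in the
   halving. *)
Definition Cab_genus (a b : nat) : nat := ((a.-1 * b.-1)./2)%N.

(* The exponents (i, j) of the monomials in the basis B of L(m P_oo). *)
Definition Cab_basis (a b m : nat) : seq (nat * nat) :=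
  [seq ij <- [seq (i, j) | i <- iota 0 m.+1, j <- iota 0 a]
     | (wdeg a b ij <= m)%N].

Lemma mem_Cab_basis (a b m i j : nat) : (0 < a)%N ->
  ((i, j) \in Cab_basis a b m) = (wdeg a b (i, j) <= m)%N && (j < a)%N.
Proof.
move=> a0; rewrite mem_filter; apply: andb_id2l => le_m.
apply/allpairsPdep/idP => [[u [v [_ + [_ ->]]]]|ja].
  by rewrite mem_iota.
exists i, j; rewrite !mem_iota /= !add0n ja ltnS; split => //.
by apply: leq_trans le_m; apply: leq_trans (leq_addr _ _); rewrite leq_pmull.
Qed.

(* f lies in L(m P_oo); elements of F[x, y] = F[X, Y] / (H) are represented by
   their standard forms. *)
Definition in_RR (F : fieldType) (a b m : nat) (f : {poly {poly F}}) : Prop :=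
  forall i j, in_suppXY f i j -> (wdeg a b (i, j) <= m)%N /\ (j < a)%N.

Definition evP (F : fieldType) (n : nat) (P : n.-tuple (F * F))
    (f : {poly {poly F}}) : 'rV[F]_n :=
  \row_l f.[(tnth P l).1, (tnth P l).2].

(* See Cab_codeP for the description as {ev_P(f) | f in L(m P_oo)}. *)
Definition Cab_code (F : fieldType) (a b m n : nat) (P : n.-tuple (F * F)) :
    {vspace 'rV[F]_n} :=
  <<[seq evP P (monXY F ij) | ij <- Cab_basis a b m]>>%VS.

Lemma evP_sum (F : fieldType) n (P : n.-tuple (F * F)) (I : Type)
    (r : seq I) (c : I -> F) (f : I -> {poly {poly F}}) :
  evP P (\sum_(i <- r) (c i)%:P%:P * f i) = \sum_(i <- r) c i *: evP P (f i).
Proof.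
apply/rowP => l; rewrite mxE summxE !horner_sum; apply: eq_bigr => i _.
by rewrite !mxE !hornerE.
Qed.

Lemma coef_monXY (F : fieldType) (c : F) (u : nat * nat) i j :
  (c%:P%:P * monXY F u)`_i`_j = c *+ (u == (i, j)).
Proof.
case: u => u v; rewrite /monXY /= coefCM -polyC_exp coefMC coefXn.
rewrite xpair_eqE [i == u]eq_sym; case: (u == i); last first.
  by rewrite mul0r mulr0 coef0.
by rewrite mul1r coefCM coefXn eq_sym; case: eqP => _; rewrite ?mulr1 ?mulr0.
Qed.

Lemma Cab_codeP (F : fieldType) (a b m n : nat) (P : n.-tuple (F * F))
    (c : 'rV[F]_n) : (0 < a)%N ->
  c \in Cab_code a b m P <-> exists2 f, in_RR a b m f & c = evP P f.
Proof.
move=> a0; set B := Cab_basis a b m.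
split=> [cX|[f fRR ->]].
  pose X := in_tuple [seq evP P (monXY F ij) | ij <- B].
  rewrite (@coord_span _ _ _ X c cX).
  have szX : size X = size B by rewrite size_map.
  pose e (l : 'I_(size X)) := nth (0, 0)%N B l.
  exists (\sum_(l < size X) (coord X l c)%:P%:P * monXY F (e l)).
    move=> i j; rewrite /in_suppXY !coef_sum => h.
    suff [l /eqP eij] : exists l, e l == (i, j).
      apply/andP; rewrite -mem_Cab_basis // -eij.
      by apply: mem_nth; rewrite -szX ltn_ord.
    apply/existsP; apply: contraNT h => /existsPn h.
    by apply/eqP; apply: big1 => l _; rewrite coef_monXY (negbTE (h l)).
  rewrite evP_sum; apply: eq_bigr => l _; congr (_ *: _).
  by rewrite (nth_map (0, 0)%N) // -szX.
have -> : f = \sum_(ij <- B) (f`_(ij.1)`_(ij.2))%:P%:P * monXY F ij.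
  apply/polyP => i; apply/polyP => j; rewrite !coef_sum.
  have uB : uniq B.
    by apply/filter_uniq/allpairs_uniq; rewrite ?iota_uniq // => -[? ?] [? ?].
  have [ijB|ijB] := boolP ((i, j) \in B).
    rewrite (bigD1_seq (i, j)) //= coef_monXY eqxx big1 ?addr0 // => ij ne.
    by rewrite coef_monXY (negbTE ne).
  rewrite big_seq big1 => [|ij ijB'].
    apply/eqP; apply: contraNT ijB => /fRR; rewrite mem_Cab_basis //.
    by move=> [-> ->].
  by rewrite coef_monXY; case: eqP => // E; rewrite -E ijB' in ijB.
rewrite evP_sum big_seq; apply: memv_suml => ij ijB.
by apply/memvZ/memv_span/map_f.
Qed.

(* A C_ab code with the choice of monomials that fixes its evaluation-encoding
   map.  By cc_Bhat_free the k monomials of cc_Bhat are distinct, so cc_Bhat is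
   an enumeration of the whole of B when k = |B|. *)
Record cab_code : Type := CabCode {
  cc_F : finFieldType;
  cc_a : nat;
  cc_b : nat;
  cc_H : {poly {poly cc_F}};
  cc_m : nat;
  cc_n : nat;
  cc_P : cc_n.-tuple (cc_F * cc_F);
  cc_k : nat;
  cc_Bhat : cc_k.-tuple (nat * nat);
  cc_a_gt0 : (0 < cc_a)%N;
  cc_b_gt0 : (0 < cc_b)%N;
  cc_coprime : coprime cc_a cc_b;
  cc_Cab : is_Cab cc_a cc_b cc_H;
  cc_P_uniq : uniq cc_P;
  cc_P_curve : forall l : 'I_cc_n, cc_H.[(tnth cc_P l).1, (tnth cc_P l).2] = 0;
  cc_m_bound : (cc_m < cc_n + 2 * Cab_genus cc_a cc_b)%N;
  cc_dim : cc_k = \dim (Cab_code cc_a cc_b cc_m cc_P);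
  cc_Bhat_sub : {subset cc_Bhat <= Cab_basis cc_a cc_b cc_m};
  cc_Bhat_free : free [seq evP cc_P (monXY cc_F ij) | ij <- cc_Bhat]
}.

Definition msg_poly (C : cab_code) (msg : 'rV[cc_F C]_(cc_k C)) :
    {poly {poly cc_F C}} :=
  \sum_(l < cc_k C) (msg 0 l)%:P%:P * monXY (cc_F C) (tnth (cc_Bhat C) l).

Definition encode (C : cab_code) (msg : 'rV[cc_F C]_(cc_k C)) :
    'rV[cc_F C]_(cc_n C) :=
  evP (cc_P C) (msg_poly msg).

Record enc_input : Type := EncInput {
  ei_code :> cab_code;
  ei_msg : 'rV[cc_F ei_code]_(cc_k ei_code)
}.

(** * Algebraic RAM *)

(* A machine over F has index registers, which hold machine words (naturals
   taken modulo a word capacity W), and field registers, which hold elements of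
   F.  Its memory consists of tables: a cell is named by a table number and a
   key, which is a sequence of indices and field elements.  A program does not
   depend on F and treats the elements of F as opaque: it can only apply the
   field operations to them, compare them, and use them in keys.  Since the
   length of every key is fixed by the program text, each instruction has unit
   cost. *)

Variant key_reg : Type := KI of nat | KF of nat.

Variant instr : Type :=
| IConst of nat & nat               (* I[r] := c *)
| IAdd of nat & nat & nat           (* I[r] := I[s] + I[t] *)
| ISub of nat & nat & nat           (* truncated subtraction *)
| IMul of nat & nat & nat
| IDiv of nat & nat & nat           (* Euclidean quotient, 0 if I[t] = 0 *)
| FZero of nat
| FOne of nat
| FAdd of nat & nat & nat           (* F[r] := F[s] + F[t] *)
| FSub of nat & nat & nat
| FMul of nat & nat & nat
| FDiv of nat & nat & nat           (* 0 if F[t] = 0 *)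
| ILoad of nat & nat & seq key_reg  (* I[r] := index table t at key *)
| IStore of nat & seq key_reg & nat (* index table t at key := I[r] *)
| FLoad of nat & nat & seq key_reg
| FStore of nat & seq key_reg & nat
| JumpLt of nat & nat & nat         (* if I[s] < I[t] goto l *)
| JumpFeq of nat & nat & nat.       (* if F[s] = F[t] goto l *)

Definition program : Type := seq instr.

(* Table number and key. *)
Definition cell (F : finFieldType) : Type := (nat * seq (nat + F))%type.

Record state (F : finFieldType) : Type := State {
  pc : nat;
  ireg : nat -> nat;
  freg : nat -> F;
  itab : cell F -> nat;
  ftab : cell F -> F
}.

Section Semantics.
Variables (F : finFieldType) (W : nat).

Implicit Type s : state F.

Definition set_pc l s := State l (ireg s) (freg s) (itab s) (ftab s).

Definition set_ireg r v s :=
  State (pc s).+1 [eta ireg s with r |-> (v %% W)%N] (freg s) (itab s) (ftab s).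

Definition set_freg r (v : F) s :=
  State (pc s).+1 (ireg s) [eta freg s with r |-> v] (itab s) (ftab s).

Definition set_itab (z : cell F) v s :=
  State (pc s).+1 (ireg s) (freg s) [eta itab s with z |-> v] (ftab s).

Definition set_ftab (z : cell F) v s :=
  State (pc s).+1 (ireg s) (freg s) (itab s) [eta ftab s with z |-> v].

Definition cell_at s (t : nat) (ks : seq key_reg) : cell F :=
  (t, [seq match x with KI r => inl (ireg s r) | KF r => inr (freg s r) end
      | x <- ks]).

Definition exec_instr (i : instr) s : state F :=
  match i with
  | IConst r c => set_ireg r c s
  | IAdd r u v => set_ireg r (ireg s u + ireg s v)%N s
  | ISub r u v => set_ireg r (ireg s u - ireg s v)%N s
  | IMul r u v => set_ireg r (ireg s u * ireg s v)%N s
  | IDiv r u v => set_ireg r (ireg s u %/ ireg s v)%N s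
  | FZero r => set_freg r 0 s
  | FOne r => set_freg r 1 s
  | FAdd r u v => set_freg r (freg s u + freg s v) s
  | FSub r u v => set_freg r (freg s u - freg s v) s
  | FMul r u v => set_freg r (freg s u * freg s v) s
  | FDiv r u v => set_freg r (freg s u / freg s v) s
  | ILoad r t ks => set_ireg r (itab s (cell_at s t ks)) s
  | IStore t ks r => set_itab (cell_at s t ks) (ireg s r) s
  | FLoad r t ks => set_freg r (ftab s (cell_at s t ks)) s
  | FStore t ks r => set_ftab (cell_at s t ks) (freg s r) s
  | JumpLt u v l => set_pc (if (ireg s u < ireg s v)%N then l else (pc s).+1) s
  | JumpFeq u v l => set_pc (if freg s u == freg s v then l else (pc s).+1) s
  end.

Definition halted (A : program) s : bool := (size A <= pc s)%N.

Definition step (A : program) s : state F :=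
  if halted A s then s else exec_instr (nth (FZero 0) A (pc s)) s.

(* A, started in s0, halts after exactly T instructions, in state s. *)
Definition runs_to (A : program) s0 (T : nat) s : Prop :=
  [/\ iter T (step A) s0 = s, halted A s
    & forall t, (t < T)%N -> ~~ halted A (iter t (step A) s0)].

End Semantics.

(** * The encoding task *)

(* Initial memory.  Index registers 0..5: a, b, m, n, k, q.  Index tables 0 and
   1: the X- and Y-exponents of the monomials in Bhat.  Field tables 0..3: the
   coefficients of H, the X- and Y-coordinates of the points, the message.
   Everything else is 0. *)
Definition enc_ireg (C : cab_code) : nat -> nat :=
  nth 0%N [:: cc_a C; cc_b C; cc_m C; cc_n C; cc_k C; #|cc_F C|].

Definition enc_itab (C : cab_code) (z : cell (cc_F C)) : nat :=
  match z with
  | (0, [:: inl l]) => (nth (0, 0) (cc_Bhat C) l).1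
  | (1, [:: inl l]) => (nth (0, 0) (cc_Bhat C) l).2
  | _ => 0
  end%N.

Definition enc_ftab (I : enc_input) (z : cell (cc_F I)) : cc_F I :=
  match z with
  | (0%N, [:: inl i; inl j]) => (cc_H I)`_i`_j
  | (1%N, [:: inl l]) => (nth (0, 0) (cc_P I) l).1
  | (2%N, [:: inl l]) => (nth (0, 0) (cc_P I) l).2
  | (3%N, [:: inl l]) => if insub l is Some o then ei_msg I 0 o else 0
  | _ => 0
  end.

Definition enc_init (I : enc_input) : state (cc_F I) :=
  State 0 (enc_ireg I) (fun=> 0) (@enc_itab I) (@enc_ftab I).

(* Words have O(log N) bits, where N bounds all the indices in the input (k is
   at most n, and the exponents in Bhat are at most m); d is a parameter of the
   machine that may not depend on the input. *)
Definition word_capacity (d : nat) (C : cab_code) : nat :=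
  ((cc_a C + cc_b C + cc_m C + cc_n C + #|cc_F C|).+2 ^ d)%N.

(* On input I the program A halts after T instructions, with the l-th entry of
   the codeword in cell l of field table 4. *)
Definition encodes_in (A : program) (d : nat) (I : enc_input) (T : nat) : Prop :=
  exists2 s : state (cc_F I),
    runs_to (word_capacity d I) A (enc_init I) T s
    & forall l : 'I_(cc_n I),
        ftab s (4%N, [:: inl (l : nat)]) = encode (ei_msg I) 0 l.

(** * Soft-O *)

(* f = softO(h) on the inputs satisfying D. *)
Definition softO (R : realType) (I : Type) (D : I -> Prop) (f h : I -> R) : Prop :=
  exists (C : R) (c : nat), forall x, D x ->
    `|f x| <= C * (h x * Num.max 1 (ln (h x)) ^+ c).

(* Main.v *)
Require Import Defs.
From mathcomp Require Import all_boot all_order all_algebra.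
From mathcomp Require Import reals exp.
From mathcomp Require Import polyXY qpoly zify ring lra.
Set Implicit Arguments.
Unset Strict Implicit.
Unset Printing Implicit Defensive.
Import Order.TTheory GRing.Theory Num.Theory.

(** The encoder is an explicit RAM program.  It uses the fibres of the projection
of the curve to the x-line.  By the support conditions, H(x, Y) has degree
exactly a in Y for every x in F, so every fibre has at most a points
([fiber_size]) and n <= a q.  The message polynomial is a sum of f_j(X) Y^j
with j < a and deg f_j <= m / a.  The program evaluates the polynomials f_j at
the distinct first coordinates x of the points, at most q of them, and then,
for every such x, the polynomial sum_j f_j(x) Y^j of degree less than a at the
points of the fibre over x.  The first phase consists of a univariate multipoint
evaluations of size about q + m / a, the second of at most q evaluations of
size about a; with quasi-linear multipoint evaluation both cost a q + m + n up
to logarithmic factors ([encoder_ok]).  Since a < b and the genus is at most n,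
a^2 <= 9 n ([sqr_a_le]), m <= 3 n and n <= a q, so that this is quasi-linear
in q sqrt n ([encoder_T_bound]).

Multipoint evaluation ([mpe_ok]) is the transposed subproduct tree: the values
of f are the coefficients of 1 / X in the expansions of f / (X - x) at infinity,
and they are reached from the expansion of f / M, where M is the product of
all the X - x, by middle products down the tree ([midcoef_down]).  The expansion
at the root takes one power series inversion by Newton iteration
([newton_step]).

Everything thus rests on a polynomial multiplication that is quasi-linear over
every finite field, including those without suitable roots of unity.  This is
Nussbaumer's recursion ([nuss_stage], [conv_ok]), in radix 2, or in radix 3 when
F has characteristic 2.  Polynomials are multiplied modulo X^L - 1, where L is a
power of the radix r.  A polynomial in X is seen as a polynomial of small
degree in X over the polynomials in X^M; there X^M is a root of unity, so that
the Fourier transform needs only rotations of coefficient sequences.  After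
logarithmically many halvings of the exponent of L, the blocks have constant
size.  The sums over roots of unity that have to vanish do so only modulo
1 + X^(L/r) + ... + X^((r-1)L/r); this is enough to recover products of degree
less than L / r ([linear_of_cyclic]).

The program is written in a small structured language with a compiler to the
RAM that is proved correct, including the exact number of steps
([compile_correct]).  Its correctness and its cost are derived together in a
program logic for this language ([ok_seq], [ok_for], [fill_ok]). *)

Local Notation "\fsum_ ( i < n ) X" := (\big[+%R/0%R]_(i < n) X)
  (at level 41, X at level 41, i, n at level 50).

(** * A structured language and its compilation to the RAM *)

(** Subtraction is truncated, and division by 0 gives 0, as on the machine. *)
Inductive iexpr : Type :=
| EV of nat
| EC of nat
| EAdd of iexpr & iexpr
| ESub of iexpr & iexpr
| EMul of iexpr & iexpr
| EDiv of iexpr & iexpr.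

Variant kexpr : Type := KE of iexpr | KR of nat.

Variant fop : Type := OpAdd | OpSub | OpMul | OpDiv.

(** The bound of a loop [For r e c] is read once.  The counter itself is kept in a
temporary and copied to r before every iteration, so that c may overwrite r. *)
Inductive cmd : Type :=
| Skip
| Seq of cmd & cmd
| ISet of nat & iexpr
| ILd of nat & nat & seq kexpr
| ISt of nat & seq kexpr & iexpr
| FCst of nat & bool
| FBin of fop & nat & nat & nat
| FLd of nat & nat & seq kexpr
| FSt of nat & seq kexpr & nat
| IfLt of iexpr & iexpr & cmd & cmd
| IfFeq of nat & nat & cmd & cmd
| For of nat & iexpr & cmd.

Fixpoint ev (rho : nat -> nat) (e : iexpr) : nat :=
  match e with
  | EV r => rho r
  | EC c => c
  | EAdd e1 e2 => ev rho e1 + ev rho e2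
  | ESub e1 e2 => ev rho e1 - ev rho e2
  | EMul e1 e2 => ev rho e1 * ev rho e2
  | EDiv e1 e2 => ev rho e1 %/ ev rho e2
  end.

(** The state of the machine without the program counter, and with the registers
that serve as temporaries of the compiled code ignored. *)
Record store (F : finFieldType) : Type := Store {
  ir : nat -> nat;
  fr : nat -> F;
  it : cell F -> nat;
  ft : cell F -> F
}.

Section Denotation.
Variables (F : finFieldType) (V : nat).
Implicit Types (s : store F) (c : cmd).

Definition seti r v s := Store [eta ir s with r |-> v] (fr s) (it s) (ft s).
Definition setf r v s := Store (ir s) [eta fr s with r |-> v] (it s) (ft s).
Definition setit z v s := Store (ir s) (fr s) [eta it s with z |-> v] (ft s).
Definition setft z v s := Store (ir s) (fr s) (it s) [eta ft s with z |-> v].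

Definition kval s (k : kexpr) : nat + F :=
  match k with KE e => inl (ev (ir s) e) | KR r => inr (fr s r) end.

Definition fopv (o : fop) : F -> F -> F :=
  match o with
  | OpAdd => fun x y => x + y
  | OpSub => fun x y => x - y
  | OpMul => fun x y => x * y
  | OpDiv => fun x y => x / y
  end%R.

Fixpoint run c s : store F :=
  match c with
  | Skip => s
  | Seq c1 c2 => run c2 (run c1 s)
  | ISet r e => seti r (ev (ir s) e) s
  | ILd r t ks => seti r (it s (t, [seq kval s k | k <- ks])) s
  | ISt t ks e => setit (t, [seq kval s k | k <- ks]) (ev (ir s) e) s
  | FCst r b => setf r (b%:R)%R s
  | FBin o r u v => setf r (fopv o (fr s u) (fr s v)) s
  | FLd r t ks => setf r (ft s (t, [seq kval s k | k <- ks])) s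
  | FSt t ks r => setft (t, [seq kval s k | k <- ks]) (fr s r) s
  | IfLt e1 e2 c1 c2 =>
      if ev (ir s) e1 < ev (ir s) e2 then run c1 s else run c2 s
  | IfFeq u v c1 c2 => if fr s u == fr s v then run c1 s else run c2 s
  | For r e c => iteri (ev (ir s) e) (fun i s => run c (seti r i s)) s
  end.

Definition loopst r c i s := iteri i (fun i s => run c (seti r i s)) s.

(** Every number that c computes into a register, into a table or as the bound of
a loop is at most V.  This excludes overflow of the machine words. *)
Fixpoint safe c s : Prop :=
  match c with
  | Seq c1 c2 => safe c1 s /\ safe c2 (run c1 s)
  | ISet _ e => ev (ir s) e <= V
  | ISt _ _ e => ev (ir s) e <= V
  | IfLt e1 e2 c1 c2 =>
      if ev (ir s) e1 < ev (ir s) e2 then safe c1 s else safe c2 s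
  | IfFeq u v c1 c2 => if fr s u == fr s v then safe c1 s else safe c2 s
  | For r e c => ev (ir s) e <= V /\
      forall i, i < ev (ir s) e -> safe c (seti r i (loopst r c i s))
  | _ => True
  end.

Fixpoint expr_cost (e : iexpr) : nat :=
  match e with
  | EV _ => 2
  | EC _ => 1
  | EAdd e1 e2 | ESub e1 e2 | EMul e1 e2 | EDiv e1 e2 => expr_cost e1 + expr_cost e2 + 1
  end.

Definition key_cost (k : kexpr) := if k is KE e then expr_cost e else 0.

(** The exact number of instructions executed by the compiled code. *)
Fixpoint cost c s : nat :=
  match c with
  | Skip => 0
  | Seq c1 c2 => cost c1 s + cost c2 (run c1 s)
  | ISet r e => expr_cost e + 2
  | ILd r t ks => sumn (map key_cost ks) + 1
  | ISt t ks e => sumn (map key_cost ks) + expr_cost e + 1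
  | FCst _ _ => 1
  | FBin _ _ _ _ => 1
  | FLd _ _ ks => sumn (map key_cost ks) + 1
  | FSt _ ks _ => sumn (map key_cost ks) + 1
  | IfLt e1 e2 c1 c2 => expr_cost e1 + expr_cost e2 + 1 +
      if ev (ir s) e1 < ev (ir s) e2 then cost c1 s else cost c2 s + 1
  | IfFeq u v c1 c2 =>
      1 + if fr s u == fr s v then cost c1 s else cost c2 s + 1
  | For r e c => expr_cost e + 3 +
      \sum_(i < ev (ir s) e) (cost c (seti r i (loopst r c i s)) + 6)
  end.

Definition wf s := (forall r, ir s r <= V) /\ (forall z, it s z <= V).

Lemma wf_run c s : wf s -> safe c s -> wf (run c s).
Proof.
elim: c s => //=.
- by move=> c1 IH1 c2 IH2 s w [s1 s2]; apply: IH2 => //; apply: IH1.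
- by move=> r e s [w1 w2] le; split => // x /=; case: ifP.
- by move=> r t ks s [w1 w2] _; split => // x /=; case: ifP.
- by move=> t ks e s [w1 w2] le; split => // x /=; case: ifP.
- by move=> e1 e2 c1 IH1 c2 IH2 s w; case: ifP => _; auto.
- by move=> u v c1 IH1 c2 IH2 s w; case: ifP => _; auto.
move=> r e c IH s w [le H].
have: forall i, i <= ev (ir s) e -> wf (loopst r c i s).
  elim=> [|i IHi] // lti; rewrite /loopst iteriS.
  apply: IH (H _ lti); have [w1 w2] := IHi (ltnW lti).
  split => // x /=; case: ifP => // _.
  by apply: leq_trans le; apply: ltnW.
exact.
Qed.

End Denotation.

(** The registers from this one on are temporaries of the compiled code. *)
Definition temp0 : nat := 100.

Fixpoint compile_expr (t : nat) (e : iexpr) : program :=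
  match e with
  | EV r => [:: IConst t.+1 0; IAdd t r t.+1]
  | EC c => [:: IConst t c]
  | EAdd e1 e2 => compile_expr t e1 ++ compile_expr t.+1 e2 ++ [:: IAdd t t t.+1]
  | ESub e1 e2 => compile_expr t e1 ++ compile_expr t.+1 e2 ++ [:: ISub t t t.+1]
  | EMul e1 e2 => compile_expr t e1 ++ compile_expr t.+1 e2 ++ [:: IMul t t t.+1]
  | EDiv e1 e2 => compile_expr t e1 ++ compile_expr t.+1 e2 ++ [:: IDiv t t t.+1]
  end.

Fixpoint compile_keys (t : nat) (ks : seq kexpr) : program :=
  match ks with
  | [::] => [::]
  | KE e :: ks => compile_expr t e ++ compile_keys t.+1 ks
  | KR _ :: ks => compile_keys t.+1 ks
  end.

Fixpoint key_regs (t : nat) (ks : seq kexpr) : seq key_reg :=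
  match ks with
  | [::] => [::]
  | KE _ :: ks => KI t :: key_regs t.+1 ks
  | KR r :: ks => KF r :: key_regs t.+1 ks
  end.

Definition compile_op (o : fop) : nat -> nat -> nat -> instr :=
  match o with
  | OpAdd => FAdd | OpSub => FSub | OpMul => FMul | OpDiv => FDiv
  end.

Fixpoint code_size (c : cmd) : nat :=
  match c with
  | Skip => 0
  | Seq c1 c2 => code_size c1 + code_size c2
  | ISet r e => expr_cost e + 2
  | ILd r t ks => sumn (map key_cost ks) + 1
  | ISt t ks e => sumn (map key_cost ks) + expr_cost e + 1
  | FCst _ _ => 1
  | FBin _ _ _ _ => 1
  | FLd _ _ ks => sumn (map key_cost ks) + 1
  | FSt _ ks _ => sumn (map key_cost ks) + 1
  | IfLt e1 e2 c1 c2 => expr_cost e1 + expr_cost e2 + (code_size c2 + code_size c1 + 2)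
  | IfFeq u v c1 c2 => code_size c2 + code_size c1 + 2
  | For r e c => expr_cost e + (code_size c + 8)
  end.

(** p is the address of the first instruction, and t the first free temporary. *)
Fixpoint compile (p t : nat) (c : cmd) : program :=
  match c with
  | Skip => [::]
  | Seq c1 c2 => compile p t c1 ++ compile (p + code_size c1) t c2
  | ISet r e => compile_expr t e ++ [:: IConst t.+1 0; IAdd r t t.+1]
  | ILd r n ks => compile_keys t ks ++ [:: ILoad r n (key_regs t ks)]
  | ISt n ks e => compile_keys t ks ++ compile_expr (t + size ks) e ++
                    [:: IStore n (key_regs t ks) (t + size ks)]
  | FCst r b => [:: if b then FOne r else FZero r]
  | FBin o r u v => [:: compile_op o r u v]
  | FLd r n ks => compile_keys t ks ++ [:: FLoad r n (key_regs t ks)]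
  | FSt n ks r => compile_keys t ks ++ [:: FStore n (key_regs t ks) r]
  | IfLt e1 e2 c1 c2 =>
      let p2 := p + (expr_cost e1 + expr_cost e2) + 1 in
      let p1 := p2 + code_size c2 + 1 in
      compile_expr t e1 ++ compile_expr t.+1 e2 ++ [:: JumpLt t t.+1 p1] ++ compile p2 t c2 ++
        [:: JumpFeq 0 0 (p1 + code_size c1)] ++ compile p1 t c1
  | IfFeq u v c1 c2 =>
      let p2 := p + 1 in
      let p1 := p2 + code_size c2 + 1 in
      [:: JumpFeq u v p1] ++ compile p2 t c2 ++
        [:: JumpFeq 0 0 (p1 + code_size c1)] ++ compile p1 t c1
  | For r e c =>
      let l := p + expr_cost e + 1 in
      compile_expr t e ++ [:: IConst t.+1 0; JumpLt t.+1 t (l + 2);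
                     JumpFeq 0 0 (l + 7 + code_size c);
                     IConst t.+2 0; IAdd r t.+1 t.+2] ++
      compile (l + 4) t.+2 c ++
      [:: IConst t.+2 1; IAdd t.+1 t.+1 t.+2; JumpFeq 0 0 l]
  end.

(** The exponent in the bound of [ev_deg]: subexpressions may exceed the bound V on
stored numbers, but only by a power that the program text determines. *)
Fixpoint expr_deg (e : iexpr) : nat :=
  match e with
  | EV _ => 1
  | EC _ => 1
  | EAdd e1 e2 => (maxn (expr_deg e1) (expr_deg e2)).+1
  | EMul e1 e2 => expr_deg e1 + expr_deg e2
  | ESub e1 e2 | EDiv e1 e2 => maxn (expr_deg e1) (expr_deg e2)
  end.

Fixpoint expr_regs (e : iexpr) : bool :=
  match e with
  | EV r => r < temp0
  | EC c => c < 10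
  | EAdd e1 e2 | ESub e1 e2 | EMul e1 e2 | EDiv e1 e2 => expr_regs e1 && expr_regs e2
  end.

Definition max_deg : nat := 12.
Definition expr_wf e := expr_regs e && (expr_deg e <= max_deg).
Definition key_wf k := if k is KE e then expr_wf e else true.

Fixpoint cmd_wf (c : cmd) : bool :=
  match c with
  | Skip | FCst _ _ | FBin _ _ _ _ => true
  | Seq c1 c2 => cmd_wf c1 && cmd_wf c2
  | ISet r e => (r < temp0) && expr_wf e
  | ILd r _ ks => (r < temp0) && all key_wf ks
  | ISt _ ks e => all key_wf ks && expr_wf e
  | FLd _ _ ks | FSt _ ks _ => all key_wf ks
  | IfLt e1 e2 c1 c2 => [&& expr_wf e1, expr_wf e2, cmd_wf c1 & cmd_wf c2]
  | IfFeq _ _ c1 c2 => cmd_wf c1 && cmd_wf c2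
  | For r e c => [&& r < temp0, expr_wf e & cmd_wf c]
  end.

Lemma size_compile_expr t e : size (compile_expr t e) = expr_cost e.
Proof.
by elim: e t => //= e1 IH1 e2 IH2 t; rewrite !size_cat IH1 IH2 addnA.
Qed.

Lemma size_compile_keys t ks : size (compile_keys t ks) = sumn (map key_cost ks).
Proof.
by elim: ks t => //= -[e|r] ks IH t /=; rewrite ?size_cat ?size_compile_expr IH ?add0n.
Qed.

Lemma size_compile p t c : size (compile p t c) = code_size c.
Proof.
elim: c p t => //=.
- by move=> c1 IH1 c2 IH2 p t; rewrite size_cat IH1 IH2.
- by move=> r e p t; rewrite size_cat size_compile_expr.
- by move=> r n ks p t; rewrite size_cat size_compile_keys.
- by move=> n ks e p t; rewrite !size_cat size_compile_keys size_compile_expr addnA.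
- by move=> r n ks p t; rewrite size_cat size_compile_keys.
- by move=> n ks r p t; rewrite size_cat size_compile_keys.
- move=> e1 e2 c1 IH1 c2 IH2 p t.
  by rewrite !size_cat /= size_cat /= !size_compile_expr IH1 IH2; lia.
- by move=> u v c1 IH1 c2 IH2 p t; rewrite size_cat /= IH1 IH2; lia.
move=> r e c IH p t; rewrite size_cat /= size_cat /= IH size_compile_expr; lia.
Qed.

Lemma eta_ext (T : eqType) (U : Type) (f g : T -> U) (x : T) (v : U) :
  f =1 g -> [eta f with x |-> v] =1 [eta g with x |-> v].
Proof. by move=> E z /=; case: ifP. Qed.

Section Compile.
Variables (F : finFieldType) (W V : nat) (A : program).
Hypothesis V_ge : 10 <= V.
Hypothesis W_gt : V ^ max_deg < W.
Implicit Types (s : state F) (g : store F).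

Definition steps s T s' :=
  iter T (step W A) s = s' /\
  forall t, t < T -> ~~ halted A (iter t (step W A) s).

Lemma steps0 s : steps s 0 s. Proof. by []. Qed.

Lemma steps_trans s1 T1 s2 T2 s3 :
  steps s1 T1 s2 -> steps s2 T2 s3 -> steps s1 (T1 + T2) s3.
Proof.
move=> [e1 h1] [e2 h2]; split=> [|t lt]; first by rewrite addnC iterD e1.
have [/h1//|ge] := ltnP t T1.
by rewrite -(subnK ge) iterD e1; apply: h2; rewrite ltn_subLR.
Qed.

Definition at_ p (code : program) := take (size code) (drop p A) = code.

Lemma at_cat p c1 c2 : at_ p (c1 ++ c2) -> at_ p c1 /\ at_ (p + size c1) c2.
Proof.
rewrite /at_ size_cat takeD drop_drop => h.
have s1 : size (take (size c1) (drop p A)) = size c1.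
  rewrite size_take_min; apply/minn_idPl.
  have: size (take (size c1) (drop p A) ++ take (size c2) (drop (size c1 + p) A))
    = size c1 + size c2 by rewrite h size_cat.
  rewrite size_cat !size_take_min !size_drop subnDAC -subnDA => E.
  rewrite leqNgt; apply/negP => lt.
  have E2 : minn (size c1) (size A - p) = size A - p by apply/minn_idPr/ltnW.
  have E3 : size A - (p + size c1) = 0.
    by rewrite subnDA; apply/eqP; rewrite subn_eq0; apply: ltnW.
  move: E; rewrite E2 E3 minn0 addn0 => E; move: lt.
  by rewrite E ltnNge leq_addr.
split.
  have := congr1 (take (size c1)) h.
  by rewrite take_size_cat // take_size_cat.
have := congr1 (drop (size c1)) h.
by rewrite drop_size_cat // drop_size_cat // [p + _]addnC.
Qed.

Lemma steps_one s i code :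
  at_ (pc s) (i :: code) -> steps s 1 (exec_instr W i s).
Proof.
move=> h; have lt : pc s < size A.
  rewrite ltnNge; apply/negP => ge; move: h.
  by rewrite /at_ drop_oversize.
have e : nth (FZero 0) A (pc s) = i.
  move: h; rewrite /at_ (drop_nth (FZero 0) lt) /=.
  by move=> [-> _].
have nh : ~~ halted A s by rewrite /halted -ltnNge.
split=> [|t]; last by rewrite ltnS leqn0 => /eqP ->.
by rewrite /= /step (negbTE nh) e.
Qed.

Definition straight (i : instr) : bool :=
  match i with JumpLt _ _ _ | JumpFeq _ _ _ => false | _ => true end.

Definition execs code s := foldl (fun s i => exec_instr W i s) s code.

Lemma pc_straight i s : straight i -> pc (exec_instr W i s) = (pc s).+1.
Proof. by case: i. Qed.

Lemma pc_execs code s : all straight code -> pc (execs code s) = pc s + size code.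
Proof.
elim: code s => [|i code IH] s /=; first by rewrite addn0.
by move=> /andP[si sc]; rewrite IH // pc_straight // addSnnS.
Qed.

Lemma steps_execs code s :
  all straight code -> at_ (pc s) code -> steps s (size code) (execs code s).
Proof.
elim: code s => [|i code IH] s /=; first by move=> *; exact: steps0.
move=> /andP[si sc] h; rewrite -add1n.
apply: steps_trans (steps_one h) _; apply: IH => //.
by rewrite pc_straight //; have := @at_cat (pc s) [:: i] code h => -[_]; rewrite addn1.
Qed.

Lemma execs_cat c1 c2 s : execs (c1 ++ c2) s = execs c2 (execs c1 s).
Proof. exact: foldl_cat. Qed.

Lemma straight_compile_expr t e : all straight (compile_expr t e).
Proof. by elim: e t => //= e1 IH1 e2 IH2 t; rewrite !all_cat IH1 IH2. Qed.

Lemma straight_compile_keys t ks : all straight (compile_keys t ks).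
Proof.
by elim: ks t => //= -[e|r] ks IH t //; rewrite all_cat straight_compile_expr IH.
Qed.

Lemma ev_deg rho e : (forall r, rho r <= V) -> expr_regs e -> ev rho e <= V ^ expr_deg e.
Proof.
move=> le; have V1 : 1 < V by apply: leq_trans V_ge.
have V0 : 0 < V by apply: ltnW.
elim: e => /=.
- by rewrite expn1.
- by rewrite expn1 => c lt; apply: leq_trans V_ge; apply: ltnW.
- move=> e1 IH1 e2 IH2 /andP[/IH1 le1 /IH2 le2].
  rewrite expnS; apply: leq_trans (leq_mul V1 (leqnn _)).
  rewrite mul2n -addnn leq_add //.
    by apply: leq_trans le1 _; rewrite leq_exp2l // leq_maxl.
  by apply: leq_trans le2 _; rewrite leq_exp2l // leq_maxr.
- move=> e1 IH1 e2 IH2 /andP[/IH1 le1 /IH2 le2].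
  apply: leq_trans (leq_subr _ _) _.
  by apply: leq_trans le1 _; rewrite leq_exp2l // leq_maxl.
- move=> e1 IH1 e2 IH2 /andP[/IH1 le1 /IH2 le2].
  by rewrite expnD leq_mul.
move=> e1 IH1 e2 IH2 /andP[/IH1 le1 /IH2 le2].
apply: leq_trans (leq_div _ _) _.
by apply: leq_trans le1 _; rewrite leq_exp2l // leq_maxl.
Qed.

Definition sim s g :=
  [/\ forall r, r < temp0 -> ireg s r = ir g r, freg s =1 fr g,
      itab s =1 it g & ftab s =1 ft g].

(** Only temporaries from t on have changed. *)
Definition keeps t s s' :=
  [/\ forall r, r < t -> ireg s' r = ireg s r, freg s' = freg s,
      itab s' = itab s & ftab s' = ftab s].

Lemma keeps_trans t s1 s2 s3 : keeps t s1 s2 -> keeps t s2 s3 -> keeps t s1 s3.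
Proof.
move=> [a1 b1 c1 d1] [a2 b2 c2 d2]; split; rewrite ?b2 ?c2 ?d2 // => r lt.
by rewrite a2 // a1.
Qed.

Lemma keeps_reg t s s' r : keeps t s s' -> r < t -> ireg s' r = ireg s r.
Proof. by case=> H _ _ _; apply: H. Qed.

Lemma keepsW t t' s s' : t' <= t -> keeps t s s' -> keeps t' s s'.
Proof.
by move=> le [a b c d]; split => // r lt; apply: a; apply: leq_trans le.
Qed.

Lemma keeps_sim t s s' g : temp0 <= t -> keeps t s s' -> sim s g -> sim s' g.
Proof.
move=> le [a b c d] [h1 h2 h3 h4]; split; rewrite ?b ?c ?d // => r lt.
by rewrite a ?h1 //; apply: leq_trans le.
Qed.

Lemma execs_compile_expr g e t s : wf V g -> expr_wf e -> temp0 <= t -> sim s g ->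
  ireg (execs (compile_expr t e) s) t = ev (ir g) e /\ keeps t s (execs (compile_expr t e) s).
Proof.
move=> w; have evW e' : expr_wf e' -> ev (ir g) e' %% W = ev (ir g) e'.
  move=> /andP[rok dok]; apply: modn_small; apply: leq_ltn_trans W_gt.
  apply: leq_trans (ev_deg (proj1 w) rok) _.
  by rewrite leq_exp2l //; apply: leq_trans V_ge.
have bin e1 e2 t0 s0 o (f : nat -> nat -> nat) :
    (forall s, exec_instr W (o t0 t0 t0.+1) s =
       set_ireg W t0 (f (ireg s t0) (ireg s t0.+1)) s) ->
    f (ev (ir g) e1) (ev (ir g) e2) %% W = f (ev (ir g) e1) (ev (ir g) e2) ->
    (forall s, sim s g -> ireg (execs (compile_expr t0 e1) s) t0 = ev (ir g) e1 /\
        keeps t0 s (execs (compile_expr t0 e1) s)) ->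
    (forall s, sim s g -> ireg (execs (compile_expr t0.+1 e2) s) t0.+1 = ev (ir g) e2 /\
        keeps t0.+1 s (execs (compile_expr t0.+1 e2) s)) ->
    temp0 <= t0 -> sim s0 g ->
    ireg (execs (compile_expr t0 e1 ++ compile_expr t0.+1 e2 ++ [:: o t0 t0 t0.+1]) s0) t0 =
      f (ev (ir g) e1) (ev (ir g) e2) /\
    keeps t0 s0 (execs (compile_expr t0 e1 ++ compile_expr t0.+1 e2 ++ [:: o t0 t0 t0.+1]) s0).
  move=> Ho fW H1 H2 le sm; rewrite !execs_cat.
  have [E1 K1] := H1 _ sm.
  set s1 := execs (compile_expr t0 e1) s0 in E1 K1 *.
  have [E2 K2] := H2 _ (keeps_sim le K1 sm).
  set s2 := execs (compile_expr t0.+1 e2) s1 in E2 K2 *.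
  rewrite /execs /= Ho /= eqxx E2; case: (K2) => a _ _ _.
  rewrite a // E1 fW; split => //.
  apply: keeps_trans K1 _.
  apply: (@keeps_trans _ _ s2); first exact: keepsW K2.
  by split => //= r lt; rewrite ltn_eqF.
elim: e t s => //=.
- move=> r t s ok le sm; rewrite /execs /= !eqxx mod0n addn0.
  have rt : r < t by case/andP: ok => /= rb _; apply: leq_trans le.
  have -> : (r == t.+1) = false by rewrite ltn_eqF //; apply: ltnW.
  have rb : r < temp0 by case/andP: ok.
  case: (sm) => -> // _ _ _.
  rewrite (evW (EV r)) //; split => //; split => //= r' lt.
  by rewrite ltn_eqF // ltn_eqF //; apply: ltnW.
- move=> c t s ok le sm; rewrite /execs /= !eqxx (evW (EC c)) //.
  by split => //; split => //= r' lt; rewrite ltn_eqF.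
- move=> e1 IH1 e2 IH2 t s ok le sm.
  case/andP: (ok) => /= /andP[r1 r2] d.
  apply: (bin e1 e2 t s IAdd addn) => //; first by rewrite (evW (EAdd e1 e2)).
    move=> s' sm'; apply: IH1 => //; rewrite /expr_wf r1 /=; apply: leq_trans d.
    by apply: leqW; apply: leq_maxl.
  move=> s' sm'; apply: IH2 => //; last exact: leqW.
  rewrite /expr_wf r2 /=; apply: leq_trans d.
  by apply: leqW; apply: leq_maxr.
- move=> e1 IH1 e2 IH2 t s ok le sm.
  case/andP: (ok) => /= /andP[r1 r2] d.
  apply: (bin e1 e2 t s ISub subn) => //; first by rewrite (evW (ESub e1 e2)).
    move=> s' sm'; apply: IH1 => //; rewrite /expr_wf r1 /=; apply: leq_trans d.
    by apply: leq_maxl.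
  move=> s' sm'; apply: IH2 => //; last exact: leqW.
  rewrite /expr_wf r2 /=; apply: leq_trans d.
  by apply: leq_maxr.
- move=> e1 IH1 e2 IH2 t s ok le sm.
  case/andP: (ok) => /= /andP[r1 r2] d.
  apply: (bin e1 e2 t s IMul muln) => //; first by rewrite (evW (EMul e1 e2)).
    move=> s' sm'; apply: IH1 => //; rewrite /expr_wf r1 /=; apply: leq_trans d.
    exact: leq_addr.
  move=> s' sm'; apply: IH2 => //; last exact: leqW.
  rewrite /expr_wf r2 /=; apply: leq_trans d.
  exact: leq_addl.
move=> e1 IH1 e2 IH2 t s ok le sm.
case/andP: (ok) => /= /andP[r1 r2] d.
apply: (bin e1 e2 t s IDiv divn) => //; first by rewrite (evW (EDiv e1 e2)).
  move=> s' sm'; apply: IH1 => //; rewrite /expr_wf r1 /=; apply: leq_trans d.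
  by apply: leq_maxl.
move=> s' sm'; apply: IH2 => //; last exact: leqW.
rewrite /expr_wf r2 /=; apply: leq_trans d.
by apply: leq_maxr.
Qed.

Lemma execs_compile_keys g ks t s : wf V g -> all key_wf ks -> temp0 <= t -> sim s g ->
  let s' := execs (compile_keys t ks) s in
  (forall s'', keeps (t + size ks) s' s'' ->
     forall n, cell_at s'' n (key_regs t ks) = (n, [seq kval g k | k <- ks])) /\
  keeps t s s'.
Proof.
move=> w; elim: ks t s => [|k ks IH] t s /=.
  by move=> _ le sm; split => //; split.
move=> /andP[ok oks] le sm.
case: k ok => [e|r] ok /=.
  rewrite execs_cat.
  have [E1 K1] := execs_compile_expr w ok le sm.
  set s1 := execs (compile_expr t e) s in E1 K1 *.
  have le' : temp0 <= t.+1 by apply: leqW.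
  have [C K2] := IH t.+1 s1 oks le' (keeps_sim le K1 sm).
  split; last by apply: keeps_trans K1 _; apply: keepsW K2.
  move=> s'' K3 n; rewrite addnS -addSn in K3.
  have := C _ K3 n; rewrite /cell_at => -[/= ->].
  rewrite (keeps_reg K3) ?(keeps_reg K2) ?E1 //; lia.
have le' : temp0 <= t.+1 by apply: leqW.
have [C K2] := IH t.+1 s oks le' sm.
split; last by apply: keepsW K2.
move=> s'' K3 n; rewrite addnS -addSn in K3.
have := C _ K3 n; rewrite /cell_at => -[/= ->].
by case: K3 => _ -> _ _; case: K2 => _ -> _ _; case: sm => _ -> _ _.
Qed.

(** The temporaries below t, which hold the counters of the enclosing loops, are
preserved. *)
Definition simulates g' t s T s' := [/\ steps s T s', sim s' g' &
  forall r, temp0 <= r < t -> ireg s' r = ireg s r].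

Lemma V_ltW x : x <= V -> x %% W = x.
Proof.
move=> le; apply: modn_small; apply: leq_ltn_trans W_gt.
apply: leq_trans le _; rewrite -{1}(expn1 V) leq_exp2l //.
by apply: leq_trans V_ge.
Qed.

Lemma sim_pc s g l : sim s g -> sim (set_pc l s) g. Proof. by []. Qed.

Lemma sim_ireg s g r v : v <= V -> r < temp0 -> sim s g ->
  sim (set_ireg W r v s) (seti r v g).
Proof.
move=> le rb [h1 h2 h3 h4]; split => //= x xb.
by case: eqP => // _; [rewrite V_ltW|apply: h1].
Qed.

Definition correct c := forall p t s g, temp0 <= t -> cmd_wf c -> wf V g ->
  safe V c g -> sim s g -> pc s = p -> at_ p (compile p t c) ->
  exists s', simulates (run c g) t s (cost c g) s' /\ pc s' = p + code_size c.

(** Both kinds of conditionals are compiled to the same layout. *)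
Lemma branch c1 c2 (b : bool) t s g p1 : correct c1 -> correct c2 ->
  temp0 <= t -> cmd_wf c1 -> cmd_wf c2 -> wf V g ->
  (if b then safe V c1 g else safe V c2 g) -> sim s g ->
  forall p2, pc s = (if b then p1 else p2) ->
  at_ p2 (compile p2 t c2 ++ [:: JumpFeq 0 0 (p1 + code_size c1)] ++ compile p1 t c1) ->
  p1 = p2 + code_size c2 + 1 ->
  exists s', simulates (if b then run c1 g else run c2 g) t s
    (if b then cost c1 g else cost c2 g + 1) s' /\ pc s' = p1 + code_size c1.
Proof.
move=> IH1 IH2 le ok1 ok2 w sf sm p2 Ep + E1.
move=> /at_cat[hd]; rewrite size_compile => /at_cat[he hf].
rewrite -E1 /= in hf; case: b sf Ep => sf Ep.
  by apply: IH1.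
have [s1 [[X1 sm1 k1] P1]] := IH2 _ _ _ _ le ok2 w sf sm Ep hd.
rewrite -P1 in he; have X2 := steps_one he; rewrite /= eqxx in X2.
exists (set_pc (p1 + code_size c1) s1); split => //; split => //.
exact: steps_trans X1 X2.
Qed.

(** The subexpressions of a well-formed command have degree at most max_deg in
registers bounded by V, so no word overflows. *)
Theorem compile_correct c : correct c.
Proof.
rewrite /correct.
elim: c => /=.
- move=> p t s g le _ w _ sm Ep _; exists s; split; last by rewrite addn0.
  by split.
- move=> c1 IH1 c2 IH2 p t s g le /andP[ok1 ok2] w [sf1 sf2] sm Ep.
  move=> /at_cat; rewrite size_compile => -[h1 h2].
  have [s1 [[st1 sm1 k1] P1]] := IH1 _ _ _ _ le ok1 w sf1 sm Ep h1.
  have [s2 [[st2 sm2 k2] P2]] :=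
    IH2 _ _ _ _ le ok2 (wf_run w sf1) sf2 sm1 P1 h2.
  exists s2; split; last by rewrite P2 addnA.
  split => //; first exact: steps_trans st1 st2.
  by move=> r lt; rewrite k2 // k1.
- move=> r e p t s g le /andP[rb ok] w sf sm Ep h; subst p.
  set code := _ ++ _ in h.
  have st : all straight code by rewrite all_cat straight_compile_expr.
  exists (execs code s); rewrite pc_execs // size_cat size_compile_expr; split => //.
  have [E1 K1] := execs_compile_expr w ok le sm.
  have rt : r < t by apply: leq_trans le.
  split.
  - by have := steps_execs st h; rewrite size_cat size_compile_expr.
  - rewrite execs_cat /execs /= -/(execs _ _).
    set s1 := execs (compile_expr t e) s in E1 K1 *.
    have [h1 h2 h3 h4] := keeps_sim le K1 sm.
    split => //= x xb; rewrite eqxx mod0n addn0.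
    have -> : (t == t.+1) = false by rewrite ltn_eqF.
    rewrite E1 V_ltW //; case: eqP => // _.
    rewrite h1 // ltn_eqF // ltnS; apply: ltnW; exact: leq_trans le.
  move=> x /andP[xb xt]; rewrite execs_cat /execs /= -/(execs _ _).
  rewrite [x == r]gtn_eqF ?(leq_trans rb) // ltn_eqF ?(keeps_reg K1) //.
  exact: ltnW.
- move=> r n ks p t s g le /andP[rb ok] w sf sm Ep h; subst p.
  set code := _ ++ _ in h.
  have st : all straight code by rewrite all_cat straight_compile_keys.
  exists (execs code s); rewrite pc_execs // size_cat size_compile_keys; split => //.
  have [C K1] := execs_compile_keys w ok le sm.
  split.
  - by have := steps_execs st h; rewrite size_cat size_compile_keys.
  - rewrite execs_cat /execs /= -/(execs _ _).
    have -> := C _ _ n; last by split.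
    set s1 := execs _ s in C K1 *.
    have sm1 := keeps_sim le K1 sm.
    have [h1 h2 h3 h4] := sm1.
    by rewrite h3; apply: sim_ireg => //; apply: (proj2 w).
  move=> x /andP[xb xt]; rewrite execs_cat /execs /= -/(execs _ _).
  rewrite gtn_eqF ?(leq_trans rb) //; by rewrite (keeps_reg K1).
- move=> n ks e p t s g le /andP[ok oe] w sf sm Ep h; subst p.
  set code := _ ++ _ in h.
  have st : all straight code.
    by rewrite !all_cat straight_compile_keys straight_compile_expr.
  have sz : size code = sumn (map key_cost ks) + expr_cost e + 1.
    by rewrite !size_cat size_compile_keys size_compile_expr addnA.
  exists (execs code s); rewrite pc_execs // sz; split => //.
  have [C K1] := execs_compile_keys w ok le sm.
  set s1 := execs _ s in C K1 *.
  have le' : temp0 <= t + size ks by apply: leq_trans (leq_addr _ _).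
  have sm1 := keeps_sim le K1 sm.
  have [E2 K2] := execs_compile_expr w oe le' sm1.
  set s2 := execs _ s1 in E2 K2 *.
  have [h1 h2 h3 h4] := keeps_sim le' K2 sm1.
  have Ec : execs code s = set_itab (cell_at s2 n (key_regs t ks)) (ireg s2 (t + size ks)) s2.
    by rewrite /code !execs_cat.
  rewrite Ec; split.
  - by have := steps_execs st h; rewrite sz Ec.
  - rewrite C // E2; split => //=; exact: eta_ext.
  move=> x /andP[xb xt] /=.
  rewrite (keeps_reg K2) ?(keeps_reg K1) //.
  by apply: leq_trans (leq_addr _ _).
- move=> r b p t s g le _ w sf [h1 h2 h3 h4] Ep h; subst p.
  exists (set_freg r (b%:R)%R s); split; last by rewrite addn1.
  split; last by [].
    by have := steps_one h; case: (b).
  by split => //=; apply: eta_ext.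
- move=> o r u v p t s g le _ w sf [h1 h2 h3 h4] Ep h; subst p.
  exists (set_freg r (fopv o (freg s u) (freg s v)) s); split; last by rewrite addn1.
  have E : exec_instr W (compile_op o r u v) s = set_freg r (fopv o (freg s u) (freg s v)) s.
    by case: o {h}.
  split; first by rewrite -E; apply: steps_one h.
    by rewrite !h2; split => //=; apply: eta_ext.
  by [].
- move=> r n ks p t s g le ok w sf sm Ep h; subst p.
  set code := _ ++ _ in h.
  have st : all straight code by rewrite all_cat straight_compile_keys.
  exists (execs code s); rewrite pc_execs // size_cat size_compile_keys; split => //.
  have [C K1] := execs_compile_keys w ok le sm.
  split.
  - by have := steps_execs st h; rewrite size_cat size_compile_keys.
  - rewrite execs_cat /execs /= -/(execs _ _).
    have -> := C _ _ n; last by split.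
    set s1 := execs _ s in C K1 *.
    have [h1 h2 h3 h4] := keeps_sim le K1 sm.
    by rewrite h4; split => //=; apply: eta_ext.
  move=> x /andP[xb xt]; rewrite execs_cat /execs /= -/(execs _ _).
  by rewrite (keeps_reg K1).
- move=> n ks r p t s g le ok w sf sm Ep h; subst p.
  set code := _ ++ _ in h.
  have st : all straight code by rewrite all_cat straight_compile_keys.
  exists (execs code s); rewrite pc_execs // size_cat size_compile_keys; split => //.
  have [C K1] := execs_compile_keys w ok le sm.
  split.
  - by have := steps_execs st h; rewrite size_cat size_compile_keys.
  - rewrite execs_cat /execs /= -/(execs _ _).
    have -> := C _ _ n; last by split.
    set s1 := execs _ s in C K1 *.
    have [h1 h2 h3 h4] := keeps_sim le K1 sm.
    by rewrite h2; split => //=; exact: eta_ext.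
  move=> x /andP[xb xt]; rewrite execs_cat /execs /= -/(execs _ _).
  by rewrite (keeps_reg K1).
- move=> e1 e2 c1 IH1 c2 IH2 p t s g le /and4P[ok1 ok2 okc1 okc2] w sf sm Ep.
  subst p; set p2 := pc s + _ + 1; set p1 := p2 + _ + 1.
  rewrite -[_ :: _ ++ _]/([:: _] ++ _ ++ [:: _] ++ _).
  move=> /at_cat[ha]; rewrite size_compile_expr => /at_cat[hb]; rewrite size_compile_expr.
  move=> /at_cat[hc hd].
  have [E1 K1] := execs_compile_expr w ok1 le sm.
  have X1 := steps_execs (straight_compile_expr t e1) ha.
  have P1 := pc_execs s (straight_compile_expr t e1).
  rewrite size_compile_expr in X1 P1; set s1 := execs _ s in E1 K1 X1 P1.
  have sm1 := keeps_sim le K1 sm; have le' : temp0 <= t.+1 by apply: leqW.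
  have [E2 K2] := execs_compile_expr w ok2 le' sm1.
  rewrite -P1 in hb; have X2 := steps_execs (straight_compile_expr t.+1 e2) hb.
  have P2 := pc_execs s1 (straight_compile_expr t.+1 e2).
  rewrite size_compile_expr in X2 P2; set s2 := execs _ s1 in E2 K2 X2 P2.
  have sm2 := keeps_sim le' K2 sm1.
  have Q2 : pc s2 = pc s + expr_cost e1 + expr_cost e2 by rewrite P2 P1.
  rewrite -Q2 in hc; have X3 := steps_one hc.
  rewrite /= in X3; have E1' : ireg s2 t = ev (ir g) e1 by rewrite (keeps_reg K2).
  rewrite E1' E2 in X3.
  have k2 r : temp0 <= r < t -> ireg s2 r = ireg s r.
    move=> /andP[rb rt]; rewrite (keeps_reg K2) ?(keeps_reg K1) //.
    exact: ltnW.
  have Ep2 : (pc s2).+1 = p2 by rewrite Q2 /p2; lia.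
  have hd2 : at_ p2 (compile p2 t c2 ++ [:: JumpFeq 0 0 (p1 + code_size c1)] ++ compile p1 t c1).
    by move: hd; congr at_; rewrite /p2 /=; lia.
  rewrite Ep2 in X3.
  have [s' [[X st k] P]] := branch IH1 IH2 le okc1 okc2 w sf
    (sim_pc (if ev (ir g) e1 < ev (ir g) e2 then p1 else p2) sm2)
    (erefl _) hd2 (erefl _).
  exists s'; split; last by rewrite P /p1 /p2; lia.
  split => //; last by move=> r lr; rewrite k //= k2.
  have := steps_trans X1 (steps_trans X2 (steps_trans X3 X)).
  by congr steps; lia.
- move=> u v c1 IH1 c2 IH2 p t s g le /andP[okc1 okc2] w sf sm Ep.
  subst p; set p2 := pc s + 1; set p1 := p2 + _ + 1.
  rewrite -[_ :: _ ++ _]/([:: _] ++ _ ++ [:: _] ++ _) => h.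
  have /at_cat[_ hd] := h; have X3 := steps_one h.
  case: (sm) => _ h2 _ _; rewrite /= !h2 -[(pc s).+1]addn1 -/p2 in X3.
  have [s' [[X st k] P]] := branch IH1 IH2 le okc1 okc2 w sf
    (sim_pc (if fr g u == fr g v then p1 else p2) sm)
    (erefl _) hd (erefl _).
  exists s'; split; last by rewrite P /p1 /p2; lia.
  by split => //; apply: steps_trans X3 X.
move=> r e c IH p t s g le /and3P[rb oke okc] w [sv sf] sm Ep; subst p.
set l := pc s + expr_cost e + 1; set n := ev (ir g) e in sv sf *.
move=> /at_cat[ha]; rewrite size_compile_expr.
rewrite -[_ :: _]/([:: _] ++ [:: _] ++ [:: _] ++ [:: _; _] ++ _ ++ [:: _; _; _]).
move=> /at_cat[hb] /at_cat[hc] /at_cat[hd] /at_cat[he] /at_cat[hf hg].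
rewrite size_compile in hg.
have [E1 K1] := execs_compile_expr w oke le sm.
have X1 := steps_execs (straight_compile_expr t e) ha.
have P1 := pc_execs s (straight_compile_expr t e).
rewrite size_compile_expr in X1 P1; set s1 := execs _ s in E1 K1 X1 P1.
rewrite -P1 in hb; have X2 := steps_one hb.
set s2 := exec_instr _ _ _ in X2; have P2 : pc s2 = l by rewrite /= P1 /l addn1.
have sm2 : sim s2 g.
  have [h1 h2 h3 h4] := keeps_sim le K1 sm; split => //= x xb.
  by rewrite ltn_eqF ?h1 // ltnS; apply: ltnW; apply: leq_trans le.
have k2 x : temp0 <= x < t -> ireg s2 x = ireg s x.
  move=> /andP[xb xt] /=; rewrite ltn_eqF; last exact: ltnW.
  by rewrite (keeps_reg K1).
have c2 : ireg s2 t.+1 = 0 by rewrite /= eqxx mod0n.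
have n2 : ireg s2 t = n by rewrite /= ltn_eqF.
have W0 : 1 < W.
  by apply: leq_ltn_trans W_gt; rewrite expn_gt0; lia.
have loop i : i <= n -> exists s', [/\ simulates (loopst r c i g) t s2
    (\sum_(j < i) (cost c (seti r j (loopst r c j g)) + 6)) s', pc s' = l,
    ireg s' t = n, ireg s' t.+1 = i & wf V (loopst r c i g)].
  elim: i => [|i IHi] lei.
    exists s2; split=> //; rewrite big_ord0; split=> //; exact: steps0.
  have [s3 [[X3 sm3 k3] P3 n3 c3 w3]] := IHi (ltnW lei).
  have hc3 : at_ (pc s3) [:: JumpLt t.+1 t (l + 2)].
    by move: hc; congr at_; rewrite P3 /l /=; lia.
  have X4 := steps_one hc3; rewrite /= n3 c3 lei in X4.
  set s4 := set_pc _ _ in X4; have P4 : pc s4 = l + 2 by [].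
  have he4 : at_ (pc s4) [:: IConst t.+2 0; IAdd r t.+1 t.+2].
    by move: he; congr at_; rewrite P4 /= /l; lia.
  have X5 := @steps_execs [:: IConst t.+2 0; IAdd r t.+1 t.+2] s4 isT he4;
    rewrite /execs /= eqxx mod0n addn0 in X5.
  set s5 := set_ireg _ _ _ _ in X5.
  have P5 : pc s5 = l + 4 by rewrite /= /l; lia.
  have iV : i <= V by apply: leq_trans sv; apply: ltnW.
  have sm5 : sim s5 (seti r i (loopst r c i g)).
    rewrite /s5 [t.+1 == _]ltn_eqF // c3; apply: sim_ireg => //.
    case: sm3 => h1 h2 h3 h4; split => //= x xb.
    rewrite ltn_eqF ?h1 //; lia.
  have hf5 : at_ (l + 4) (compile (l + 4) t.+2 c).
    by move: hf; congr at_; rewrite /= /l; lia.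
  have w5 : wf V (seti r i (loopst r c i g)).
    by case: w3 => w31 w32; split => // x /=; case: ifP.
  have le2 : temp0 <= t.+2 by apply: leqW; apply: leqW.
  have [s6 [[X6 sm6 k6] P6]] := IH _ _ _ _ le2 okc w5 (sf _ lei) sm5 P5 hf5.
  have hg6 : at_ (pc s6) ([:: IConst t.+2 1; IAdd t.+1 t.+1 t.+2] ++
      [:: JumpFeq 0 0 l]).
    by move: hg; congr at_; rewrite P6 /= /l; lia.
  have /at_cat[hh hi] := hg6.
  have X7 := @steps_execs [:: IConst t.+2 1; IAdd t.+1 t.+1 t.+2] s6 isT hh;
    rewrite /execs /= in X7.
  rewrite eqxx [t.+1 == _]ltn_eqF // modn_small // in X7.
  have t1r : (t.+1 == r) = false by rewrite gtn_eqF //; lia.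
  have tr : (t == r) = false by rewrite gtn_eqF //; lia.
  have c6 : ireg s6 t.+1 = i.
    rewrite k6; last by lia.
    by rewrite /= t1r ltn_eqF.
  have n6 : ireg s6 t = n.
    rewrite k6; last by lia.
    by rewrite /= tr ltn_eqF //; apply: leqnSn.
  rewrite c6 addn1 in X7; set s7 := set_ireg _ _ _ _ in X7.
  have P7 : pc s7 = pc s6 + 2 by rewrite /= addn2.
  rewrite -P7 in hi; have X8 := steps_one hi; rewrite /= eqxx in X8.
  exists (set_pc l s7); split => //.
  - split.
    + have := steps_trans X3 (steps_trans X4 (steps_trans X5 (steps_trans X6 (steps_trans X7 X8)))).
      by congr steps; rewrite big_ord_recr /=; lia.
    + rewrite /loopst iteriS -/(loopst r c i g).
      case: sm6 => h1 h2 h3 h4; split => //= x xb.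
      have -> : (x == t.+1) = false by rewrite ltn_eqF //; lia.
      have -> : (x == t.+2) = false by rewrite ltn_eqF //; lia.
      by rewrite h1.
    + move=> x /andP[xb xt] /=.
      have -> : (x == t.+1) = false by rewrite ltn_eqF //; lia.
      have -> : (x == t.+2) = false by rewrite ltn_eqF //; lia.
      rewrite k6; last by lia.
      rewrite /= [x == r]gtn_eqF; last by lia.
      rewrite ltn_eqF; last by lia.
      rewrite k3; last by lia.
      by rewrite /= ltn_eqF //; lia.
  - rewrite /= !ltn_eqF //; lia.
  - by rewrite /= eqxx V_ltW //; lia.
  rewrite /loopst iteriS; apply: wf_run => //; exact: sf.
have [s3 [[X3 sm3 k3] P3 n3 c3 w3]] := loop n (leqnn _).
have hc3 : at_ (pc s3) [:: JumpLt t.+1 t (l + 2)].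
  by move: hc; congr at_; rewrite P3 /l /=; lia.
have X4 := steps_one hc3; rewrite /= n3 c3 ltnn in X4.
set s4 := set_pc _ _ in X4.
have hd4 : at_ (pc s4) [:: JumpFeq 0 0 (l + 7 + code_size c)].
  by move: hd; congr at_; rewrite /= P3 /l; lia.
have X5 := steps_one hd4; rewrite /= eqxx in X5.
exists (set_pc (l + 7 + code_size c) s4); split; last by rewrite /= /l; lia.
split => //; last by move=> x lx; rewrite /= k3 ?k2.
have := steps_trans X1 (steps_trans X2 (steps_trans X3 (steps_trans X4 X5))).
congr steps; rewrite -/n; set S := \sum_(_ < _) _; lia.
Qed.

End Compile.

(** * Program logic *)

(** The registers and the tables to which a command may write are computed from its
text; frame conditions for concrete commands then hold by computation. *)
Fixpoint mod_ireg (c : cmd) : seq nat :=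
  match c with
  | Seq c1 c2 | IfLt _ _ c1 c2 | IfFeq _ _ c1 c2 => mod_ireg c1 ++ mod_ireg c2
  | ISet r _ | ILd r _ _ => [:: r]
  | For r _ c => r :: mod_ireg c
  | _ => [::]
  end.

Fixpoint mod_freg (c : cmd) : seq nat :=
  match c with
  | Seq c1 c2 | IfLt _ _ c1 c2 | IfFeq _ _ c1 c2 => mod_freg c1 ++ mod_freg c2
  | FCst r _ | FBin _ r _ _ | FLd r _ _ => [:: r]
  | For _ _ c => mod_freg c
  | _ => [::]
  end.

Fixpoint mod_itab (c : cmd) : seq nat :=
  match c with
  | Seq c1 c2 | IfLt _ _ c1 c2 | IfFeq _ _ c1 c2 => mod_itab c1 ++ mod_itab c2
  | ISt t _ _ => [:: t]
  | For _ _ c => mod_itab c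
  | _ => [::]
  end.

Fixpoint mod_ftab (c : cmd) : seq nat :=
  match c with
  | Seq c1 c2 | IfLt _ _ c1 c2 | IfFeq _ _ c1 c2 => mod_ftab c1 ++ mod_ftab c2
  | FSt t _ _ => [:: t]
  | For _ _ c => mod_ftab c
  | _ => [::]
  end.

Fixpoint loopfree (c : cmd) : bool :=
  match c with
  | Seq c1 c2 | IfLt _ _ c1 c2 | IfFeq _ _ c1 c2 => loopfree c1 && loopfree c2
  | For _ _ _ => false
  | _ => true
  end.

(** A bound for loop-free commands; it adds up both branches of a conditional
instead of taking their maximum. *)
Fixpoint static_cost (c : cmd) : nat :=
  match c with
  | Seq c1 c2 => static_cost c1 + static_cost c2
  | ISet r e => expr_cost e + 2
  | ILd r t ks => sumn (map key_cost ks) + 1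
  | ISt t ks e => sumn (map key_cost ks) + expr_cost e + 1
  | FLd _ _ ks => sumn (map key_cost ks) + 1
  | FSt _ ks _ => sumn (map key_cost ks) + 1
  | IfLt e1 e2 c1 c2 => expr_cost e1 + expr_cost e2 + 2 + (static_cost c1 + static_cost c2)
  | IfFeq u v c1 c2 => 2 + (static_cost c1 + static_cost c2)
  | _ => 1
  end.

Fixpoint evars (e : iexpr) : seq nat :=
  match e with
  | EV r => [:: r]
  | EC _ => [::]
  | EAdd e1 e2 | ESub e1 e2 | EMul e1 e2 | EDiv e1 e2 => evars e1 ++ evars e2
  end.

Lemma ev_ext rho rho' e :
  (forall r, r \in evars e -> rho r = rho' r) -> ev rho e = ev rho' e.
Proof.
elim: e => //=.
- by move=> r H; apply: H; rewrite inE.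
- by move=> e1 IH1 e2 IH2 H; rewrite IH1 ?IH2 // => r rin; apply: H; rewrite mem_cat rin ?orbT.
- by move=> e1 IH1 e2 IH2 H; rewrite IH1 ?IH2 // => r rin; apply: H; rewrite mem_cat rin ?orbT.
- by move=> e1 IH1 e2 IH2 H; rewrite IH1 ?IH2 // => r rin; apply: H; rewrite mem_cat rin ?orbT.
by move=> e1 IH1 e2 IH2 H; rewrite IH1 ?IH2 // => r rin; apply: H; rewrite mem_cat rin ?orbT.
Qed.

Lemma map_ev_ext rho rho' es :
  (forall r, r \in flatten (map evars es) -> rho r = rho' r) ->
  map (ev rho) es = map (ev rho') es.
Proof.
elim: es => //= e es IH H; congr cons.
  by apply: ev_ext => r rin; apply: H; rewrite mem_cat rin.
by apply: IH => r rin; apply: H; rewrite mem_cat rin orbT.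
Qed.

Section Logic.
Variables (F : finFieldType) (V : nat).
Implicit Types (s : store F) (c : cmd).

Record eqoff (c : cmd) s s' : Prop := EqOff {
  eo_i : forall r, r \notin mod_ireg c -> ir s' r = ir s r;
  eo_f : forall r, r \notin mod_freg c -> fr s' r = fr s r;
  eo_it : forall t ks, t \notin mod_itab c -> it s' (t, ks) = it s (t, ks);
  eo_ft : forall t ks, t \notin mod_ftab c -> ft s' (t, ks) = ft s (t, ks)
}.

Definition submods c c' := [/\ {subset mod_ireg c <= mod_ireg c'},
  {subset mod_freg c <= mod_freg c'},
  {subset mod_itab c <= mod_itab c'} & {subset mod_ftab c <= mod_ftab c'}].

Lemma eqoff_trans c s1 s2 s3 : eqoff c s1 s2 -> eqoff c s2 s3 -> eqoff c s1 s3.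
Proof.
case=> a1 b1 c1 d1 [a2 b2 c2 d2].
by split=> *; rewrite ?a2 ?b2 ?c2 ?d2 ?a1 ?b1 ?c1 ?d1.
Qed.

Lemma eqoffW c c' s1 s2 : submods c c' -> eqoff c s1 s2 -> eqoff c' s1 s2.
Proof.
case=> a b d e [a1 b1 d1 e1].
split=> [r|r|t ks|t ks] nin.
- by apply: a1; apply: contra nin; exact: a.
- by apply: b1; apply: contra nin; exact: b.
- by apply: d1; apply: contra nin; exact: d.
by apply: e1; apply: contra nin; exact: e.
Qed.

Lemma submods_catl c1 c2 : submods c1 (Seq c1 c2).
Proof. by split=> r rin; rewrite mem_cat rin. Qed.

Lemma submods_catr c1 c2 : submods c2 (Seq c1 c2).
Proof. by split=> r rin; rewrite mem_cat rin orbT. Qed.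

Lemma submods_for r e c : submods c (For r e c).
Proof. by split=> x //= xin; rewrite inE xin orbT. Qed.

Lemma eqoff_seti r v c s : r \in mod_ireg c -> eqoff c s (seti r v s).
Proof. by move=> rin; split=> //= x xin; case: eqP => // E; rewrite E rin in xin. Qed.

Lemma run_eqoff c s : eqoff c s (run c s).
Proof.
elim: c s => //=.
- move=> c1 IH1 c2 IH2 s; apply: (@eqoff_trans _ _ (run c1 s)).
    exact: eqoffW (submods_catl _ _) (IH1 s).
  exact: eqoffW (submods_catr _ _) (IH2 _).
- by move=> r e s; split=> //= x; rewrite inE; case: eqP.
- by move=> r n ks s; split=> //= x; rewrite inE; case: eqP.
- move=> n ks e s; split=> //= t ks'; rewrite inE => ne.
  by rewrite xpair_eqE (negbTE ne).
- by move=> r b s; split=> //= x; rewrite inE; case: eqP.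
- by move=> o r u v s; split=> //= x; rewrite inE; case: eqP.
- by move=> r n ks s; split=> //= x; rewrite inE; case: eqP.
- move=> n ks e s; split=> //= t ks'; rewrite inE => ne.
  by rewrite xpair_eqE (negbTE ne).
- move=> e1 e2 c1 IH1 c2 IH2 s; case: ifP => _.
    exact: eqoffW (submods_catl c1 c2 : submods c1 (IfLt e1 e2 c1 c2)) (IH1 s).
  exact: eqoffW (submods_catr c1 c2 : submods c2 (IfLt e1 e2 c1 c2)) (IH2 s).
- move=> e1 e2 c1 IH1 c2 IH2 s; case: ifP => _.
    exact: eqoffW (submods_catl c1 c2 : submods c1 (IfFeq e1 e2 c1 c2)) (IH1 s).
  exact: eqoffW (submods_catr c1 c2 : submods c2 (IfFeq e1 e2 c1 c2)) (IH2 s).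
move=> r e c IH s; elim: (ev _ e) => // n IHn; rewrite iteriS.
apply: eqoff_trans IHn _; set s1 := iteri n _ s.
apply: (@eqoff_trans _ _ (seti r n s1)).
  by apply: eqoff_seti; rewrite /= inE eqxx.
exact: eqoffW (submods_for _ _ _) (IH _).
Qed.

(** Total correctness with a bound on the running time. *)
Definition ok c s (T : nat) (Q : store F -> Prop) :=
  [/\ safe V c s, cost c s <= T & Q (run c s)].

Lemma ok_conseq c s T T' (Q Q' : store F -> Prop) :
  ok c s T' Q' -> T' <= T -> (forall s', eqoff c s s' -> Q' s' -> Q s') ->
  ok c s T Q.
Proof.
case=> h1 h2 h3 le H; split=> //; first exact: leq_trans le.
by apply: H => //; exact: run_eqoff.
Qed.

Lemma ok_seq c1 c2 s T1 T2 T Q1 (Q : store F -> Prop) :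
  ok c1 s T1 Q1 -> (forall s1, eqoff c1 s s1 -> Q1 s1 -> ok c2 s1 T2 Q) ->
  T1 + T2 <= T -> ok (Seq c1 c2) s T Q.
Proof.
case=> h1 h2 h3 H le; have [h4 h5 h6] := H _ (run_eqoff _ _) h3.
split=> //=; apply: leq_trans le; exact: leq_add.
Qed.

Lemma ok_lf c s (Q : store F -> Prop) :
  loopfree c -> safe V c s -> Q (run c s) -> ok c s (static_cost c) Q.
Proof.
move=> lf sf q; split=> // {sf q}.
elim: c lf s => //=.
- by move=> c1 IH1 c2 IH2 /andP[l1 l2] s; rewrite leq_add ?IH1 ?IH2.
- move=> e1 e2 c1 IH1 c2 IH2 /andP[l1 l2] s; rewrite -!addnA !leq_add2l.
  have := IH1 l1 s; have := IH2 l2 s; case: ifP => _; lia.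
move=> u v c1 IH1 c2 IH2 /andP[l1 l2] s.
have := IH1 l1 s; have := IH2 l2 s; case: ifP => _; lia.
Qed.

Lemma ok_for r e c s n T Tb (Inv : nat -> store F -> Prop) (Q : store F -> Prop) :
  ev (ir s) e = n -> n <= V -> Inv 0 s ->
  (forall i s', i < n -> eqoff (For r e c) s s' -> Inv i s' ->
     ok c (seti r i s') Tb (Inv i.+1)) ->
  (forall s', eqoff (For r e c) s s' -> Inv n s' -> Q s') ->
  expr_cost e + 3 + n * (Tb + 6) <= T ->
  ok (For r e c) s T Q.
Proof.
move=> En nV I0 H HQ le.
have L i : i <= n -> Inv i (loopst r c i s) /\ eqoff (For r e c) s (loopst r c i s).
  elim: i => // i IHi lei; have [I1 E1] := IHi (ltnW lei).
  have [_ _ q] := H _ _ lei E1 I1; rewrite /loopst iteriS; split=> //.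
  apply: eqoff_trans E1 _.
  apply: (@eqoff_trans _ _ (seti r i (loopst r c i s))).
    by apply: eqoff_seti; rewrite /= inE eqxx.
  exact: eqoffW (submods_for _ _ _) (run_eqoff _ _).
split=> /=; rewrite En.
- split=> // i lei; have [I1 E1] := L _ (ltnW lei).
  by case: (H _ _ lei E1 I1).
- apply: leq_trans le; rewrite leq_add2l.
  rewrite -[n in n * _]card_ord -sum_nat_const; apply: leq_sum => i _.
  have [I1 E1] := L _ (ltnW (ltn_ord i)).
  by rewrite leq_add2r; case: (H _ _ (ltn_ord i) E1 I1).
by have [I1 E1] := L n (leqnn _); apply: HQ.
Qed.

(** The body b leaves the summand in field register 1. *)
Definition sumc (r : nat) (e : iexpr) (b : cmd) : cmd :=
  Seq (FCst 0 false) (For r e (Seq b (FBin OpAdd 0 0 1))).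

Lemma ok_sumc r e b s n Tb (g : nat -> F) :
  ev (ir s) e = n -> n <= V -> 0 \notin mod_freg b ->
  (forall i s', i < n -> eqoff (sumc r e b) s s' ->
      ok b (seti r i s') Tb (fun s2 => fr s2 1 = g i)) ->
  ok (sumc r e b) s (expr_cost e + 4 + n * (Tb + 7))
    (fun s' => fr s' 0 = \sum_(i < n) g i)%R.
Proof.
move=> En nV nb H.
apply: (@ok_seq _ _ _ 1 (expr_cost e + 3 + n * (Tb + 1 + 6)) _
  (fun s1 => fr s1 0 = 0)%R) => //; last by lia.
move=> s1 E1 z1.
apply: (@ok_for r e _ s1 n _ (Tb + 1) (fun i s' => fr s' 0 = \sum_(j < i) g j)%R) => //.
- by rewrite -En; apply: ev_ext => x _; rewrite (eo_i E1).
- by rewrite big_ord0.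
move=> i s' lei E2 I2.
have E : eqoff (sumc r e b) s s'.
  apply: (@eqoff_trans _ _ s1); first exact: eqoffW (submods_catl _ _) E1.
  exact: eqoffW (submods_catr _ _) E2.
apply: (ok_seq (T2 := 1)) (H i s' lei E) _ _ => // s2 E3 g3.
split=> //=; rewrite g3 (eo_f E3) //= I2 big_ord_recr //.
Qed.

Fixpoint nest (rs : seq (nat * iexpr)) (b : cmd) : cmd :=
  if rs is re :: rs' then For re.1 re.2 (nest rs' b) else b.

(** The body b leaves in field register 0 the entry for the current values of the
loop registers; the prefix pre of the keys is constant. *)
Definition fill (tab : nat) (pre : seq iexpr) (rs : seq (nat * iexpr)) (b : cmd) :=
  nest rs (Seq b (FSt tab (map KE pre ++ [seq KE (EV x.1) | x <- rs]) 0)).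

Definition box (ns idx : seq nat) := all2 ltn idx ns.

(** The overhead per entry, including that of the nested loops. *)
Definition fillK (pre : seq iexpr) (rs : seq (nat * iexpr)) : nat :=
  sumn (map key_cost (map KE pre ++ [seq KE (EV x.1) | x <- rs])) + 1 +
  sumn [seq expr_cost x.2 + 9 | x <- rs].

Definition ikey (l : seq nat) : seq (nat + F) := map inl l.

Lemma ikey_inj : injective ikey.
Proof. by apply: inj_map => x y []. Qed.

Lemma mod_ireg_nest rs b : mod_ireg (nest rs b) = map fst rs ++ mod_ireg b.
Proof. by elim: rs => //= x rs ->. Qed.

Lemma mod_freg_nest rs b : mod_freg (nest rs b) = mod_freg b.
Proof. by elim: rs => //= x rs ->. Qed.

Lemma mod_itab_nest rs b : mod_itab (nest rs b) = mod_itab b.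
Proof. by elim: rs => //= x rs ->. Qed.

Lemma mod_ftab_nest rs b : mod_ftab (nest rs b) = mod_ftab b.
Proof. by elim: rs => //= x rs ->. Qed.

(** The loops do not interfere: b modifies no loop register, neither b nor the loops
modify a register on which a bound or the prefix depends, and b stores nothing
in a field table. *)
Definition fill_wf pre rs b : bool :=
  [&& uniq (map fst rs), ~~ has (mem (mod_ireg b)) (map fst rs),
      nilp (mod_ftab b),
      ~~ has (mem (map fst rs ++ mod_ireg b)) (flatten (map evars pre)) &
      ~~ has (mem (map fst rs ++ mod_ireg b)) (flatten (map (fun x => evars x.2) rs))].

Section Fill.
Variables (tab : nat) (pre : seq iexpr) (rs : seq (nat * iexpr)) (b : cmd).
Variables (s : store F) (ns : seq nat) (Tb : nat) (val : seq nat -> F).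
Hypothesis wfb : fill_wf pre rs b.

Let C := fill tab pre rs b.
Let pv := [seq ev (ir s) e | e <- pre].

Definition written ks := exists2 idx, box ns idx & ks = ikey (pv ++ idx).

Definition reach s' := eqoff C s s' /\
  forall ks, ~ written ks -> ft s' (tab, ks) = ft s (tab, ks).

Hypothesis ns_ev : ns = [seq ev (ir s) x.2 | x <- rs].
Hypothesis ns_V : all (fun n => 0 < n <= V) ns.
Hypothesis body : forall idx s', box ns idx -> reach s' ->
  (forall i, i < size rs -> ir s' (nth 0 (map fst rs) i) = nth 0 idx i) ->
  ok b s' Tb (fun s2 => fr s2 0 = val idx).

Let B := Seq b (FSt tab (map KE pre ++ [seq KE (EV x.1) | x <- rs]) 0).

Lemma eval_pre s' : eqoff C s s' -> [seq ev (ir s') e | e <- pre] = pv.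
Proof.
case/and5P: wfb => _ _ _ h _ E; apply: map_ev_ext => r rin.
apply: (eo_i E); rewrite /C mod_ireg_nest /= cats0; apply: contra h => rin2.
by apply/hasP; exists r.
Qed.

(** The loops over the registers of rs1 have been entered, with counters o. *)
Lemma nest_ok rs2 rs1 o s' : rs = rs1 ++ rs2 -> size o = size rs1 ->
  box (take (size rs1) ns) o -> reach s' ->
  (forall i, i < size rs1 -> ir s' (nth 0 (map fst rs) i) = nth 0 o i) ->
  let ns2 := drop (size rs1) ns in
  ok (nest rs2 B) s'
   (\prod_(n <- ns2) n * (Tb + sumn (map key_cost (map KE pre ++ [seq KE (EV x.1) | x <- rs])) + 1 +
      sumn [seq expr_cost x.2 + 9 | x <- rs2]))
   (fun s2 => (forall idx, box ns2 idx -> ft s2 (tab, ikey (pv ++ o ++ idx)) = val (o ++ idx)) /\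
     forall ks, (forall idx, box ns2 idx -> ks <> ikey (pv ++ o ++ idx)) ->
        ft s2 (tab, ks) = ft s' (tab, ks)).
Proof.
case/and5P: wfb => urs hrs hft hpre hes.
have szns : size ns = size rs by rewrite ns_ev size_map.
elim: rs2 rs1 o s' => [|[r e] rs2 IH] rs1 o s' Ers szo bo re Ho ns2.
  have En2 : ns2 = [::].
    by rewrite /ns2 drop_oversize // szns Ers cats0.
  rewrite cats0 in Ers; rewrite En2 big_nil mul1n /= addn0.
  have bo' : box ns o by rewrite -[ns]take_size szns Ers.
  have Hb := body bo' re; rewrite Ers in Hb *.
  set kk := sumn _; rewrite -addnA.
  rewrite {1}Ers in Ho; rewrite /B Ers; apply: (@ok_seq _ _ _ _ (kk+1) _ _ _ (Hb Ho)) => //.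
  move=> s2 E2 v2; split=> //=.
  have Ek : [seq kval s2 k | k <- map KE pre ++ [seq KE (EV x.1) | x <- rs1]]
     = ikey (pv ++ o).
    rewrite /ikey !map_cat; congr cat.
      rewrite -(eval_pre (proj1 re)) -(@map_ev_ext (ir s2)); first by rewrite -!map_comp.
      move=> x xin; apply: (eo_i E2).
      apply: contra hpre => xin2; apply/hasP; exists x => //.
      by rewrite /= mem_cat xin2 orbT.
    rewrite -map_comp.
    apply: (@eq_from_nth _ (inl 0)); rewrite !size_map // => i lei.
    rewrite (nth_map (0, EC 0)) // (nth_map 0) ?szo //= -Ho //.
    rewrite (nth_map (0, EC 0)) //; congr inl; apply: (eo_i E2).
    have -> : (nth (0, EC 0) rs1 i).1 = nth 0 (map fst rs1) i.
      by rewrite (nth_map (0, EC 0)).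
    apply: contra hrs => xin; apply/hasP; exists (nth 0 (map fst rs1) i) => //.
    by rewrite Ers; apply: mem_nth; rewrite size_map.
  rewrite Ek; split.
    by case=> // _; rewrite cats0 eqxx v2.
  move=> ks nks; rewrite xpair_eqE eqxx /=; case: eqP => [E|_].
    by have := nks [::] isT; rewrite cats0.
  apply: (eo_ft E2); by rewrite (nilP hft).
have lt1 : size rs1 < size ns.
  by rewrite szns Ers size_cat /= addnS ltnS leq_addr.
set n := nth 0 ns (size rs1).
have Ens2 : ns2 = n :: drop (size rs1).+1 ns by rewrite /ns2 (drop_nth 0).
set ns3 := drop _ ns in Ens2.
have Eev : ev (ir s') e = n.
  rewrite /n ns_ev (nth_map (0, EC 0)) -?szns //.
  rewrite Ers nth_cat ltnn subnn /=; apply: ev_ext => x xin.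
  apply: (eo_i (proj1 re)); rewrite /C mod_ireg_nest /= cats0.
  apply: contra hes => xin2; apply/hasP; exists x => //.
  by rewrite Ers map_cat flatten_cat mem_cat /= mem_cat xin orbT.
have /andP[n0 nV] : 0 < n <= V by apply: (allP ns_V); apply: mem_nth.
set K := Tb + _ + 1.
pose Tb3 := \prod_(n <- ns3) n * (K + sumn [seq expr_cost x.2 + 9 | x <- rs2]).
pose Inv i s2 := [/\ reach s2,
  forall j, j < size rs1 -> ir s2 (nth 0 (map fst rs) j) = nth 0 o j,
  forall idx, box ns2 idx -> head 0 idx < i ->
    ft s2 (tab, ikey (pv ++ o ++ idx)) = val (o ++ idx) &
  forall ks, (forall idx, box ns2 idx -> ks <> ikey (pv ++ o ++ idx)) ->
        ft s2 (tab, ks) = ft s' (tab, ks)].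
apply: (@ok_for r e _ s' n _ Tb3 Inv) => //.
- move=> i s2 lei E2 [re2 o2 v2 k2].
  have Er : nth 0 (map fst rs) (size rs1) = r.
    by rewrite Ers map_cat nth_cat size_map ltnn subnn.
  have ors j : j < size rs1 -> nth 0 (map fst rs) j != r.
    move=> lj; rewrite -Er nth_uniq // ?size_map ?ltn_eqF // -szns //.
    exact: ltn_trans lt1.
  have re3 : reach (seti r i s2).
    case: re2 => re2 w2; split=> //; apply: eqoff_trans re2 _.
    apply: eqoff_seti; rewrite /C mod_ireg_nest mem_cat Ers map_cat mem_cat /= inE.
    by rewrite eqxx orbT.
  have Ers' : rs = rcons rs1 (r, e) ++ rs2 by rewrite cat_rcons.
  have szo' : size (rcons o i) = size (rcons rs1 (r, e)).
    by rewrite !size_rcons szo.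
  have bo' : box (take (size (rcons rs1 (r, e))) ns) (rcons o i).
    rewrite size_rcons (take_nth 0) // /box all2E !size_rcons zip_rcons.
      rewrite all_rcons /= lei /=.
      by move: bo; rewrite /box all2E eqSS => /andP[-> ->].
    by move: bo; rewrite /box all2E => /andP[/eqP].
  have Ho' j : j < size (rcons rs1 (r, e)) ->
      ir (seti r i s2) (nth 0 (map fst rs) j) = nth 0 (rcons o i) j.
    rewrite size_rcons ltnS leq_eqVlt => /orP[/eqP ->|lj] /=.
      by rewrite Er eqxx nth_rcons szo ltnn eqxx.
    by rewrite (negbTE (ors _ lj)) nth_rcons szo lj o2.
  apply: ok_conseq (IH _ _ _ Ers' szo' bo' re3 Ho') _ _.
    by rewrite size_rcons.
  rewrite size_rcons -/ns3 => s3 E3 [v3 k3].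
  have nwr ks : ~ written ks -> forall idx, box ns3 idx -> ks <> ikey (pv ++ rcons o i ++ idx).
    move=> nw idx bi Eks; apply: nw; exists (rcons o i ++ idx) => //.
    rewrite -[ns](cat_take_drop (size rs1).+1) /box all2E -/ns3.
    move: bo'; rewrite /box all2E (size_rcons rs1) => /andP[/eqP E5 h5].
    move: bi; rewrite /box all2E => /andP[/eqP E6 h6].
    by rewrite zip_cat // all_cat h5 !size_cat E5 E6 eqxx h6.
  split.
  + split.
      apply: eqoff_trans (proj1 re3) _; apply: eqoffW E3.
      rewrite /C /fill -/B Ers'; split=> x;
        rewrite ?mod_ireg_nest ?mod_freg_nest ?mod_itab_nest ?mod_ftab_nest //.
      by rewrite map_cat !mem_cat => /orP[->|->]; rewrite !orbT.
    move=> ks nw; rewrite k3; last exact: nwr.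
    by rewrite (proj2 re3).
  + move=> j lj; rewrite (eo_i E3) /=.
      by rewrite (negbTE (ors _ lj)) o2.
    rewrite mod_ireg_nest /= cats0 mem_cat negb_or.
    have lj' : j < size (map fst rs) by rewrite size_map -szns; apply: ltn_trans lt1.
    apply/andP; split.
      have := urs; rewrite {1}Ers' map_cat cat_uniq => /and3P[_ /hasPn h _].
      apply/negP => xin; have := h _ xin.
      rewrite /= map_rcons mem_rcons inE negb_or => /andP[_].
      rewrite Ers map_cat nth_cat size_map lj mem_nth //.
      by rewrite size_map.
    by apply: contra hrs => xin; apply/hasP; exists (nth 0 (map fst rs) j) => //; apply: mem_nth.
  + rewrite Ens2 => -[|i' idx] // /andP[li' bi] /=; rewrite ltnS leq_eqVlt.
    case/orP=> [/eqP E|lt]; first by rewrite E -cat_rcons v3 ?cat_rcons.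
    rewrite k3; last first.
      move=> idx2 _ /ikey_inj/eqP; rewrite eqseq_cat // eqxx /= cat_rcons.
      rewrite eqseq_cat // eqxx /= => /eqP[E _].
      by rewrite E ltnn in lt.
    by apply: v2 => //; rewrite Ens2; apply/andP; split.
  move=> ks nks; rewrite k3 /=; first exact: k2.
  move=> idx bi E; apply: (nks (i :: idx)); first by rewrite Ens2 /= lei.
  by rewrite -cat_rcons.
- move=> s2 E2 [re2 o2 v2 k2]; split=> // idx bi; apply: v2 => //.
  by move: bi; rewrite Ens2; case: (idx) => // x l /andP[].
rewrite Ens2 big_cons /Tb3 /=.
set P := \prod_(_ <- _) _; set S := sumn _.
have P0 : 0 < P.
  rewrite /P big_seq; apply: (big_ind (fun x => 0 < x)) => //.
    by move=> x y x0 y0; rewrite muln_gt0 x0.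
  by move=> x /mem_drop xin; have /andP[] := allP ns_V _ xin.
rewrite -/K; nia.
Qed.

(** Cells outside the box keep their contents, so that the body may read the part
of the same table that belongs to another prefix. *)
Lemma fill_ok :
  ok C s (\prod_(n <- ns) n * (Tb + fillK pre rs))
   (fun s2 => (forall idx, box ns idx -> ft s2 (tab, ikey (pv ++ idx)) = val idx) /\
     forall ks, (forall idx, box ns idx -> ks <> ikey (pv ++ idx)) ->
        ft s2 (tab, ks) = ft s (tab, ks)).
Proof.
have re : reach s by split.
have b0 : box (take (size (@nil (nat * iexpr))) ns) [::] by rewrite take0.
have := @nest_ok rs [::] [::] s erefl erefl b0 re (fun i => _).
rewrite drop0 => H; apply: ok_conseq (H _) _ _ => //.
by rewrite /fillK !addnA.
Qed.

End Fill.
End Logic.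

Arguments ikey {F} l.

Lemma box2P a b l : box [:: a; b] l ->
  exists x y, [/\ l = [:: x; y], x < a & y < b].
Proof.
case: l => [|x [|y [|? ?]]] //=; rewrite /box /= ?andbF ?andbT //.
by move=> /andP[h1 h2]; exists x, y.
Qed.

Lemma box4P a b c d l : box [:: a; b; c; d] l ->
  exists x y z w, [/\ l = [:: x; y; z; w], x < a, y < b, z < c & w < d].
Proof.
case: l => [|x [|y [|z [|w [|? ?]]]]] //=; rewrite /box /= ?andbF ?andbT //.
by move=> /and4P[h1 h2 h3 h4]; exists x, y, z, w.
Qed.

Lemma fill_lf (F : finFieldType) V tab pre rs b (s : store F) ns pv (val : seq nat -> F) :
  fill_wf pre rs b -> loopfree b -> (forall s' : store F, safe V b s') ->
  [seq ev (ir s) e | e <- pre] = pv ->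
  [seq ev (ir s) x.2 | x <- rs] = ns -> all (fun n => 0 < n <= V) ns ->
  (forall idx s', box ns idx -> eqoff (fill tab pre rs b) s s' ->
    (forall ks, (forall idx, box ns idx -> ks <> ikey (pv ++ idx)) ->
        ft s' (tab, ks) = ft s (tab, ks)) ->
    (forall i, i < size rs -> ir s' (nth 0 (map fst rs) i) = nth 0 idx i) ->
    fr (run b s') 0 = val idx) ->
  ok V (fill tab pre rs b) s (\prod_(n <- ns) n * (static_cost b + fillK pre rs))
   (fun s2 => (forall idx, box ns idx -> ft s2 (tab, ikey (pv ++ idx)) = val idx) /\
     forall ks, (forall idx, box ns idx -> ks <> ikey (pv ++ idx)) ->
        ft s2 (tab, ks) = ft s (tab, ks)).
Proof.
move=> wfb lf sf Epv Ens nsV H; rewrite -Epv.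
apply: (@fill_ok F V tab pre rs b s ns (static_cost b) val wfb) => // idx s' bi [E rd] Hr.
apply: ok_lf => //; apply: H => // ks nk; apply: rd => -[idx' bi' E'].
by apply: (nk idx' bi'); rewrite -Epv.
Qed.

(** * Fourier transforms and cyclic products *)

Section Transforms.
Local Open Scope ring_scope.

Lemma sum_mul_split (V : nmodType) m n (f : nat -> V) :
  \sum_(c < m * n) f c = \sum_(i < m) \sum_(j < n) f (i * n + j)%N.
Proof.
rewrite -(big_mkord xpredT f) big_nat_mul big_mkord; apply: eq_bigr => i _.
rewrite -{1}[(i * n)%N]add0n big_addn mulSn addnK big_mkord.
by apply: eq_bigr => j _; rewrite addnC.
Qed.

Lemma exp_modn (A : pzRingType) (x : A) n i : x ^+ n = 1 -> x ^+ (i %% n) = x ^+ i.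
Proof. by move=> xn; rewrite [in RHS](divn_eq i n) exprD mulnC exprM xn expr1n mul1r. Qed.

Lemma fft_exponent e x1 x2 R r D c1 c0 : e = (x1 * R + x2)%N ->
  (e * ((c1 * r + c0) * D) = x1 * c1 * (R * (r * D)) +
     (D * e * c0 + x2 * (c1 * (r * D))))%N.
Proof. by move=> ->; ring. Qed.

Lemma shift_not_mult k M c i : (c < M)%N -> (i < M)%N -> i != c ->
  (M - c + i)%N <> (k * M)%N.
Proof. by move=> cM iM /eqP ic; case: k => [|[|k]]; nia. Qed.

Section Cyclic.
Variables (F : fieldType) (A : comNzRingType) (iota : {rmorphism F -> A}).
Implicit Types (y zeta omega eta : A) (w u v : nat -> F).

(** A sequence w of L coefficients in F is specified by its value at a point y of an
F-algebra A.  When y ^+ L = 1, rotations of w become multiplications by powers of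
y, and cyclic convolution becomes multiplication. *)
Definition sem y L w : A := \sum_(p < L) iota (w p) * y ^+ p.

Lemma eq_sem y L w w' : (forall p, (p < L)%N -> w p = w' p) -> sem y L w = sem y L w'.
Proof. by move=> E; apply: eq_bigr => p _; rewrite E. Qed.

Lemma sem_shift y L w s t : (0 < L)%N -> y ^+ L = 1 -> ((t + s) %% L = 0)%N ->
  sem y L (fun p => w ((p + t) %% L)%N) = y ^+ s * sem y L w.
Proof.
move=> L0 yL st; rewrite /sem big_distrr /=.
pose h (p : 'I_L) : 'I_L := Ordinal (ltn_pmod (p + t) L0).
have hI : injective h.
  move=> p q /(congr1 val) /= /eqP; rewrite eqn_modDr !modn_small // => /eqP.
  exact: val_inj.
rewrite [RHS](reindex_inj hI); apply: eq_bigr => p _ /=.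
rewrite mulrCA; congr (_ * _); rewrite -exprD -(exp_modn (s + _) yL).
rewrite modnDmr addnCA -modnDmr [(s + t)%N]addnC st addn0.
by rewrite exp_modn.
Qed.

Lemma sem_sum y L n (w : nat -> nat -> F) :
  sem y L (fun p => \sum_(c < n) w c p) = \sum_(c < n) sem y L (w c).
Proof.
rewrite /sem exchange_big; apply: eq_bigr => p _.
by rewrite rmorph_sum mulr_suml.
Qed.

Lemma sem_scale y L k w : sem y L (fun p => k * w p) = iota k * sem y L w.
Proof.
rewrite /sem big_distrr; apply: eq_bigr => p _ /=.
by rewrite rmorphM mulrA.
Qed.

Lemma sem_mul y L u v : (0 < L)%N -> y ^+ L = 1 ->
  sem y L (fun p => \sum_(i < L) u i * v ((p + L - i) %% L)%N) =
  sem y L u * sem y L v.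
Proof.
move=> L0 yL; rewrite (@sem_sum y L L (fun i p => u i * v ((p + L - i) %% L)%N)).
rewrite [X in _ = X * _]/sem mulr_suml; apply: eq_bigr => i _.
rewrite sem_scale -mulrA; congr (_ * _).
rewrite -(@sem_shift y L v i (L - i)%N) //; last first.
  by rewrite subnK ?modnn //; apply: ltnW.
by apply: eq_sem => p _; rewrite addnBA //; apply: ltnW.
Qed.

(** a t e i is the e-th Fourier coefficient, of order r ^ t, of the subsequence of
the indices congruent to i modulo r ^ (T - t). *)
Lemma fft_spec (r T L1 : nat) (y : A) (a : nat -> nat -> nat -> A) :
  (0 < r)%N -> y ^+ L1 = 1 -> (r ^ T %| L1)%N ->
  (forall t e i, (t < T)%N -> (e < r ^ t.+1)%N -> (i < r ^ (T - t.+1))%N ->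
     a t.+1 e i = \sum_(c < r) y ^+ (L1 %/ r ^ t.+1 * e * c) *
        a t (e %% r ^ t)%N (c * r ^ (T - t.+1) + i)%N) ->
  forall e, (e < r ^ T)%N ->
  a T e 0%N = \sum_(c < r ^ T) (y ^+ (L1 %/ r ^ T)) ^+ (e * c) * a 0%N 0%N c.
Proof.
move=> r0 yL dv H.
pose om := y ^+ (L1 %/ r ^ T).
have omM : om ^+ (r ^ T) = 1 by rewrite -exprM divnK.
suff L t e i : (t <= T)%N -> (e < r ^ t)%N -> (i < r ^ (T - t))%N ->
    a t e i = \sum_(c < r ^ t) om ^+ (e * (c * r ^ (T - t))) *
                a 0%N 0%N (c * r ^ (T - t) + i)%N.
  move=> e le; rewrite (L T e 0%N) ?subnn ?expn0 //.
  by apply: eq_bigr => c _; rewrite muln1 addn0.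
elim: t e i => [|t IH] e i leT le li.
  rewrite expn0 big_ord1 !mul0n muln0 expr0 mul1r add0n.
  by move: le; rewrite expn0 ltnS leqn0 => /eqP ->.
rewrite (H _ _ _ leT le li); set D := (r ^ (T - t.+1))%N.
have ED : (r ^ (T - t) = r * D)%N by rewrite -expnS; congr expn; lia.
have EE : (L1 %/ r ^ t.+1 = L1 %/ r ^ T * D)%N.
  have dv2 : (r ^ t.+1 %| r ^ T)%N by apply: dvdn_exp2l.
  have ET : (r ^ T = r ^ t.+1 * D)%N by rewrite -expnD; congr expn; lia.
  case/dvdnP: dv => k ->; rewrite mulnK ?expn_gt0 ?r0 // ET mulnA mulnAC.
  by rewrite mulnK ?expn_gt0 ?r0.
have rt0 : (0 < r ^ t)%N by rewrite expn_gt0 r0.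
transitivity (\sum_(c0 < r) \sum_(c1 < r ^ t)
    om ^+ (e * ((c1 * r + c0) * D)) * a 0%N 0%N ((c1 * r + c0) * D + i)%N).
  apply: eq_bigr => c0 _; rewrite IH ?ltn_pmod ?(ltnW leT) //; last first.
    rewrite ED; have := ltn_ord c0; move: (nat_of_ord c0) => c; nia.
  rewrite big_distrr /=; apply: eq_bigr => c1 _.
  rewrite mulrA; congr (_ * a _ _ _); last by rewrite ED; lia.
  have -> : y ^+ (L1 %/ r ^ t.+1 * e * c0) = om ^+ (D * e * c0).
    by rewrite EE /om -exprM !mulnA.
  rewrite -exprD -(exp_modn _ omM) -[RHS](exp_modn _ omM); congr (_ ^+ _).
  have ET : (r ^ T = r ^ t * r ^ (T - t))%N by rewrite -expnD subnKC // ltnW.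
  have -> : (e * ((c1 * r + c0) * D) = (e %/ r ^ t * c1) * r ^ T +
      (D * e * c0 + e %% r ^ t * (c1 * r ^ (T - t))))%N.
    by rewrite ET ED; apply: fft_exponent; exact: divn_eq.
  by rewrite modnMDl.
have := sum_mul_split (r ^ t) r
  (fun c => om ^+ (e * (c * D)) * a 0%N 0%N (c * D + i)%N).
by rewrite -expnSr => ->; rewrite exchange_big.
Qed.

Lemma sum_geom_prod (x : A) r T :
  \sum_(e < r ^ T) x ^+ e = \prod_(t < T) \sum_(c < r) x ^+ (c * r ^ t).
Proof.
elim: T => [|T IH]; first by rewrite expn0 big_ord1 big_ord0.
rewrite big_ord_recr /= -IH expnS sum_mul_split mulrC mulr_suml.
apply: eq_bigr => i _; rewrite mulr_sumr; apply: eq_bigr => j _.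
by rewrite exprD.
Qed.

(** The sum factors by [sum_geom_prod].  If r ^ s is the exact power of the prime r in
d, then the factor of index T - s is the sum of the powers of eta ^+ d', where
eta = om ^+ (r ^ T) and d' is prime to r, which is the sum of the powers of eta.
This works in rings with zero divisors, such as F[X] modulo a cyclotomic
polynomial that is reducible over F. *)
Lemma orthogonality r T (om : A) d : (1 < r < 4)%N ->
  \sum_(c < r) (om ^+ (r ^ T)) ^+ c = 0 -> ~~ (r ^ T.+1 %| d)%N ->
  \sum_(e < r ^ T.+1) om ^+ (e * d) = 0.
Proof.
set eta := om ^+ _ => r14 He nd.
have r23 : r = 2%N \/ r = 3%N by lia.
have r1 : (1 < r)%N by case/andP: r14.
have pr : prime r by case: r23 => ->.
have er : eta ^+ r = 1 by apply/eqP; rewrite -subr_eq0 subrX1 He mulr0.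
have d0 : (0 < d)%N by case: (d) nd => //; rewrite dvdn0.
(* d = r ^ s * d' with d' prime to r. *)
pose s := logn r d; pose d' := (d %/ r ^ s)%N.
have Ed : d = (r ^ s * d')%N by rewrite /d' mulnC divnK // pfactor_dvdnn.
have sT : (s < T.+1)%N by move: nd; rewrite pfactor_dvdn // -ltnNge.
have nd' : ~~ (r %| d')%N.
  apply: contraTN (ltnSn s) => /dvdnP[k Ek]; rewrite -leqNgt -pfactor_dvdn //.
  by rewrite Ed Ek expnS; apply/dvdnP; exists k; lia.
transitivity (\sum_(e < r ^ T.+1) (om ^+ d) ^+ e).
  by apply: eq_bigr => e _; rewrite -exprM mulnC.
(* The factor that vanishes. *)
have lt : (T - s < T.+1)%N by lia.
rewrite sum_geom_prod (bigD1 (Ordinal lt)) //=.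
suff -> : \sum_(c < r) (om ^+ d) ^+ (c * r ^ (T - s)) = 0 by rewrite mul0r.
have E c : (om ^+ d) ^+ (c * r ^ (T - s)) = eta ^+ (c * (d' %% r)).
  transitivity (eta ^+ (c * d')).
    rewrite /eta -!exprM; congr (_ ^+ _).
    have -> : (r ^ T = r ^ s * r ^ (T - s))%N by rewrite -expnD subnKC.
    by rewrite Ed; ring.
  by rewrite -(exp_modn (c * d') er) -modnMmr exp_modn.
under eq_bigr => c _ do rewrite E.
have : (0 < d' %% r < r)%N.
  by rewrite lt0n ltn_pmod ?(ltnW r1) // andbT; exact: nd'.
have E1 : \sum_(c < r) eta ^+ c = 0 by [].
move: (d' %% r)%N eta er E1 {He E} => k x.
case: r23 => -> {r r14 nd r1 pr s d' Ed sT nd' lt} x3 E1 k3.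
  have -> : k = 1%N by lia.
  by rewrite -[RHS]E1; apply: eq_bigr => c _; rewrite muln1.
have [->|->] : k = 1%N \/ k = 2%N by lia.
  by rewrite -[RHS]E1; apply: eq_bigr => c _; rewrite muln1.
have S (f : nat -> A) : \sum_(c < 3) f c = f 0%N + f 1%N + f 2%N.
  by rewrite !big_ord_recr big_ord0 /= add0r.
rewrite -[RHS]E1 (S (fun c => x ^+ (c * 2))) (S (fun c => x ^+ c)) /=.
by rewrite -[(2 * 2)%N]/4%N [x ^+ 4]exprSr x3 mul1r; ring.
Qed.

Lemma dft_inv r T (om : A) (p : {poly A}) c : (1 < r < 4)%N ->
  \sum_(e < r) (om ^+ (r ^ T)) ^+ e = 0 -> (size p <= r ^ T.+1)%N ->
  (c < r ^ T.+1)%N ->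
  \sum_(e < r ^ T.+1) om ^+ ((r ^ T.+1 - c) %% r ^ T.+1 * e) * p.[om ^+ e] =
  (r ^ T.+1)%:R * p`_c.
Proof.
set M := (r ^ T.+1)%N => r14 He sp cM.
have omM : om ^+ M = 1.
  apply/eqP; rewrite -subr_eq0 /M expnSr exprM subrX1 He mulr0 //.
have E e : om ^+ ((M - c) %% M * e) * p.[om ^+ e] =
    \sum_(i < M) p`_i * om ^+ (e * (M - c + i)).
  rewrite (horner_coef_wide _ sp) mulr_sumr; apply: eq_bigr => i _.
  rewrite mulrCA; congr (_ * _); rewrite -exprM -exprD.
  rewrite -(exp_modn _ omM) -modnDml modnMml modnDml exp_modn //.
  by congr (_ ^+ _); ring.
under eq_bigr => e _ do rewrite E.
rewrite exchange_big (bigD1 (Ordinal cM)) //= [X in _ + X]big1 ?addr0 => [|i ic].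
  under eq_bigr => e _.
    rewrite subnK ?(ltnW cM) // mulnC exprM omM expr1n mulr1; over.
  by rewrite sumr_const card_ord mulr_natl.
rewrite -mulr_sumr orthogonality ?mulr0 //.
have ici : nat_of_ord i != c by apply: contra ic => /eqP E1; apply/eqP/val_inj.
by apply/negP => /dvdnP[k]; exact: shift_not_mult.
Qed.

Lemma sem_split (zeta : A) L1 M1 u :
  sem zeta (L1 * M1) u =
  \sum_(i < M1) zeta ^+ i * sem (zeta ^+ M1) L1 (fun j => u (j * M1 + i)%N).
Proof.
rewrite /sem (sum_mul_split L1 M1 (fun p => iota (u p) * zeta ^+ p)) exchange_big.
apply: eq_bigr => i _ /=; rewrite mulr_sumr; apply: eq_bigr => j _.
by rewrite mulrCA -exprM -exprD [(M1 * j)%N]mulnC addnC.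
Qed.

(** The L1 * M1 coefficients of u are those of a polynomial of degree less than M1 in
zeta over the polynomials in y = zeta ^+ M1.  A product of two such
polynomials has degree less than M, as r >= 2, so it is determined by its
values at the M powers of om.  Here uh and vh are the transforms of u and v, wh is
their entrywise product, and W is the transform of wh.  In the formula for
out, the summation over c carries out the substitution of zeta ^+ M1 for y. *)
Lemma nuss_stage r m L1 (zeta : A) u v out (invM : F)
    (uh vh wh W : nat -> nat -> F) :
  let M1 := (r ^ m)%N in let M := (r ^ m.+1)%N in
  let y := zeta ^+ M1 in let om := y ^+ (L1 %/ M) in
  (1 < r < 4)%N -> (M %| L1)%N -> (0 < L1)%N ->
  \sum_(c < r) (y ^+ (L1 %/ r)) ^+ c = 0 ->
  (forall e, (e < M)%N -> sem y L1 (uh e) = \sum_(i < M) om ^+ (e * i) *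
     (if (i < M1)%N then sem y L1 (fun j => u (j * M1 + i)%N) else 0)) ->
  (forall e, (e < M)%N -> sem y L1 (vh e) = \sum_(i < M) om ^+ (e * i) *
     (if (i < M1)%N then sem y L1 (fun j => v (j * M1 + i)%N) else 0)) ->
  (forall e, (e < M)%N ->
     sem y L1 (wh e) = sem y L1 (uh e) * sem y L1 (vh e)) ->
  (forall e, (e < M)%N ->
     sem y L1 (W e) = \sum_(i < M) om ^+ (e * i) * sem y L1 (wh i)) ->
  invM * M%:R = 1 ->
  (forall p, (p < L1 * M1)%N -> out p = invM * \sum_(c < r)
     W ((M - (p %% M1 + c * M1)) %% M)%N ((p %/ M1 + L1 - c) %% L1)%N) ->
  sem zeta (L1 * M1) out = sem zeta (L1 * M1) u * sem zeta (L1 * M1) v.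
Proof.
move=> M1 M y om r14 dvM L10 Hroot Hu Hv Hw HW HM Hout.
have r0 : (0 < r)%N by lia.
have EM : M = (r * M1)%N by rewrite /M expnS.
have M10 : (0 < M1)%N by rewrite expn_gt0 r0.
have M0 : (0 < M)%N by rewrite EM muln_gt0 r0.
have dvr : (r %| L1)%N by apply: dvdn_trans dvM; rewrite EM dvdn_mulr.
have rL : (r <= L1)%N by apply: dvdn_leq.
have omr : om ^+ (r ^ m) = y ^+ (L1 %/ r).
  rewrite -exprM; congr (_ ^+ _); rewrite -/M1; case/dvdnP: dvM => k ->.
  by rewrite mulnK // EM mulnCA mulKn.
have yL : y ^+ L1 = 1.
  by rewrite -[in LHS](divnK dvr) exprM; apply/eqP; rewrite -subr_eq0 subrX1 Hroot mulr0.
pose poly_of w := \poly_(i < M1) sem y L1 (fun j => w (j * M1 + i)%N) : {poly A}.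
have szp w : (size (poly_of w) <= M1)%N by apply: size_poly.
have M1M : (M1 <= M)%N by rewrite EM leq_pmull.
have ev w x : (poly_of w).[x] = \sum_(i < M) x ^+ i *
     (if (i < M1)%N then sem y L1 (fun j => w (j * M1 + i)%N) else 0).
  rewrite (horner_coef_wide _ (leq_trans (szp w) M1M)).
  by apply: eq_bigr => i _; rewrite coef_poly mulrC.
have evz w : (poly_of w).[zeta] = sem zeta (L1 * M1) w.
  rewrite sem_split (horner_coef_wide _ (szp w)); apply: eq_bigr => i _.
  by rewrite coef_poly ltn_ord mulrC.
pose P := poly_of u * poly_of v.
have szP : (size P <= M)%N.
  apply: leq_trans (size_polyMleq _ _) _; rewrite EM.
  have := szp u; have := szp v; nia.
have HP e : (e < M)%N -> sem y L1 (wh e) = P.[om ^+ e].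
  move=> eM; rewrite Hw // Hu // Hv // hornerM !ev.
  by congr (_ * _); apply: eq_bigr => i _; rewrite exprM.
have HWc c : (c < M)%N -> sem y L1 (W ((M - c) %% M)%N) = M%:R * P`_c.
  move=> cM; rewrite HW ?ltn_pmod // -(@dft_inv r m om P c) ?omr //.
  by apply: eq_bigr => e _; rewrite HP.
rewrite -(evz u) -(evz v) -hornerM -/P (horner_coef_wide _ szP) sem_split.
have Eout i : (i < M1)%N -> sem y L1 (fun j => out (j * M1 + i)%N) =
    \sum_(c < r) y ^+ c * P`_(i + c * M1).
  move=> iM; transitivity (sem y L1 (fun j => invM * \sum_(c < r)
     W ((M - (i + c * M1)) %% M)%N ((j + (L1 - c)) %% L1)%N)).
    apply: eq_sem => j jL; rewrite Hout; last first.
      by rewrite -[(L1 * _)%N](subnK (leq_pmull M1 L10)); nia.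
    congr (_ * _); apply: eq_bigr => c _.
    rewrite modnMDl (modn_small iM) divnMDl // (divn_small iM) addn0 addnBA //.
    by apply: leq_trans rL; apply: ltnW.
  rewrite sem_scale (@sem_sum y L1 r (fun c j =>
    W ((M - (i + c * M1)) %% M)%N ((j + (L1 - c)) %% L1)%N)) mulr_sumr.
  apply: eq_bigr => c _ /=.
  rewrite (@sem_shift y L1 (W ((M - (i + c * M1)) %% M)%N) c (L1 - c)) //; last first.
    by rewrite subnK ?modnn //; apply: leq_trans rL; apply: ltnW.
  have icM : (i + c * M1 < M)%N.
    by rewrite EM; have := ltn_ord c; move: (nat_of_ord c) => c'; nia.
  rewrite HWc // mulrCA; congr (_ * _).
  have : iota (invM * M%:R) = 1 by rewrite HM rmorph1.
  by rewrite rmorphM rmorph_nat mulrA => ->; rewrite mul1r.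
have := sum_mul_split r M1 (fun i => P`_i * zeta ^+ i).
rewrite -EM => ->; rewrite exchange_big; apply: eq_bigr => i _ /=.
rewrite -/y Eout // mulr_sumr; apply: eq_bigr => c _.
rewrite addnC mulrA [RHS]mulrC; congr (_ * _).
by rewrite /y -exprM -exprD; congr (_ ^+ _); ring.
Qed.

End Cyclic.

Section CoefReading.
Variable F : fieldType.

(** For r prime and N a power of r this is the cyclotomic polynomial of order r N. *)
Definition cyclo (r N : nat) : {poly F} := \sum_(t < r) 'X^(t * N).

Lemma cyclo_monic r N : (0 < r)%N -> (0 < N)%N ->
  cyclo r N \is monic /\ size (cyclo r N) = (r.-1 * N).+1.
Proof.
case: r => // r _ N0; rewrite /cyclo big_ord_recr /=.
set p := \sum_(_ < _) _.
have sp : (size p <= r * N)%N.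
  apply: (leq_trans (size_sum _ _ _)); apply/bigmax_leqP => t _.
  by rewrite size_polyXn; have := ltn_ord t; nia.
have E : size (p + 'X^(r * N)) = (r * N).+1.
  by rewrite addrC size_polyDl size_polyXn // ltnS.
split=> //; rewrite monicE lead_coefE E /= coefD coefXn eqxx.
by rewrite nth_default ?add0r.
Qed.

(** In this quotient of F[X] the class of X is an (r N)-th root of unity zeta such
that 1 + zeta ^+ N + ... + zeta ^+ ((r-1) N) = 0. *)
Definition cring r N := {poly %/ cyclo r N}.
Definition cval r N : {rmorphism {poly F} -> cring r N} := in_qpoly (cyclo r N).
Definition cscal r N : {rmorphism F -> cring r N} := cval r N \o polyC.
Definition czeta r N : cring r N := cval r N 'X.

Lemma mk_cyclo r N : (1 < r)%N -> (0 < N)%N -> mk_monic (cyclo r N) = cyclo r N.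
Proof.
move=> r1 N0; have [mon sz] := cyclo_monic (ltnW r1) N0.
rewrite /mk_monic mon sz ltnS muln_gt0 N0 andbT.
by case: r r1 {mon sz} => [|[|r]].
Qed.

Lemma cval_eq0 r N p : (1 < r)%N -> (0 < N)%N -> cval r N p = 0 ->
  exists g, p = g * cyclo r N.
Proof.
move=> r1 N0 E; have [mon sz] := cyclo_monic (ltnW r1) N0.
have : val (cval r N p) = 0 by rewrite E.
rewrite /cval /= (mk_cyclo r1 N0) => h.
exists (Pdiv.CommonRing.rdivp p (cyclo r N)).
by rewrite {1}(Pdiv.RingMonic.rdivp_eq mon p) h addr0.
Qed.

Lemma czeta_root r N : (1 < r)%N -> (0 < N)%N -> \sum_(t < r) (czeta r N ^+ N) ^+ t = 0.
Proof.
move=> r1 N0; have [mon sz] := cyclo_monic (ltnW r1) N0.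
transitivity (cval r N (cyclo r N)).
  rewrite rmorph_sum; apply: eq_bigr => t _.
  by rewrite /czeta -!rmorphXn /= -!exprM mulnC.
have Em := mk_cyclo r1 N0.
by apply: val_inj; rewrite /= Em Pdiv.RingMonic.rmodpp.
Qed.

Lemma sem_cval r N L (w : nat -> F) :
  sem (cscal r N) (czeta r N) L w = cval r N (\poly_(p < L) w p).
Proof.
rewrite /sem poly_def rmorph_sum; apply: eq_bigr => p _.
by rewrite -mul_polyC rmorphM rmorphXn.
Qed.

(** Replacing X^((r-1) N + i) by -(X^i + X^(N + i) + ... + X^((r-2) N + i)) reduces c
modulo [cyclo]; the coefficient of X^i becomes c_i - c_((r-1) N + i).  The product
of u and v has degree less than N, so it is reduced already. *)
Lemma linear_of_cyclic r N (u v c : nat -> F) Du Dv : (1 < r)%N -> (0 < N)%N ->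
  (forall p, (Du <= p)%N -> u p = 0) -> (forall p, (Dv <= p)%N -> v p = 0) ->
  (Du + Dv <= N.+1)%N ->
  sem (cscal r N) (czeta r N) (r * N) c =
    sem (cscal r N) (czeta r N) (r * N) u * sem (cscal r N) (czeta r N) (r * N) v ->
  forall i, (i < N)%N ->
  c i - c (r.-1 * N + i)%N = \sum_(j < i.+1) u j * v (i - j)%N.
Proof.
move=> r1 N0 hu hv le; rewrite !sem_cval -rmorphM => /eqP.
rewrite -subr_eq0 -rmorphB => /eqP /(cval_eq0 r1 N0)[g Eg] i iN.
have [mon sz] := cyclo_monic (ltnW r1) N0.
set U := \poly_(p < _) u p in Eg; set W := \poly_(p < _) v p in Eg.
set C := \poly_(p < _) c p in Eg.
have r0 : (0 < r)%N by apply: ltnW.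
have rN : (N <= r * N)%N by rewrite leq_pmull.
have ErN : (r * N = r.-1 * N + N)%N by rewrite -{1}(prednK r0) mulSn addnC.
have sN : (N <= r.-1 * N)%N by rewrite leq_pmull //; case: (r) r1 => [|[]].
have szU : (size U <= Du)%N.
  by apply/leq_sizeP => p /hu E; rewrite coef_poly E; case: ifP.
have szW : (size W <= Dv)%N.
  by apply/leq_sizeP => p /hv E; rewrite coef_poly E; case: ifP.
have szUW : (size (U * W)%R <= N)%N.
  by apply: leq_trans (size_polyMleq _ _) _; lia.
have szg : (size g <= N)%N.
  have [->|g0] := eqVneq g 0; first by rewrite size_poly0.
  have : (size (g * cyclo r N)%R <= r * N)%N.
    rewrite -Eg; apply: leq_trans (size_polyD _ _) _.
    by rewrite size_polyN geq_max size_poly (leq_trans szUW).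
  rewrite size_Mmonic // sz; lia.
have cg k : (g * cyclo r N)`_k = \sum_(t < r) (if (k < t * N)%N then 0 else g`_(k - t * N)).
  by rewrite mulr_sumr coef_sum; apply: eq_bigr => t _; rewrite coefMXn.
have Ecf k : (k < r * N)%N -> c k = (U * W)`_k + (g * cyclo r N)`_k.
  by move=> lt; rewrite -Eg coefB coef_poly lt addrC subrK.
have lt2 : (r.-1 * N + i < r * N)%N by rewrite ErN ltn_add2l.
rewrite (Ecf i (leq_trans iN rN)) (Ecf _ lt2).
have -> : (U * W)`_(r.-1 * N + i) = 0.
  apply: nth_default; apply: leq_trans szUW _.
  by apply: leq_trans sN (leq_addr _ _).
have -> : (g * cyclo r N)`_(r.-1 * N + i) = g`_i.
  have lt1 : (r.-1 < r)%N by rewrite prednK.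
  rewrite cg (bigD1 (Ordinal lt1)) //=.
  rewrite ltnNge leq_addr /= addKn big1 ?addr0 // => t nt; case: ifP => // _.
  rewrite nth_default //; apply: leq_trans szg _.
  have : nat_of_ord t != r.-1 by [].
  have := ltn_ord t; move: (nat_of_ord t) => t'; nia.
have -> : (g * cyclo r N)`_i = g`_i.
  rewrite cg (bigD1 (Ordinal r0)) //= subn0 big1 ?addr0 // => t nt; case: ifP => //.
  have : nat_of_ord t != 0%N by [].
  move: (nat_of_ord t) => t'; nia.
rewrite add0r addrK coefM; apply: eq_bigr => j _.
have := ltn_ord j; rewrite ltnS => ji.
by rewrite !coef_poly !(leq_ltn_trans _ (leq_trans iN rN)) ?leq_subr.
Qed.
End CoefReading.
End Transforms.

(** * Expansions at infinity and middle products *)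

Section MiddleProducts.
Local Open Scope ring_scope.

Section Multipoint.
Variable F : fieldType.
Implicit Types (p q G : {poly F}).

Definition eqX d p q := forall i, (i < d)%N -> p`_i = q`_i.

Lemma eqX_mul d p p' q q' : eqX d p p' -> eqX d q q' -> eqX d (p * q) (p' * q').
Proof.
move=> h1 h2 i id; rewrite !coefM; apply: eq_bigr => j _.
have ji : (j <= i)%N by rewrite -ltnS.
by rewrite h1 ?h2 //; [apply: leq_ltn_trans id; apply: leq_subr|apply: leq_ltn_trans id].
Qed.

Lemma eqX_sqr d p : eqX d p 0 -> eqX (d + d) (p * p) 0.
Proof.
move=> h i id; rewrite coefM coef0 big1 // => j _.
have [jd|jd] := ltnP j d; first by rewrite (h _ jd) coef0 mul0r.
have ji : (j <= i)%N by rewrite -ltnS.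
by rewrite (h (i - j)%N) ?coef0 ?mulr0 //; lia.
Qed.

(** If p q = 1 - e, then p q (2 - p q) = 1 - e^2. *)
Lemma newton_step S d p q q' N : (d <= S)%N -> eqX d (p * q) 1 ->
  eqX S N (2%:R - p * q) -> eqX S q' (q * N) ->
  forall d', (d' <= d + d)%N -> (d' <= S)%N -> eqX d' (p * q') 1.
Proof.
move=> dS h hN hq d' le1 le2 i id.
have E1 : eqX S (p * q') (p * (q * (2%:R - p * q))).
  apply: eqX_mul => //; move=> k kS; rewrite hq //.
  by apply: (@eqX_mul S q q N _) => // u _.
have iS : (i < S)%N by apply: leq_trans le2.
rewrite E1 //.
have -> : p * (q * (2%:R - p * q)) = 1 - (1 - p * q) * (1 - p * q) by ring.
have z : eqX d (1 - p * q) 0.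
  by move=> k kd; rewrite coefB h // subrr coef0.
by rewrite coefB (eqX_sqr z) ?coef0 ?subr0 //; apply: leq_trans le1.
Qed.

(** The leaves of the subproduct tree are the points xs i.  The polynomials are
reversed: the factors are 1 - x X instead of X - x. *)
Definition nodepoly (xs : nat -> F) h v : {poly F} :=
  \prod_(i < 2 ^ h) (1 - (xs (v * 2 ^ h + i)%N)%:P * 'X).

Lemma nodepoly0 xs v : nodepoly xs 0 v = 1 - (xs v)%:P * 'X.
Proof. by rewrite /nodepoly expn0 big_ord1 muln1 addn0. Qed.

Lemma nodepolyS xs h v :
  nodepoly xs h.+1 v = nodepoly xs h (v.*2) * nodepoly xs h (v.*2.+1).
Proof.
have E : (2 ^ h.+1 = 2 ^ h + 2 ^ h)%N by rewrite expnS mul2n addnn.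
rewrite /nodepoly E big_split_ord /=; congr (_ * _); apply: eq_bigr => i _.
  by congr (1 - (xs _)%:P * 'X); rewrite -muln2; ring.
by congr (1 - (xs _)%:P * 'X); rewrite -muln2; ring.
Qed.

Lemma size_nodepoly xs h v : (size (nodepoly xs h v) <= (2 ^ h).+1)%N.
Proof.
elim: h v => [|h IH] v.
  rewrite nodepoly0 expn0; apply: leq_trans (size_polyD _ _) _.
  rewrite size_poly1 geq_max /= size_polyN.
  by apply: leq_trans (size_polyMleq _ _) _; rewrite size_polyX size_polyC; case: eqP.
rewrite nodepolyS; apply: leq_trans (size_polyMleq _ _) _.
have := IH v.*2; have := IH v.*2.+1; rewrite expnS; lia.
Qed.

Lemma nodepoly_coef0 xs h v : (nodepoly xs h v)`_0 = 1.
Proof.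
elim: h v => [|h IH] v.
  by rewrite nodepoly0 coefB coef1 coefMX /= subr0.
by rewrite nodepolyS coefM big_ord1 !IH mulr1.
Qed.

(** The coefficient of X^-(t+1) in the expansion of f / M at infinity, where f has
degree less than S and M is the monic polynomial of degree s whose reversal
has inverse G modulo X^S. *)
Definition midcoef (f : nat -> F) S G s t : F :=
  \sum_(k < S) f k * (G * 'X^s)`_(t + 1 + k).

(** Up to a power of X, the expansion of f / M is the reversal of f times G. *)
Lemma midcoef_root f S G t : (t < S)%N ->
  midcoef f S G S t = \sum_(u < t.+1) f (S - 1 - u)%N * G`_(t - u).
Proof.
move=> tS; rewrite /midcoef (reindex_inj rev_ord_inj) /=.
rewrite (big_ord_widen S (fun u => f (S - 1 - u)%N * G`_(t - u)%N)) // big_mkcond /=.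
rewrite [RHS]big_mkcond /=; apply: eq_bigr => u _.
have uS := ltn_ord u; rewrite coefMXn /=.
case: ifP => h1; case: ifP => h2; try lia; first by rewrite mulr0.
by congr (f _ * G`_ _); lia.
Qed.

(** If M = M' M'' with factors of degree s, then f / M' is the product of f / M with
M'', whose reversal is p; the polynomial part of f / M does not contribute to
these coefficients. *)
Lemma midcoef_down f S G p s t (sig : nat -> F) : (t < s)%N -> (size p <= s.+1)%N ->
  (forall j, (j < s + s)%N -> sig j = midcoef f S G (s + s) j) ->
  \sum_(u < (t + s).+1) p`_u * sig (t + s - u)%N = midcoef f S (p * G) s t.
Proof.
move=> ts sp hs.
transitivity (\sum_(k < S) f k * \sum_(u < (t + s).+1) p`_u * (G * 'X^(s + s))`_(t + s + 1 + k
  - u)).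
  under [RHS]eq_bigr => k _ do rewrite mulr_sumr.
  rewrite exchange_big; apply: eq_bigr => u _ /=.
  have us : (u <= t + s)%N by rewrite -ltnS.
  rewrite hs; last by lia.
  rewrite /midcoef mulr_sumr; apply: eq_bigr => k _; rewrite mulrCA.
  by congr (_ * (_ * _`_ _)); lia.
apply: eq_bigr => k _; congr (_ * _).
have -> : (p * G * 'X^s)`_(t + 1 + k) = (p * (G * 'X^(s + s)))`_(t + s + 1 + k).
  rewrite exprD !mulrA [in RHS]coefMXn ifF; last by lia.
  by congr (_`_ _); lia.
rewrite coefM (big_ord_widen (t + s + 1 + k).+1 (fun u =>
  p`_u * (G * 'X^(s + s))`_(t + s + 1 + k - u))); last by lia.
rewrite big_mkcond /=; apply: eq_bigr => u _; case: ifP => // us.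
by rewrite (nth_default _ (leq_trans sp _)) ?mul0r //; lia.
Qed.

(** The coefficient of 1 / X in f / (X - x) is f(x). *)
Lemma midcoef_leaf f S G x : eqX S ((1 - x%:P * 'X) * G) 1 ->
  midcoef f S G 1 0 = \sum_(k < S) f k * x ^+ k.
Proof.
move=> h; apply: eq_bigr => k _; congr (_ * _).
rewrite coefMXn add0n add1n /= subn1 /=.
case: k => k /= kS; elim: k kS => [|k IH] kS.
  by have := h 0%N kS; rewrite mulrBl mul1r coefB -mulrA coefCM coefXM /= mulr0 subr0 coef1.
have := h k.+1 kS; rewrite mulrBl mul1r coefB -mulrA coefCM coefXM /= coef1 /=.
by rewrite IH ?exprS; [move/eqP; rewrite subr_eq0 => /eqP | apply: ltnW].
Qed.

End Multipoint.
End MiddleProducts.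

(** * Polynomial multiplication: one stage *)

Definition EMod e1 e2 := ESub e1 (EMul (EDiv e1 e2) e2).

Lemma sub_divn_mod x y : x - x %/ y * y = x %% y.
Proof. by rewrite {1}(divn_eq x y) addnC addnK. Qed.

(** Index registers: 6 the radix r; 10 the number of products computed at once; 11
their size h; 12 the depth kap; 13 the operand (0 or 1, and 2 for the product);
14 the stage; 15 and 16 the depths of this stage and of the next one; 17, 18, 29
the numbers M1 = r ^ m, M = r ^ (m + 1) and m; 19 and 20 the sizes L1 and L = L1 * M1
of the blocks of the next and of this stage; 21 the number of blocks; 22
the number of stages; 23 to 27 the level t of a transform, r ^ t, r ^ (t + 1),
M / r ^ (t + 1) and L1 / r ^ (t + 1); 30 to 34 the counters for the block, the
frequency, the entry, the position and a summation; 35 a loop counter.  Registers 27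
and 28 are also used for intermediate results.

Field tables: 5 the blocks, with keys operand, stage, block, position; 6 the levels
of a transform, with keys level, block, frequency, entry, position; 7 the inverses
of the powers of r; 8 the result.  Index tables: 2 the powers of r; 3 those of 2.

A multiplication by a power of y is a rotation of positions; the summand
r * L1 keeps the truncated subtraction from being truncated. *)
Definition fft_load : cmd :=
    FLd 1 6 [:: KE (EV 23); KE (EV 30); KE (EMod (EV 31) (EV 24));
      KE (EAdd (EMul (EV 34) (EV 26)) (EV 32));
      KE (EMod (ESub (EAdd (EV 33) (EMul (EV 6) (EV 19)))
                     (EMul (EMul (EV 27) (EV 31)) (EV 34))) (EV 19))].

Definition fft_body : cmd := sumc 34 (EV 6) fft_load.

Definition fft_fill : cmd :=
  fill 6 [:: EAdd (EV 23) (EC 1)]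
    [:: (30, EV 21); (31, EV 25); (32, EV 26); (33, EV 19)] fft_body.

Definition fft_setup : cmd :=
  Seq (ILd 24 2 [:: KE (EV 23)]) (Seq (ILd 25 2 [:: KE (EAdd (EV 23) (EC 1))])
  (Seq (ISet 26 (EDiv (EV 18) (EV 25))) (ISet 27 (EDiv (EV 19) (EV 25))))).

Definition fft : cmd := For 23 (EAdd (EV 29) (EC 1)) (Seq fft_setup fft_fill).

Definition split_body : cmd :=
  IfLt (EV 32) (EV 17)
    (FLd 0 5 [:: KE (EV 13); KE (EV 14); KE (EV 30);
                 KE (EAdd (EMul (EV 33) (EV 17)) (EV 32))])
    (FCst 0 false).
Definition split_rs := [:: (30, EV 21); (31, EC 1); (32, EV 18); (33, EV 19)].
Definition split_cmd : cmd := fill 6 [:: EC 0] split_rs split_body.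

Definition join_body : cmd :=
  FLd 0 6 [:: KE (EAdd (EV 29) (EC 1)); KE (EDiv (EV 30) (EV 18));
              KE (EMod (EV 30) (EV 18)); KE (EC 0); KE (EV 33)].
Definition join_pre := [:: EV 13; EAdd (EV 14) (EC 1)].
Definition join_rs := [:: (30, EMul (EV 21) (EV 18)); (33, EV 19)].
Definition join_cmd : cmd := fill 5 join_pre join_rs join_body.

(** The coefficients of a block are distributed over the entries of level 0, and the
transforms become blocks of the next stage. *)
Definition fwd : cmd := Seq split_cmd (Seq fft join_cmd).

Definition gather_body : cmd :=
  FLd 0 5 [:: KE (EC 2); KE (EAdd (EV 14) (EC 1));
              KE (EAdd (EMul (EV 30) (EV 18)) (EV 32)); KE (EV 33)].
Definition gather_cmd : cmd := fill 6 [:: EC 0] split_rs gather_body.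

Definition merge_load : cmd :=
  FLd 1 6 [:: KE (EAdd (EV 29) (EC 1)); KE (EV 30);
    KE (EMod (ESub (EV 18) (EAdd (EMod (EV 33) (EV 17)) (EMul (EV 34) (EV 17))))
             (EV 18)); KE (EC 0);
    KE (EMod (ESub (EAdd (EDiv (EV 33) (EV 17)) (EV 19)) (EV 34)) (EV 19))].
Definition merge_body : cmd :=
  Seq (sumc 34 (EV 6) merge_load)
    (Seq (FLd 2 7 [:: KE (EAdd (EV 29) (EC 1))]) (FBin OpMul 0 2 0)).
Definition merge_pre := [:: EC 2; EV 14].
Definition merge_rs := [:: (30, EV 21); (33, EV 20)].
Definition merge_cmd : cmd := fill 5 merge_pre merge_rs merge_body.

(** The inverse transform and the substitution of [nuss_stage]. *)
Definition bwd : cmd := Seq gather_cmd (Seq fft merge_cmd).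

Section ForwardTransform.
Variables (F : finFieldType) (V : nat).
Implicit Types (s : store F).

Record pre_tabs s (r lim : nat) : Prop := PreTabs {
  pt_r : ir s 6 = r;
  pt_r23 : 1 < r < 4;
  pt_pw : forall i, i <= lim -> it s (2, ikey [:: i]) = r ^ i;
  pt_p2 : forall i, i <= lim -> it s (3, ikey [:: i]) = 2 ^ i;
  pt_inv : forall i, i <= lim -> (ft s (7, ikey [:: i]) * (r ^ i)%:R = 1)%R
}.

Lemma pre_tabs_eqoff c s s' r lim : pre_tabs s r lim -> eqoff c s s' ->
  6 \notin mod_ireg c -> 2 \notin mod_itab c -> 3 \notin mod_itab c -> 7 \notin mod_ftab c ->
  pre_tabs s' r lim.
Proof.
case=> h1 h2 h3 h4 h5 E n1 n2 n3 n4; split=> //.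
- by rewrite (eo_i E).
- by move=> i /h3 <-; rewrite (eo_it E).
- by move=> i /h4 <-; rewrite (eo_it E).
by move=> i /h5; rewrite (eo_ft E).
Qed.

Definition fft_pre := [:: EAdd (EV 23) (EC 1)].
Definition fft_rs := [:: (30, EV 21); (31, EV 25); (32, EV 26); (33, EV 19)].

Definition sum_cost n (b : cmd) := 6 + n * (static_cost b + 7).

Lemma fft_fill_ok s t B m r L1 :
  1 < r < 4 -> t <= m -> r ^ m.+1 %| L1 -> 0 < L1 -> 0 < B ->
  B <= V -> r ^ m.+1 <= V -> L1 <= V ->
  ir s 23 = t -> ir s 6 = r -> ir s 21 = B -> ir s 19 = L1 ->
  ir s 24 = r ^ t -> ir s 25 = r ^ t.+1 -> ir s 26 = r ^ (m - t) ->
  ir s 27 = L1 %/ r ^ t.+1 ->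
  ok V fft_fill s (B * r ^ m.+1 * L1 * (sum_cost r fft_load + fillK fft_pre fft_rs))
   (fun s' =>
     (forall blk e i pos, blk < B -> e < r ^ t.+1 -> i < r ^ (m - t) -> pos < L1 ->
        ft s' (6, ikey [:: t.+1; blk; e; i; pos]) =
        \fsum_(c < r) ft s (6, ikey [:: t; blk; e %% r ^ t; c * r ^ (m - t) + i;
           (pos + r * L1 - L1 %/ r ^ t.+1 * e * c) %% L1])) /\
     forall ks, (forall l, ks <> ikey (t.+1 :: l)) -> ft s' (6, ks) = ft s (6, ks)).
Proof.
move=> r14 tm dv L10 B0 BV MV LV E23 E6 E21 E19 E24 E25 E26 E27.
have r0 : 0 < r by lia.
pose val l := \fsum_(c < r) ft s (6, ikey [:: t; nth 0 l 0; nth 0 l 1 %% r ^ t;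
   c * r ^ (m - t) + nth 0 l 2;
   (nth 0 l 3 + r * L1 - L1 %/ r ^ t.+1 * nth 0 l 1 * c) %% L1]).
have EM : r ^ t.+1 * r ^ (m - t) = r ^ m.+1 by rewrite -expnD; congr expn; lia.
have p1 : 0 < r ^ t.+1 by rewrite expn_gt0 r0.
have p2 : 0 < r ^ (m - t) by rewrite expn_gt0 r0.
have rV : r <= V by apply: leq_trans MV; rewrite -{1}(expn1 r) leq_pexp2l.
have H := @fill_ok F V 6 fft_pre fft_rs fft_body s
  [:: B; r ^ t.+1; r ^ (m - t); L1] (sum_cost r fft_load) val isT.
apply: ok_conseq (H _ _ _) _ _.
- by rewrite /= E21 E25 E26 E19.
- rewrite /= B0 BV p1 p2 L10 LV !andbT /=; nia.
- move=> idx s' /box4P[blk [e [i [pos [-> b1 b2 b3 b4]]]]] [E rd] Hr.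
  have R (x : nat) : x \notin mod_ireg fft_fill -> ir s' x = ir s x by apply: (eo_i E).
  have /= h0 := Hr 0 isT; have /= h1 := Hr 1 isT.
  have /= h2 := Hr 2 isT; have /= h3 := Hr 3 isT.
  apply: ok_conseq (@ok_sumc F V 34 (EV 6) fft_load s' r (static_cost fft_load)
   (fun c => ft s (6, ikey [:: t; blk; e %% r ^ t; c * r ^ (m - t) + i;
           (pos + r * L1 - L1 %/ r ^ t.+1 * e * c) %% L1])) _ _ _ _) _ _.
  + by rewrite /= R // E6.
  + by [].
  + by [].
  + move=> c s2 cr E2.
    have R2 (x : nat) : x \notin mod_ireg fft_body -> ir s2 x = ir s' x by apply: (eo_i E2).
    apply: ok_lf => //=. rewrite !sub_divn_mod !R2 // h0 h1 h2 h3 !R // E23 E24 E26 E19 E27 E6.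
    rewrite (eo_ft E2) // rd // => -[idx2 _ /=]; rewrite E23 addn1 => -[/eqP].
    by rewrite ltn_eqF.
  + rewrite /sum_cost /=; lia.
  by [].
- by rewrite !big_cons big_nil -EM; lia.
move=> s' E [h1 h2]; split=> [blk e i pos b1 b2 b3 b4|ks hks].
  have := h1 [:: blk; e; i; pos]; rewrite /= E23 addn1 => -> //.
  by rewrite /box /= b1 b2 b3 b4.
by apply: h2 => idx _; rewrite /= E23 addn1; apply: hks.
Qed.

Definition fft_K : nat :=
  20 + static_cost fft_setup + sum_cost 3 fft_load + fillK fft_pre fft_rs.

Lemma leq_sum_cost n b : n <= 3 -> sum_cost n b <= sum_cost 3 b.
Proof. by move=> le; rewrite /sum_cost leq_add2l leq_mul2r le orbT. Qed.

Lemma twiddle_le K R e c r : e < R -> c < r -> K * e * c <= r * (K * R).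
Proof. by move=> eR cr; rewrite mulnC leq_mul ?leq_mul // ltnW. Qed.

Lemma fft_ok s lim r B m L1 : pre_tabs s r lim -> m < lim ->
  r ^ m.+1 %| L1 -> 0 < L1 -> 0 < B -> B <= V -> r ^ m.+1 <= V -> L1 <= V ->
  m < V -> ir s 29 = m -> ir s 21 = B -> ir s 18 = r ^ m.+1 -> ir s 19 = L1 ->
  ok V fft s (fft_K * (m.+1 * (B * r ^ m.+1 * L1)))
   (fun s' => forall (A : comNzRingType) (iota : {rmorphism F -> A}) (y : A),
     (y ^+ L1 = 1)%R -> forall blk e, blk < B -> e < r ^ m.+1 ->
     sem iota y L1 (fun p => ft s' (6, ikey [:: m.+1; blk; e; 0; p])) =
     (\fsum_(c < r ^ m.+1) ((y ^+ (L1 %/ r ^ m.+1)) ^+ (e * c) *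
       sem iota y L1 (fun p => ft s (6, ikey [:: 0; blk; 0; c : nat; p])))%R)).
Proof.
move=> PT mlim dv L10 B0 BV MV LV mV E29 E21 E18 E19.
have r14 := pt_r23 PT; have r0 : 0 < r by lia.
set P := B * r ^ m.+1 * L1.
have P0 : 0 < P by rewrite !muln_gt0 B0 L10 expn_gt0 r0.
pose rec (s' : store F) t := forall blk e i pos, blk < B -> e < r ^ t.+1 ->
  i < r ^ (m - t) -> pos < L1 ->
  ft s' (6, ikey [:: t.+1; blk; e; i; pos]) =
        \fsum_(c < r) ft s' (6, ikey [:: t; blk; e %% r ^ t; c * r ^ (m - t) + i;
           (pos + r * L1 - L1 %/ r ^ t.+1 * e * c) %% L1]).
pose Inv t (s' : store F) := (forall t', t' < t -> rec s' t') /\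
  forall l, ft s' (6, ikey (0 :: l)) = ft s (6, ikey (0 :: l)).
apply: (@ok_for F V 23 _ _ s m.+1 _ (static_cost fft_setup + P * (sum_cost 3 fft_load + fillK
  fft_pre fft_rs)) Inv) => //.
- by rewrite /= E29 addn1.
- move=> t s' tm E [I1 I2].
  have R (x : nat) : x \notin mod_ireg fft -> ir s' x = ir s x by apply: (eo_i E).
  have tlim : t.+1 <= lim by apply: leq_trans tm mlim.
  have Mt : r ^ m.+1 %/ r ^ t.+1 = r ^ (m - t) by rewrite -expnB ?subSS //; lia.
  pose Q1 (s2 : store F) := [/\ ir s2 23 = t, ir s2 24 = r ^ t, ir s2 25 = r ^ t.+1,
    ir s2 26 = r ^ (m - t) & ir s2 27 = L1 %/ r ^ t.+1] .
  apply: (@ok_seq _ _ _ _ _ (static_cost fft_setup) _ _ Q1) (leqnn _).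
    apply: ok_lf => //=; rewrite !addn1 !(eo_it E) //.
      rewrite (pt_pw PT tlim) !R // E18 E19 Mt; split=> //; split=> //.
      split; first by apply: leq_trans MV; rewrite leq_pexp2l //; lia.
      by apply: leq_trans LV; apply: leq_div.
    rewrite /Q1 /= (pt_pw PT tlim) (pt_pw PT (ltnW tlim)).
    by rewrite !R // E18 E19 Mt.
  move=> s2 E2 [e23 e24 e25 e26 e27].
  apply: ok_conseq (@fft_fill_ok s2 t B m r L1 _ _ _ _ _ _ _ _ _ _ _ _ _ _ _ _) _ _ => //.
  + by rewrite (eo_i E2) //= R // (pt_r PT).
  + by rewrite (eo_i E2) //= R.
  + by rewrite (eo_i E2) //= R.
  + rewrite leq_mul // leq_add2r; apply: leq_sum_cost; lia.
  have F2 ks : ft s2 (6, ks) = ft s' (6, ks) by rewrite (eo_ft E2).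
  move=> s3 E3 [h1 h2]; split=> [t' t't|l]; last first.
    by rewrite h2 ?F2 ?I2 // => l' /ikey_inj.
  have K t2 l : t2 <= t -> ft s3 (6, ikey (t2 :: l)) = ft s' (6, ikey (t2 :: l)).
    move=> le; rewrite h2 ?F2 // => l' /ikey_inj[E4 _].
    by rewrite E4 ltnn in le.
  move=> blk e i pos b1 b2 b3 b4; move: t't; rewrite ltnS leq_eqVlt => /orP[/eqP E4|lt].
    subst t'; rewrite h1 //; apply: eq_bigr => c _.
    by rewrite F2 K.
  rewrite K // I1 //; apply: eq_bigr => c _.
  by rewrite K // ltnW.
- move=> s' E [I1 I2] A iota y yL blk e bB eM.
  rewrite (@fft_spec A r m.+1 L1 y (fun t e i => sem iota y L1
     (fun p => ft s' (6, ikey [:: t; blk; e; i; p]))) r0 yL dv _ e eM).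
    apply: eq_bigr => c _; congr (_ * _)%R; apply: eq_sem => p _.
    exact: I2.
  move=> t e' i tm e'r; rewrite subSS => ir'.
  have Er : L1 = L1 %/ r ^ t.+1 * r ^ t.+1.
    by rewrite divnK //; apply: dvdn_trans dv; apply: dvdn_exp2l.
  transitivity (sem iota y L1 (fun p => (\fsum_(c < r)
     ft s' (6, ikey [:: t; blk; e' %% r ^ t; c * r ^ (m - t) + i;
        (p + (r * L1 - L1 %/ r ^ t.+1 * e' * c)) %% L1])))).
    apply: eq_sem => p pL; rewrite I1 //; apply: eq_bigr => c _.
    rewrite addnBA //; have := twiddle_le (L1 %/ r ^ t.+1) e'r (ltn_ord c).
    by rewrite -Er.
  rewrite (@sem_sum F A iota y L1 r (fun c p => ft s' (6, ikey [:: t; blk; e' %% r ^ t;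
    c * r ^ (m - t) + i;
        (p + (r * L1 - L1 %/ r ^ t.+1 * e' * c)) %% L1]))).
  apply: eq_bigr => c _ /=.
  rewrite (@sem_shift F A iota y L1 (fun p => ft s' (6, ikey [:: t; blk; e' %% r ^ t;
    c * r ^ (m - t) + i; p]))
     (L1 %/ r ^ t.+1 * e' * c) (r * L1 - L1 %/ r ^ t.+1 * e' * c)) //.
  rewrite subnK ?modnMl //; have := twiddle_le (L1 %/ r ^ t.+1) e'r (ltn_ord c).
  by rewrite -Er.
have -> : expr_cost (EAdd (EV 29) (EC 1)) = 4 by [].
rewrite /fft_K; move: (static_cost fft_setup) (sum_cost 3 fft_load) => X Y.
move: (fillK _ _) => Z; nia.
Qed.

Definition fwd_K := static_cost split_body + fillK [:: EC 0] split_rs + fft_K +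
  static_cost join_body + fillK join_pre join_rs.

Lemma fwd_ok s lim r B m L1 side st : pre_tabs s r lim -> m < lim ->
  r ^ m.+1 %| L1 -> 0 < L1 -> 0 < B -> B * r ^ m.+1 <= V -> L1 <= V ->
  m < V -> ir s 29 = m -> ir s 21 = B -> ir s 18 = r ^ m.+1 -> ir s 19 = L1 ->
  ir s 17 = r ^ m -> ir s 13 = side -> ir s 14 = st ->
  ok V fwd s (fwd_K * (m.+1 * (B * r ^ m.+1 * L1)))
   (fun s' => (forall (A : comNzRingType) (iota : {rmorphism F -> A}) (y : A),
     (y ^+ L1 = 1)%R -> forall blk e, blk < B -> e < r ^ m.+1 ->
     sem iota y L1 (fun p => ft s' (5, ikey [:: side; st.+1; blk * r ^ m.+1 + e; p])) =
     (\fsum_(i < r ^ m.+1) ((y ^+ (L1 %/ r ^ m.+1)) ^+ (e * i) *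
       (if (i < r ^ m)%N then
       sem iota y L1 (fun j => ft s (5, ikey [:: side; st; blk; (j * r ^ m + i)%N]))
       else 0))%R)) /\
     forall ks, (forall l, ks <> ikey (side :: st.+1 :: l)) -> ft s' (5, ks) = ft s (5, ks)).
Proof.
move=> PT mlim dv L10 B0 BMV LV mV E29 E21 E18 E19 E17 E13 E14.
have r14 := pt_r23 PT; have r0 : 0 < r by lia.
have M0 : 0 < r ^ m.+1 by rewrite expn_gt0 r0.
have BV : B <= V by apply: leq_trans BMV; rewrite leq_pmulr.
have MV : r ^ m.+1 <= V by apply: leq_trans BMV; rewrite leq_pmull.
have V0 : 0 < V by apply: leq_trans mV.
set P := B * r ^ m.+1 * L1.
pose val1 l := if nth 0 l 2 < r ^ m then
  ft s (5, ikey [:: side; st; nth 0 l 0; nth 0 l 3 * r ^ m + nth 0 l 2]) else 0%R.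
apply: ok_seq.
- apply: (@fill_lf F V 6 [:: EC 0] split_rs split_body s [:: B; 1; r ^ m.+1; L1] [:: 0] val1) => //.
  + by move=> s' /=; case: ifP.
  + by rewrite /= E21 E18 E19.
  + by rewrite /= B0 M0 L10 BV MV LV V0.
  move=> idx s' /box4P[blk [e [i [pos [-> b1 b2 b3 b4]]]]] E _ Hr.
  have /= h0 := Hr 0 isT; have /= h2 := Hr 2 isT; have /= h3 := Hr 3 isT.
  rewrite /val1 /= h0 h2 h3 !(eo_i E) // E17 E13 E14; case: ifP => //= _.
  by rewrite (eo_ft E).
- move=> s1 E1 [v1 k1]; rewrite /= in v1.
  apply: ok_seq.
  + apply: (@fft_ok s1 lim r B m L1) => //; try by rewrite (eo_i E1).
    exact: pre_tabs_eqoff PT E1 _ _ _ _.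
  + move=> s2 E2 H2.
    pose val2 l := ft s2 (6, ikey [:: m.+1; nth 0 l 0 %/ r ^ m.+1; nth 0 l 0 %% r ^ m.+1; 0;
      nth 0 l 1]).
    have R (x : nat) : x \notin mod_ireg split_cmd -> x \notin mod_ireg fft -> ir s2 x = ir s x.
      by move=> n1 n2; rewrite (eo_i E2) // (eo_i E1).
    apply: ok_conseq (@fill_lf F V 5 join_pre join_rs join_body s2
      [:: B * r ^ m.+1; L1] [:: side; st.+1] val2 _ _ _ _ _ _ _) (leqnn _) _ => //.
    * by rewrite /= !R // E13 E14 addn1.
    * by rewrite /= !R // E21 E18 E19.
    * by rewrite /= BMV LV L10 muln_gt0 B0 M0.
    * move=> idx s' /box2P[be [pos [-> b1 b2]]] E _ Hr.
      have /= h0 := Hr 0 isT; have /= h1 := Hr 1 isT.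
      rewrite /val2 /= sub_divn_mod h0 h1 !(eo_i E) // !R // E29 E18 addn1.
      by rewrite (eo_ft E).
    move=> s3 E3 [v3 k3]; split=> [A iota y yL blk e bB eM|ks nk]; last first.
      rewrite k3; first by rewrite (eo_ft E2) // (eo_ft E1).
      by move=> idx _; apply: nk.
    have beB : blk * r ^ m.+1 + e < B * r ^ m.+1 by nia.
    transitivity (sem iota y L1 (fun p => ft s2 (6, ikey [:: m.+1; blk; e; 0; p]))).
      apply: eq_sem => p pL; have := v3 [:: blk * r ^ m.+1 + e; p] => /= ->.
        by rewrite /val2 /= divnMDl // divn_small // addn0 modnMDl modn_small.
      by rewrite /box /= beB pL.
    rewrite H2 //; apply: eq_bigr => i _; congr (_ * _)%R.
    case: ifP => im; last first.
      rewrite /sem big1 // => p _; have := v1 [:: blk; 0; i : nat; p : nat] => /= ->.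
        by rewrite /val1 /= im rmorph0 mul0r.
      by rewrite /box /= bB !ltn_ord.
    apply: eq_sem => p pL; have := v1 [:: blk; 0; i : nat; p : nat] => /= ->.
      by rewrite /val1 /= im.
    by rewrite /box /= bB ltn_ord pL.
  exact: leqnn.
rewrite !big_cons !big_nil /fwd_K !muln1 !mul1n.
move: (static_cost split_body) (static_cost join_body) (fillK _ split_rs) (fillK _ join_rs)
  fft_K => X1 X2 X3 X4 X5.
rewrite -/P [B * (_ * _)]mulnA -/P; nia.
Qed.

End ForwardTransform.

Fixpoint seqs (cs : seq cmd) : cmd :=
  match cs with
  | [::] => Skip
  | [:: c] => c
  | c :: cs => Seq c (seqs cs)
  end.

(** At stage s the depth is kap / 2 ^ s and the blocks have r ^ (kap / 2 ^ s + 2)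
coefficients. *)
Definition conv_setup : cmd := seqs
  [:: ILd 28 3 [:: KE (EV 14)]; ISet 15 (EDiv (EV 12) (EV 28));
      ILd 28 3 [:: KE (EAdd (EV 14) (EC 1))]; ISet 16 (EDiv (EV 12) (EV 28));
      ISet 29 (ESub (EV 15) (EV 16));
      ILd 17 2 [:: KE (EV 29)]; ILd 18 2 [:: KE (EAdd (EV 29) (EC 1))];
      ILd 19 2 [:: KE (EAdd (EV 16) (EC 2))];
      ILd 20 2 [:: KE (EAdd (EV 15) (EC 2))];
      ILd 21 2 [:: KE (ESub (EAdd (EV 12) (EV 14)) (EV 15))];
      ISet 21 (EMul (EV 10) (EV 21))].

Definition depth_step : cmd := seqs
  [:: ILd 29 2 [:: KE (EAdd (EV 12) (EC 1))];
      ILd 27 3 [:: KE (EAdd (EV 11) (EC 2))];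
      IfLt (EV 29) (EV 27) (ISet 12 (EAdd (EV 12) (EC 1))) Skip].
Definition depth_cmd : cmd :=
  Seq (ISet 12 (EC 0)) (For 28 (EAdd (EV 11) (EC 2)) depth_step).

Definition stages_step : cmd :=
  IfLt (EC 0) (EV 28)
    (Seq (ISet 28 (EDiv (EV 28) (EC 2))) (ISet 22 (EAdd (EV 22) (EC 1)))) Skip.
Definition stages_cmd : cmd :=
  Seq (ISet 22 (EC 0)) (Seq (ISet 28 (EV 12)) (For 27 (EV 12) stages_step)).

Definition base_load : cmd :=
  Seq (FLd 2 5 [:: KE (EC 0); KE (EV 22); KE (EV 30); KE (EV 34)])
  (Seq (FLd 3 5 [:: KE (EC 1); KE (EV 22); KE (EV 30);
                    KE (EMod (ESub (EAdd (EV 33) (EV 20)) (EV 34)) (EV 20))])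
       (FBin OpMul 1 2 3)).
Definition base_pre := [:: EC 2; EV 22].
Definition conv_rs := [:: (30, EV 21); (33, EV 20)].
Definition base_setup : cmd := seqs
  [:: ILd 21 2 [:: KE (EAdd (EV 12) (EV 22))]; ISet 21 (EMul (EV 10) (EV 21));
      ILd 20 2 [:: KE (EC 2)]].
(** At depth 0 the blocks have r ^ 2 coefficients and are multiplied naively. *)
Definition base_cmd : cmd :=
  Seq base_setup (fill 5 base_pre conv_rs (sumc 34 (EV 20) base_load)).

Section BackwardTransform.
Variables (F : finFieldType) (V : nat).
Implicit Types (s : store F).

Definition bwd_K := static_cost gather_body + fillK [:: EC 0] split_rs + fft_K +
  (sum_cost 3 merge_load + 20) + fillK merge_pre merge_rs.

(** W is the transform of the blocks of the next stage, that is, the W of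
[nuss_stage]. *)
Lemma bwd_ok s lim r B m L1 st : pre_tabs s r lim -> m < lim ->
  r ^ m.+1 %| L1 -> 0 < L1 -> 0 < B -> B * r ^ m.+1 <= V -> L1 * r ^ m <= V ->
  m < V -> ir s 29 = m -> ir s 21 = B -> ir s 18 = r ^ m.+1 -> ir s 19 = L1 ->
  ir s 17 = r ^ m -> ir s 20 = L1 * r ^ m -> ir s 14 = st ->
  ok V bwd s (bwd_K * (m.+1 * (B * r ^ m.+1 * L1)))
   (fun s' => (exists W : nat -> nat -> nat -> F,
     (forall (A : comNzRingType) (iota : {rmorphism F -> A}) (y : A),
       (y ^+ L1 = 1)%R -> forall blk e, blk < B -> e < r ^ m.+1 ->
       sem iota y L1 (W blk e) =
       (\fsum_(i < r ^ m.+1) ((y ^+ (L1 %/ r ^ m.+1)) ^+ (e * i) *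
         sem iota y L1 (fun j => ft s (5, ikey [:: 2; st.+1; (blk * r ^ m.+1 + i)%N; j])))%R)) /\
     (forall blk p, blk < B -> p < L1 * r ^ m ->
       ft s' (5, ikey [:: 2; st; blk; p]) =
       (ft s (7, ikey [:: m.+1]) * \fsum_(c < r)
         W blk ((r ^ m.+1 - (p %% r ^ m + c * r ^ m)) %% r ^ m.+1)%N
           ((p %/ r ^ m + L1 - c) %% L1)%N)%R)) /\
     forall ks, (forall l, ks <> ikey (2 :: st :: l)) -> ft s' (5, ks) = ft s (5, ks)).
Proof.
move=> PT mlim dv L10 B0 BMV L0V mV E29 E21 E18 E19 E17 E20 E14.
have r14 := pt_r23 PT; have r0 : 0 < r by lia.
have M0 : 0 < r ^ m.+1 by rewrite expn_gt0 r0.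
have M10 : 0 < r ^ m by rewrite expn_gt0 r0.
have BV : B <= V by apply: leq_trans BMV; rewrite leq_pmulr.
have LV : L1 <= V by apply: leq_trans L0V; rewrite leq_pmulr.
have MV : r ^ m.+1 <= V by apply: leq_trans BMV; rewrite leq_pmull.
have rV : r <= V by apply: leq_trans MV; rewrite -{1}(expn1 r) leq_pexp2l.
have V0 : 0 < V by apply: leq_trans mV.
set P := B * r ^ m.+1 * L1.
pose val1 l := ft s (5, ikey [:: 2; st.+1; nth 0 l 0 * r ^ m.+1 + nth 0 l 2; nth 0 l 3]).
apply: ok_seq.
- apply: (@fill_lf F V 6 [:: EC 0] split_rs gather_body s [:: B; 1; r ^ m.+1;
  L1] [:: 0] val1) => //.
  + by rewrite /= E21 E18 E19.
  + by rewrite /= B0 M0 L10 BV MV LV V0.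
  move=> idx s' /box4P[blk [e [i [pos [-> b1 b2 b3 b4]]]]] E _ Hr.
  have /= h0 := Hr 0 isT; have /= h2 := Hr 2 isT; have /= h3 := Hr 3 isT.
  by rewrite /val1 /= h0 h2 h3 !(eo_i E) // E18 E14 addn1 (eo_ft E).
- move=> s1 E1 [v1 k1]; rewrite /= in v1.
  apply: ok_seq.
  + apply: (@fft_ok F V s1 lim r B m L1) => //; try by rewrite (eo_i E1).
    exact: pre_tabs_eqoff PT E1 _ _ _ _.
  + move=> s2 E2 H2.
    pose W blk e p := ft s2 (6, ikey [:: m.+1; blk; e; 0; p]).
    pose val2 l := (ft s (7, ikey [:: m.+1]) * \fsum_(c < r)
         W (nth 0%N l 0) ((r ^ m.+1 - (nth 0%N l 1 %% r ^ m + c * r ^ m)) %% r ^ m.+1)%N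
           ((nth 0%N l 1 %/ r ^ m + L1 - c) %% L1)%N)%R.
    have R (x : nat) : x \notin mod_ireg gather_cmd -> x \notin mod_ireg fft -> ir s2 x = ir s x.
      by move=> n1 n2; rewrite (eo_i E2) // (eo_i E1).
    have R7 ks : ft s2 (7, ks) = ft s (7, ks).
      by rewrite (eo_ft E2) // (eo_ft E1).
    apply: ok_conseq (@fill_ok F V 5 merge_pre merge_rs merge_body s2
      [:: B; L1 * r ^ m] (sum_cost 3 merge_load + 20) val2 isT _ _ _) (leqnn _) _.
    * by rewrite /= !R // E21 E20.
    * by rewrite /= BV L0V B0 !muln_gt0 L10 M10.
    * move=> idx s' /box2P[blk [p [-> b1 b2]]] [E _] Hr.
      have /= h0 := Hr 0 isT; have /= h1 := Hr 1 isT.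
      have R3 (x : nat) : x \notin mod_ireg merge_cmd -> ir s' x = ir s2 x by apply: (eo_i E).
      apply: ok_seq.
      - apply: (@ok_sumc F V 34 (EV 6) merge_load s' r (static_cost merge_load)
          (fun c => W blk ((r ^ m.+1 - (p %% r ^ m + c * r ^ m)) %% r ^ m.+1)
           ((p %/ r ^ m + L1 - c) %% L1))) => //.
          by rewrite /= R3 // R // (pt_r PT).
        move=> c s3 cr E3; apply: ok_lf => //=.
        rewrite !sub_divn_mod !(eo_i E3) // h0 h1 !R3 // !R // E29 E17 E18 E19 addn1.
        by rewrite (eo_ft E3) // (eo_ft E).
      - move=> s3 E3 S3; apply: ok_lf => //=.
        by rewrite (eo_ft E3) // (eo_ft E) // R7 (eo_i E3) // R3 // R // E29 addn1 S3.
      have r3 : r <= 3 by lia.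
      rewrite /sum_cost /=; lia.
    move=> s3 E3 [v3 k3]; split; last first.
      move=> ks nk; rewrite k3; first by rewrite (eo_ft E2) // (eo_ft E1).
      move=> idx _; rewrite /= R // E14; exact: nk.
    exists W; split=> [A iota y yL blk e bB eM|blk p bB pL].
      rewrite H2 //; apply: eq_bigr => i _; congr (_ * _)%R; apply: eq_sem => p pL.
      by have := v1 [:: blk; 0; i : nat; p] => /= ->; rewrite // /box /= bB ltn_ord pL.
    have := v3 [:: blk; p]; rewrite /= R // E14 => ->; first by [].
    by rewrite /box /= bB pL.
  exact: leqnn.
rewrite !big_cons !big_nil /bwd_K !muln1 !mul1n.
have leP : B * (L1 * r ^ m) <= P.
  by rewrite /P -mulnA leq_mul // mulnC leq_mul // leq_pexp2l.
move: (static_cost gather_body) (sum_cost 3 _) (fillK _ split_rs) (fillK _ merge_rs) fft_K =>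
  X1 X2 X3 X4 X5.
rewrite -/P [B * (_ * _)]mulnA -/P; nia.
Qed.

Lemma stage_arith kap st : let k0 := kap %/ 2 ^ st in let k1 := kap %/ 2 ^ st.+1 in
  [/\ k1 <= k0, k0 <= kap & k0 <= k1 + k1 + 1].
Proof.
have -> /= : kap %/ 2 ^ st.+1 = (kap %/ 2 ^ st) %/ 2 by rewrite -divnMA expnSr.
have := leq_div kap (2 ^ st); move: (kap %/ _) => k le.
by split=> //; lia.
Qed.

Lemma setup_ok s lim r kap B st : pre_tabs s r lim ->
  ir s 12 = kap -> ir s 14 = st -> ir s 10 = B -> st <= kap ->
  kap + kap + 4 <= lim -> 0 < B -> B * r ^ (kap + kap + 4) <= V ->
  let k0 := kap %/ 2 ^ st in let k1 := kap %/ 2 ^ st.+1 in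
  ok V conv_setup s (static_cost conv_setup) (fun s' =>
    [/\ ir s' 29 = k0 - k1, ir s' 17 = r ^ (k0 - k1), ir s' 18 = r ^ (k0 - k1).+1
      & [/\ ir s' 19 = r ^ (k1 + 2), ir s' 20 = r ^ (k0 + 2)
         & ir s' 21 = B * r ^ (kap + st - k0)]]).
Proof.
move=> PT E12 E14 E10 stk klim B0 BV k0 k1.
have r14 := pt_r23 PT; have r0 : 0 < r by lia.
have [a1 a2 a3] := stage_arith kap st; rewrite -/k0 -/k1 in a1 a2 a3.
have kV : kap <= V.
  apply: leq_trans BV; apply: leq_trans (leq_pmull _ B0).
  apply: leq_trans (ltnW (ltn_expl _ (_ : 1 < r))) _; first by lia.
  by rewrite leq_pexp2l //; lia.
have BV2 : B * r ^ (kap + st - k0) <= V.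
  by apply: leq_trans BV; rewrite leq_mul // leq_pexp2l //; lia.
have p1 : it s (3, [:: inl st]) = 2 ^ st by rewrite (pt_p2 PT) //; lia.
have p2 : it s (3, [:: inl st.+1]) = 2 ^ st.+1 by rewrite (pt_p2 PT) //; lia.
have pw i : i <= lim -> it s (2, [:: inl i]) = r ^ i := @pt_pw _ _ _ _ PT i.
apply: ok_lf => //=; rewrite !E12 !E14 !E10 !addn1 p1 p2 -/k0 -/k1 ?addn1.
  rewrite pw; last by lia.
  by do !split=> //; lia.
rewrite !pw //; try lia.
Qed.

Lemma depth_ok s lim r h : pre_tabs s r lim -> ir s 11 = h -> h + 4 <= lim -> lim <= V ->
  ok V depth_cmd s (30 * (h + 3)) (fun s' => let kap := ir s' 12 in
   [/\ kap <= h + 2, 2 ^ (h + 2) <= r ^ kap.+1 & r ^ kap <= 2 ^ (h + 2)]).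
Proof.
move=> PT E11 hlim limV; have r14 := pt_r23 PT; have r0 : 0 < r by lia.
pose Inv j (s' : store F) := let kap := ir s' 12 in
  [/\ kap <= j, (2 ^ (h + 2) <= r ^ kap.+1) || (kap == j) & r ^ kap <= 2 ^ (h + 2)].
apply: (@ok_seq _ _ _ _ _ 3 _ _ (Inv 0)).
- apply: ok_lf => //.
  by rewrite /Inv /= eqxx orbT expn0 expn_gt0.
- move=> s1 E1 I1.
  apply: (@ok_for F V 28 _ _ s1 (h + 2) _ (static_cost depth_step) Inv) => //.
  + by rewrite /= (eo_i E1) // E11.
  + lia.
  + move=> j s2 lt E2 [i1 i2 i3].
    have w11 : ir s2 11 = h by rewrite (eo_i E2) // (eo_i E1).
    have pw i : i <= lim -> it s2 (2, [:: inl i]) = r ^ i.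
      by move=> le; rewrite (eo_it E2) // (eo_it E1) // -(pt_pw PT le).
    have p2 i : i <= lim -> it s2 (3, [:: inl i]) = 2 ^ i.
      by move=> le; rewrite (eo_it E2) // (eo_it E1) // -(pt_p2 PT le).
    set kap := ir s2 12 in i1 i2 i3.
    apply: ok_lf => //=; rewrite w11 -/kap addn1 pw ?p2; try lia.
      by case: ifP => //= _; rewrite -/kap; lia.
    rewrite /Inv; case: ltnP => lt2 /=; rewrite -/kap ?addn1.
      rewrite ltnS i1 (ltnW lt2) eqSS; split=> //.
      by case/orP: i2 => [|->]; [rewrite leqNgt lt2|rewrite orbT].
    by rewrite (leqW i1) i3 lt2.
  + move=> s' E [i1 i2 i3]; split=> //.
    case/orP: i2 => // /eqP ->; apply: leq_trans (_ : 2 ^ (h + 2).+1 <= _).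
      by rewrite leq_exp2l.
    by rewrite leq_exp2r //; lia.
rewrite [static_cost _]/= [expr_cost _]/=; lia.
Qed.

Lemma stages_ok s kap : ir s 12 = kap -> kap < V ->
  ok V stages_cmd s (30 * (kap + 1)) (fun s' => let st := ir s' 22 in
   [/\ kap %/ 2 ^ st = 0, st <= kap & 2 ^ st <= 2 * kap + 1]).
Proof.
move=> E12 kV.
pose Inv j (s' : store F) := let st := ir s' 22 in
  [/\ st <= j, ir s' 28 = kap %/ 2 ^ st, (ir s' 28 == 0) || (st == j) & 2 ^ st <= 2 * kap + 1].
apply: (@ok_seq _ _ _ _ _ 3 _ _ (fun s' => ir s' 22 = 0)).
  by apply: ok_lf.
  move=> s1 E1 e22; apply: (@ok_seq _ _ _ _ _ 4 _ _ (fun s' => ir s' 22 = 0 /\ ir s' 28 = kap)).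
    have e12 : ir s1 12 = kap by rewrite (eo_i E1).
    by apply: ok_lf => //=; rewrite ?e12 ?e22 // ltnW.
  move=> s2 E2 [f22 f28].
  apply: (@ok_for F V 27 _ _ s2 kap _ (static_cost stages_step) Inv) => //.
  + by rewrite /= (eo_i E2) // (eo_i E1).
  + exact: ltnW.
  + by rewrite /Inv f22 f28 expn0 divn1 eqxx orbT; split=> //; lia.
  + move=> j s3 lt E3 [i1 i2 i3 i4]; set st := ir s3 22 in i1 i2 i3 i4.
    apply: ok_lf => //=; rewrite -/st.
      case: ifP => //= _; rewrite -/st; have := leq_div kap (2 ^ st); rewrite -i2; split; lia.
    rewrite /Inv; case: ltnP => lt2 /=; rewrite -/st.
      rewrite addn1 ltnS i1 i2 expnSr divnMA eqSS; split=> //.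
        by case/orP: i3 => [/eqP E|->]; [rewrite E in lt2|rewrite orbT].
      have : 0 < kap %/ 2 ^ st by rewrite -i2.
      rewrite divn_gt0 ?expn_gt0 //; lia.
    by rewrite (leqW i1) i2; split=> //; move: lt2; rewrite leqn0 i2 => ->.
  + move=> s' E [i1 i2 i3 i4]; split=> //; rewrite -i2; case/orP: i3 => /eqP // E3.
    by rewrite i2 E3 divn_small // ltn_expl.
  exact: leqnn.
rewrite [static_cost _]/= [expr_cost _]/=; lia.
Qed.

End BackwardTransform.

(** * Polynomial multiplication: the recursion *)

Definition fwd_loop : cmd := For 13 (EC 2) (For 14 (EV 22) (Seq conv_setup fwd)).
Definition bwd_loop : cmd :=
  For 35 (EV 22) (Seq (ISet 14 (ESub (ESub (EV 22) (EC 1)) (EV 35)))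
    (Seq conv_setup bwd)).

Section ForwardStages.
Variables (F : finFieldType) (V : nat).
Implicit Types (s : store F).

Definition base_K := static_cost base_setup + (sum_cost 9 base_load + fillK base_pre conv_rs).

Lemma base_ok s lim r kap B st : pre_tabs s r lim ->
  ir s 12 = kap -> ir s 22 = st -> ir s 10 = B -> st <= kap ->
  kap + kap + 4 <= lim -> 0 < B -> B * r ^ (kap + kap + 4) <= V ->
  ok V base_cmd s (base_K * (B * r ^ (kap + st + 3))) (fun s' =>
    (forall blk p, blk < B * r ^ (kap + st) -> p < r ^ 2 ->
       ft s' (5, ikey [:: 2; st; blk; p]) =
       (\fsum_(i < r ^ 2) (ft s (5, ikey [:: 0; st; blk; i : nat]) *
          ft s (5, ikey [:: 1; st; blk; ((p + r ^ 2 - i) %% r ^ 2)%N]))%R)) /\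
    forall ks, (forall l, ks <> ikey (2 :: st :: l)) -> ft s' (5, ks) = ft s (5, ks)).
Proof.
move=> PT E12 E22 E10 stk klim B0 BV.
have r14 := pt_r23 PT; have r0 : 0 < r by lia.
have BrV j : j <= kap + kap + 4 -> B * r ^ j <= V.
  by move=> le; apply: leq_trans BV; rewrite leq_mul // leq_pexp2l.
have rV j : j <= kap + kap + 4 -> r ^ j <= V.
  by move=> le; apply: leq_trans (BrV j le); rewrite leq_pmull.
have r29 : r ^ 2 <= 9 by case: r r14 {PT r0 BrV rV BV} => [|[|[|[|]]]].
set B2 := B * r ^ (kap + st).
have B20 : 0 < B2 by rewrite muln_gt0 B0 expn_gt0 r0.
have pw i : i <= lim -> it s (2, [:: inl i]) = r ^ i := @pt_pw _ _ _ _ PT i.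
pose val l := (\fsum_(i < r ^ 2) (ft s (5, ikey [:: 0; st; nth 0 l 0; i : nat]) *
          ft s (5, ikey [:: 1; st; nth 0 l 0; ((nth 0 l 1 + r ^ 2 - i) %% r ^ 2)%N]))%R).
apply: (@ok_seq _ _ _ _ _ (static_cost base_setup) _ _
  (fun s' => ir s' 21 = B2 /\ ir s' 20 = r ^ 2)).
- apply: ok_lf => //=; rewrite !E12 !E22 !E10 !pw //; try lia.
  by do !split => //; apply: BrV; lia.
- move=> s1 E1 [e21 e20].
  have F1 ks : ft s1 (5, ks) = ft s (5, ks) by rewrite (eo_ft E1).
  have R1 (x : nat) : x \notin mod_ireg base_setup -> ir s1 x = ir s x by apply: (eo_i E1).
  apply: ok_conseq (@fill_ok F V 5 base_pre conv_rs (sumc 34 (EV 20) base_load) s1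
    [:: B2; r ^ 2] (sum_cost 9 base_load) val isT _ _ _) (leqnn _) _.
  + by rewrite /= e21 e20.
  + by rewrite /= B20 expn_gt0 r0 BrV ?rV //; lia.
  + move=> idx s' /box2P[blk [p [-> b1 b2]]] [E rd] Hr.
    have /= h0 := Hr 0 isT; have /= h1 := Hr 1 isT.
    have R (x : nat) : x \notin mod_ireg (fill 5 base_pre conv_rs (sumc 34 (EV 20) base_load)) ->
      ir s' x = ir s1 x by apply: (eo_i E).
    apply: ok_conseq (@ok_sumc F V 34 (EV 20) base_load s' (r ^ 2) (static_cost base_load)
     (fun i => (ft s (5, ikey [:: 0; st; blk; i]) *
          ft s (5, ikey [:: 1; st; blk; ((p + r ^ 2 - i) %% r ^ 2)%N]))%R) _ _ _ _) _ _.
    * by rewrite /= R.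
    * by apply: rV; lia.
    * by [].
    * move=> c s2 cr E2; apply: ok_lf => //=.
      rewrite !sub_divn_mod !(eo_i E2) // h0 h1 !R // e20 R1 // E22 !(eo_ft E2) //.
      by rewrite !rd ?F1 // => -[idx2 _ /=]; rewrite R1 // E22 => -[].
    * rewrite /sum_cost leq_add // leq_mul //.
    by [].
  move=> s2 E2 [v2 k2]; split=> [blk p b1 b2|ks nk].
    have := v2 [:: blk; p]; rewrite /= R1 // E22 => -> //.
    by rewrite /box /= b1 b2.
  by rewrite k2 ?F1 // => idx _; rewrite /= R1 // E22; apply: nk.
rewrite !big_cons big_nil muln1 /base_K.
have leP : B2 * r ^ 2 <= B * r ^ (kap + st + 3).
  by rewrite /B2 -mulnA -expnD leq_mul // leq_pexp2l //; lia.
have B0' : 0 < B * r ^ (kap + st + 3) by rewrite muln_gt0 B0 expn_gt0 r0.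
move: (static_cost base_setup) (sum_cost _ _ + _) => X Y.
rewrite mulnDl leq_add ?leq_pmulr //.
by rewrite mulnC leq_mul.
Qed.

(** The hypotheses of [nuss_stage] on uh and vh. *)
Definition forward_dft s r B kap side st :=
  let k0 := kap %/ 2 ^ st in let k1 := kap %/ 2 ^ st.+1 in
  let M1 := r ^ (k0 - k1) in let M := r ^ (k0 - k1).+1 in let L1 := r ^ (k1 + 2) in
  forall (A : comNzRingType) (iota : {rmorphism F -> A}) (y : A),
  (y ^+ L1 = 1)%R -> forall blk e, blk < B * r ^ (kap + st - k0) -> e < M ->
  sem iota y L1 (fun p => ft s (5, ikey [:: side; st.+1; blk * M + e; p])) =
  (\fsum_(i < M) ((y ^+ (L1 %/ M)) ^+ (e * i) * (if (i < M1)%N then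
     sem iota y L1 (fun j => ft s (5, ikey [:: side; st; blk; (j * M1 + i)%N]))
     else 0))%R).

Lemma forward_dft_ext s s' r B kap side st :
  (forall l, ft s' (5, ikey (side :: st :: l)) = ft s (5, ikey (side :: st :: l))) ->
  (forall l, ft s' (5, ikey (side :: st.+1 :: l)) = ft s (5, ikey (side :: st.+1 :: l))) ->
  forward_dft s r B kap side st -> forward_dft s' r B kap side st.
Proof.
rewrite /forward_dft /= => h1 h2 H A iota y yL blk e b1 b2.
transitivity (sem iota y (r ^ (kap %/ 2 ^ st.+1 + 2)) (fun p => ft s (5, ikey [:: side; st.+1;
   blk * r ^ (kap %/ 2 ^ st - kap %/ 2 ^ st.+1).+1 + e; p]))).
  by apply: eq_sem => p _; exact: h2 [:: _; p].
rewrite (H A iota y yL blk e b1 b2).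
apply: eq_bigr => i _; congr (_ * _)%R; case: ifP => // _.
by apply: eq_sem => p _; apply: esym; exact: (h1 [:: _; _]).
Qed.

Lemma stage_pow r kap st : let k0 := kap %/ 2 ^ st in let k1 := kap %/ 2 ^ st.+1 in
  1 < r -> [/\ r ^ (k0 - k1).+1 %| r ^ (k1 + 2),
   r ^ (k1 + 2) * r ^ (k0 - k1) = r ^ (k0 + 2) &
   r ^ (kap + st - k0) * r ^ (k0 - k1).+1 = r ^ (kap + st.+1 - k1)].
Proof.
move=> k0 k1 r1; have [a1 a2 a3] := stage_arith kap st; rewrite -/k0 -/k1 in a1 a2 a3.
split; first by apply: dvdn_exp2l; lia.
  by rewrite -expnD; congr expn; lia.
by rewrite -expnD; congr expn; lia.
Qed.

(** At stage st all blocks together have B * r ^ (kap + st + 2) coefficients: the padding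
costs a factor r per stage.  As there are about log kap stages, this stays
polynomial in kap. *)
Lemma stage_cost B r kap st : let k0 := kap %/ 2 ^ st in let k1 := kap %/ 2 ^ st.+1 in
  1 < r -> forall ST, st < ST ->
  (k0 - k1).+1 * (B * r ^ (kap + st - k0) * r ^ (k0 - k1).+1 * r ^ (k1 + 2)) <=
  kap.+1 * (B * r ^ (kap + ST + 3)).
Proof.
move=> k0 k1 r1 ST lt; have [a1 a2 a3] := stage_arith kap st; rewrite -/k0 -/k1 in a1 a2 a3.
rewrite -!mulnA -!expnD leq_mul //; first by lia.
by rewrite leq_mul // leq_pexp2l //; lia.
Qed.

Definition fwd_loop_K := 20 + static_cost conv_setup + fwd_K.

Lemma fwd_loop_ok s lim r kap B ST : pre_tabs s r lim ->
  ir s 12 = kap -> ir s 22 = ST -> ir s 10 = B -> ST <= kap ->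
  kap + kap + 4 <= lim -> 0 < B -> B * r ^ (kap + kap + 4) <= V ->
  ok V fwd_loop s (fwd_loop_K * (2 * ST.+1 * (kap.+1 * (B * r ^ (kap + ST + 3)))))
   (fun s' => (forall side st, side < 2 -> st < ST -> forward_dft s' r B kap side st) /\
     forall side l, ft s' (5, ikey (side :: 0 :: l)) = ft s (5, ikey (side :: 0 :: l))).
Proof.
move=> PT E12 E22 E10 STk klim B0 BV.
have r14 := pt_r23 PT; have r0 : 0 < r by lia. have r1 : 1 < r by lia.
have BrV j : j <= kap + kap + 4 -> B * r ^ j <= V.
  by move=> le; apply: leq_trans BV; rewrite leq_mul // leq_pexp2l.
have rV j : j <= kap + kap + 4 -> r ^ j <= V.
  by move=> le; apply: leq_trans (BrV j le); rewrite leq_pmull.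
have kV : kap + kap + 4 < V.
  by apply: leq_trans (rV _ (leqnn _)); apply: ltn_expl.
have klim' : kap < lim by clear -klim; lia.
have kV' : kap < V by clear -kV; lia.
set P := kap.+1 * (B * r ^ (kap + ST + 3)).
have P0 : 0 < P by rewrite !muln_gt0 B0 expn_gt0 r0.
pose Inv sd (s' : store F) := (forall side st, side < sd -> st < ST ->
  forward_dft s' r B kap side st) /\
     forall side l, ft s' (5, ikey (side :: 0 :: l)) = ft s (5, ikey (side :: 0 :: l)).
pose Tb := static_cost conv_setup + fwd_K * P.
apply: (@ok_for F V 13 _ _ s 2 _ (5 + ST * (Tb + 6)) Inv) => //; first by lia.
- move=> sd s1 sd2 E1 [I1 I2].
  pose Inv2 x (s' : store F) := [/\ forall side st, side < sd -> st < ST ->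
    forward_dft s' r B kap side st,
     forall st, st < x -> forward_dft s' r B kap sd st &
     forall side l, ft s' (5, ikey (side :: 0 :: l)) = ft s (5, ikey (side :: 0 :: l))].
  apply: (@ok_for F V 14 _ _ _ ST _ Tb Inv2) => //.
  + by rewrite /= (eo_i E1).
  + lia.
  + move=> st s2 lt E2 [J1 J2 J3].
    have R2 (x : nat) : x \notin mod_ireg fwd_loop -> ir s2 x = ir s x.
      move=> nx; have n13 : x != 13 by move: nx; rewrite /fwd_loop /= inE negb_or => /andP[].
      rewrite (eo_i E2) /= ?(negbTE n13) ?(eo_i E1) //.
      by move: nx; rewrite /fwd_loop /= inE negb_or => /andP[].
    have PT2 : pre_tabs s2 r lim.
      apply: pre_tabs_eqoff E2 _ _ _ _ => //.
      have PT1 := pre_tabs_eqoff PT E1 isT isT isT isT.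
      by case: PT1.
    have e13 : ir s2 13 = sd by rewrite (eo_i E2).
    have ST_k : st <= kap by apply: leq_trans STk; apply: ltnW.
    apply: ok_seq.
    * apply: (@setup_ok F V _ lim r kap B st) => //; try by rewrite /= R2.
      by case: PT2.
    * move=> s3 E3 [e29 e17 e18 [e19 e20 e21]].
      have [a1 a2 a3] := stage_arith kap st.
      have [q1 q2 q3] := @stage_pow r kap st r1.
      set k0 := kap %/ 2 ^ st in e29 e17 e18 e20 e21 a1 a2 a3 q1 q2 q3.
      set k1 := kap %/ 2 ^ st.+1 in e29 e17 e18 e19 a1 a2 a3 q1 q2 q3.
      have mlim : k0 - k1 < lim := leq_ltn_trans (leq_trans (leq_subr _ _) a2) klim'.
      have mV : k0 - k1 < V := leq_ltn_trans (leq_trans (leq_subr _ _) a2) kV'.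
      apply: ok_conseq (@fwd_ok F V s3 lim r (B * r ^ (kap + st - k0)) (k0 - k1)
         (r ^ (k1 + 2)) sd st _ mlim q1 _ _ _ _ mV e29 e21 e18 e19 e17 _ _) (leqnn _) _.
      - apply: pre_tabs_eqoff E3 _ _ _ _ => //; by case: PT2.
      - by rewrite expn_gt0 r0.
      - by rewrite muln_gt0 B0 expn_gt0 r0.
      - rewrite -mulnA q3; apply: BrV; clear -ST_k; lia.
      - by apply: rV; clear -a1 a2; lia.
      - by rewrite (eo_i E3).
      - by rewrite (eo_i E3).
      have F3 ks : ft s3 (5, ks) = ft s2 (5, ks) by rewrite (eo_ft E3).
      move=> s4 E4 [h1 h2].
      have K sd' st' l : (sd' != sd) || (st' != st.+1) ->
          ft s4 (5, ikey (sd' :: st' :: l)) = ft s2 (5, ikey (sd' :: st' :: l)).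
        move=> ne; rewrite h2 ?F3 // => l' /ikey_inj[x1 x2 _].
        by move: ne; rewrite x1 x2 !eqxx.
      split.
      - move=> side st' l1 l2; apply: forward_dft_ext (J1 _ _ l1 l2) => l; rewrite K //;
          by rewrite ltn_eqF.
      - move=> st'; rewrite ltnS leq_eqVlt => /orP[/eqP ->|l1].
          rewrite /forward_dft /= => A iota y yL blk e b1 b2; rewrite h1 //.
          apply: eq_bigr => i _; congr (_ * _)%R; case: ifP => // _.
          have ne : (sd != sd) || (st != st.+1) by rewrite eqxx /= neq_ltn ltnSn.
          by apply: eq_sem => p _; rewrite F3; apply: esym; exact: (K _ _ [:: _; _] ne).
        apply: forward_dft_ext (J2 _ l1) => l; rewrite K //; apply/orP; right; clear -l1; lia.
      by move=> side l; rewrite K ?J3 // orbT.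
    rewrite /Tb leq_add2l leq_mul2l; apply/orP; right.
    exact: stage_cost.
  move=> s2 E2 [J1 J2 J3]; split=> // side st.
  rewrite ltnS leq_eqVlt => /orP[/eqP ->|l1] l2; first exact: J2.
  exact: J1.
have -> : expr_cost (EC 2) = 1 by [].
rewrite /Tb /fwd_loop_K; move: (static_cost _) (fwd_K) => X Y; nia.
Qed.

End ForwardStages.

Section BackwardStages.
Variables (F : finFieldType) (V : nat).
Implicit Types (s : store F).

Definition bwd_loop_K := 30 + static_cost conv_setup + bwd_K.

(** The blocks of stage st are evaluated at the root of unity of that stage, which
is a power of the class of X in [cring]. *)
Definition blockval s r kap (sd st blk : nat) : cring F r (r ^ kap.+1) :=
  sem (cscal F r (r ^ kap.+1)) (czeta F r (r ^ kap.+1) ^+ (r ^ (kap - kap %/ 2 ^ st)))%R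
    (r ^ (kap %/ 2 ^ st + 2)) (fun p => ft s (5, ikey [:: sd; st; blk; p])).

Lemma root_pow (A : comNzRingType) r (x : A) :
  (\fsum_(c < r) (x ^+ c)%R = 0)%R -> (x ^+ r = 1)%R.
Proof. by move=> E; apply/eqP; rewrite -subr_eq0 subrX1 E mulr0. Qed.

Lemma addnBB a b c : c <= b -> b <= a -> a - b + (b - c) = a - c.
Proof. lia. Qed.

Lemma mixed_lt x e M N : x < N -> e < M -> x * M + e < N * M.
Proof. nia. Qed.

Lemma stage_root r kap st (A : comNzRingType) (z : A) : let k := kap %/ 2 ^ st in
  (((z ^+ (r ^ (kap - k))) ^+ (r ^ k.+1)) = z ^+ (r ^ kap.+1))%R.
Proof.
move=> k; rewrite -exprM -expnD; congr (_ ^+ (_ ^ _))%R.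
by rewrite addnS subnK // leq_div.
Qed.

Definition block_products s r B kap st := forall blk, blk < B * r ^ (kap + st - kap %/ 2 ^ st) ->
  (blockval s r kap 2 st blk = blockval s r kap 0 st blk * blockval s r kap 1 st blk)%R.

(** [nuss_stage], applied to a block of stage st with its transforms. *)
Lemma stage_step s s3 s4 r kap B st (invM : F) (W : nat -> nat -> nat -> F) :
  let k0 := kap %/ 2 ^ st in let k1 := kap %/ 2 ^ st.+1 in
  let m := k0 - k1 in let L1 := r ^ (k1 + 2) in
  1 < r < 4 -> block_products s3 r B kap st.+1 ->
  (forall sd, sd < 2 -> forward_dft s r B kap sd st) ->
  (forall sd st' l, sd < 2 -> ft s3 (5, ikey (sd :: st' :: l)) = ft s (5, ikey (sd :: st' :: l))) ->
  (forall sd st' l, sd < 2 -> ft s4 (5, ikey (sd :: st' :: l)) = ft s (5, ikey (sd :: st' :: l))) ->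
  (invM * (r ^ m.+1)%:R = 1)%R ->
  (forall (A : comNzRingType) (iota : {rmorphism F -> A}) (y : A),
       (y ^+ L1 = 1)%R -> forall blk e, blk < B * r ^ (kap + st - k0) -> e < r ^ m.+1 ->
       sem iota y L1 (W blk e) =
       (\fsum_(i < r ^ m.+1) ((y ^+ (L1 %/ r ^ m.+1)) ^+ (e * i) *
         sem iota y L1 (fun j => ft s3 (5, ikey [:: 2; st.+1; (blk * r ^ m.+1 + i)%N; j])))%R)) ->
  (forall blk p, blk < B * r ^ (kap + st - k0) -> p < L1 * r ^ m ->
       ft s4 (5, ikey [:: 2; st; blk; p]) =
       (invM * \fsum_(c < r)
         W blk ((r ^ m.+1 - (p %% r ^ m + c * r ^ m)) %% r ^ m.+1)%N
           ((p %/ r ^ m + L1 - c) %% L1)%N)%R) ->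
  block_products s4 r B kap st.
Proof.
move=> k0 k1 m L1 r14 P3 HF K3 K4 HM HW Hout blk bB.
have r1 : 1 < r by lia. have r0 : 0 < r by lia.
have [a1 a2 a3] := stage_arith kap st; rewrite -/k0 -/k1 in a1 a2 a3.
have [q1 q2 q3] := @stage_pow r kap st r1; rewrite -/k0 -/k1 -/m -/L1 in q1 q2 q3.
set N := r ^ kap.+1; set z := czeta F r N.
set zeta := (z ^+ (r ^ (kap - k0)))%R; set y := (zeta ^+ (r ^ m))%R.
have N0 : 0 < N by rewrite expn_gt0 r0.
have Ey : y = (z ^+ (r ^ (kap - k1)))%R.
  by rewrite /y /zeta -exprM -expnD; congr (_ ^+ (_ ^ _))%R; exact: addnBB.
have L10 : 0 < L1 by rewrite expn_gt0 r0.
have EL : L1 %/ r = r ^ k1.+1 by rewrite /L1 addn2 expnS mulKn.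
have Hroot : (\fsum_(c < r) ((y ^+ (L1 %/ r)) ^+ c)%R = 0)%R.
  rewrite EL Ey stage_root; exact: czeta_root.
have yL : (y ^+ L1 = 1)%R by rewrite /L1 addn2 expnSr exprM -EL; apply: root_pow.
have M0 : 0 < r ^ m.+1 by rewrite expn_gt0 r0.
have bM e : e < r ^ m.+1 -> blk * r ^ m.+1 + e < B * r ^ (kap + st.+1 - k1).
  by move=> eM; rewrite -q3 mulnA; exact: mixed_lt.
pose iota := cscal F r N.
have := @nuss_stage F (cring F r N) iota r m L1 zeta
  (fun p => ft s (5, ikey [:: 0; st; blk; p])) (fun p => ft s (5, ikey [:: 1; st; blk; p]))
  (fun p => ft s4 (5, ikey [:: 2; st; blk; p])) invM
  (fun e p => ft s (5, ikey [:: 0; st.+1; blk * r ^ m.+1 + e; p]))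
  (fun e p => ft s (5, ikey [:: 1; st.+1; blk * r ^ m.+1 + e; p]))
  (fun e p => ft s3 (5, ikey [:: 2; st.+1; blk * r ^ m.+1 + e; p])) (W blk)
  r14 q1 L10 Hroot.
rewrite q2 /= -/y => H; rewrite /blockval -/k0 -/N -/z -/zeta -/iota.
have E sd : sd < 2 -> sem iota zeta (r ^ (k0 + 2)) (fun p => ft s4 (5, ikey [:: sd; st; blk; p]))
   = sem iota zeta (r ^ (k0 + 2)) (fun p => ft s (5, ikey [:: sd; st; blk; p])).
  by move=> sd2; apply: eq_sem => p _; exact: (K4 _ _ [:: _; _] sd2).
rewrite (E 0) // (E 1) //; apply: H => //.
- by move=> e eM; apply: (HF 0).
- by move=> e eM; apply: (HF 1).
- move=> e eM; have := P3 _ (bM e eM).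
  rewrite /blockval -/k1 -/L1 -/N -/z -Ey -/iota => ->.
  by congr (_ * _)%R; apply: eq_sem => p _; exact: (K3 _ _ [:: _; _]).
- by move=> e eM; apply: HW.
by move=> p pL; apply: Hout => //; rewrite q2.
Qed.

Lemma bwd_loop_ok s lim r kap B ST : pre_tabs s r lim ->
  ir s 12 = kap -> ir s 22 = ST -> ir s 10 = B -> ST <= kap ->
  kap + kap + 4 <= lim -> 0 < B -> B * r ^ (kap + kap + 4) <= V ->
  (forall sd st, sd < 2 -> st < ST -> forward_dft s r B kap sd st) ->
  block_products s r B kap ST ->
  ok V bwd_loop s (bwd_loop_K * (ST.+1 * (kap.+1 * (B * r ^ (kap + ST + 3)))))
   (fun s' => block_products s' r B kap 0 /\ forall sd st l, sd < 2 ->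
       ft s' (5, ikey (sd :: st :: l)) = ft s (5, ikey (sd :: st :: l))).
Proof.
move=> PT E12 E22 E10 STk klim B0 BV HF P0.
have r14 := pt_r23 PT; have r0 : 0 < r by lia. have r1 : 1 < r by lia.
have BrV j : j <= kap + kap + 4 -> B * r ^ j <= V.
  by move=> le; apply: leq_trans BV; rewrite leq_mul // leq_pexp2l.
have rV j : j <= kap + kap + 4 -> r ^ j <= V.
  by move=> le; apply: leq_trans (BrV j le); rewrite leq_pmull.
have kV : kap + kap + 4 < V.
  by apply: leq_trans (rV _ (leqnn _)); apply: ltn_expl.
have klim' : kap < lim by clear -klim; lia.
have kV' : kap < V by clear -kV; lia.
set P := kap.+1 * (B * r ^ (kap + ST + 3)).
have PP : 0 < P by rewrite !muln_gt0 B0 expn_gt0 r0.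
pose Inv x (s' : store F) := block_products s' r B kap (ST - x) /\
   forall sd st l, sd < 2 -> ft s' (5, ikey (sd :: st :: l)) = ft s (5, ikey (sd :: st :: l)).
pose Tb := 10 + static_cost conv_setup + bwd_K * P.
apply: (@ok_for F V 35 _ _ s ST _ Tb Inv) => //; first by lia.
- by rewrite /Inv subn0.
- move=> x s2 lt E2 [J1 J2].
  have R2 (i : nat) : i \notin mod_ireg bwd_loop -> ir s2 i = ir s i by apply: (eo_i E2).
  pose st := ST - 1 - x.
  have Est : ST - x = st.+1 by rewrite /st; clear -lt; lia.
  have Est2 : ST - x.+1 = st by rewrite /st; clear; lia.
  have stST : st < ST by rewrite /st; clear -lt; lia.
  have ST_k : st <= kap by clear -stST STk; lia.
  have PT2 := pre_tabs_eqoff PT E2 isT isT isT isT.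
  have PT2' : pre_tabs (seti 35 x s2) r lim by case: PT2.
  apply: (@ok_seq _ _ _ _ _ 10 _ _ (fun s' => ir s' 14 = st)).
  + apply: ok_lf => //=; rewrite R2 // E22; rewrite /st; lia.
  + move=> s3 E3 e14.
    have PT3 := pre_tabs_eqoff PT2' E3 isT isT isT isT.
    apply: ok_seq.
    * by apply: (@setup_ok F V _ lim r kap B st) => //; rewrite (eo_i E3) //= R2.
    * move=> s4 E4 [e29 e17 e18 [e19 e20 e21]].
      have PT4 := pre_tabs_eqoff PT3 E4 isT isT isT isT.
      have [a1 a2 a3] := stage_arith kap st.
      have [q1 q2 q3] := @stage_pow r kap st r1.
      set k0 := kap %/ 2 ^ st in e29 e17 e18 e20 e21 a1 a2 a3 q1 q2 q3.
      set k1 := kap %/ 2 ^ st.+1 in e29 e17 e18 e19 a1 a2 a3 q1 q2 q3.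
      have F4 ks : ft s4 (5, ks) = ft s2 (5, ks).
        by rewrite (eo_ft E4) // (eo_ft E3).
      have mlim : k0 - k1 < lim := leq_ltn_trans (leq_trans (leq_subr _ _) a2) klim'.
      have mV : k0 - k1 < V := leq_ltn_trans (leq_trans (leq_subr _ _) a2) kV'.
      apply: ok_conseq (@bwd_ok F V s4 lim r (B * r ^ (kap + st - k0)) (k0 - k1)
         (r ^ (k1 + 2)) st PT4 mlim q1 _ _ _ _ mV e29 e21 e18 e19 e17 _ _) (leqnn _) _.
      - by rewrite expn_gt0 r0.
      - by rewrite muln_gt0 B0 expn_gt0 r0.
      - rewrite -mulnA q3; apply: BrV; clear -ST_k; lia.
      - by rewrite q2; apply: rV; clear -a1 a2; lia.
      - by rewrite q2.
      - by rewrite (eo_i E4).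
      move=> s5 E5 [[W [w1 w2]] k5].
      have K5 sd st' l : sd < 2 -> ft s5 (5, ikey (sd :: st' :: l)) = ft s (5,
        ikey (sd :: st' :: l)).
        move=> sd2; rewrite k5 ?F4 ?J2 // => l' /ikey_inj[x1 _ _].
        by rewrite x1 in sd2.
      have K4 sd st' l : sd < 2 -> ft s4 (5, ikey (sd :: st' :: l)) = ft s (5,
        ikey (sd :: st' :: l)).
        by move=> sd2; rewrite F4 J2.
      split; last exact: K5.
      rewrite Est2.
      apply: (@stage_step s s4 s5 r kap B st (ft s4 (7, ikey [:: (k0 - k1).+1])) W) => //.
      - rewrite -Est => blk b1; rewrite /blockval.
        have E sd : sem (cscal F r (r ^ kap.+1)) (czeta F r (r ^ kap.+1) ^+ (r ^ (kap - kap %/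
          2 ^ (ST - x))))%R
            (r ^ (kap %/ 2 ^ (ST - x) + 2)) (fun p => ft s4 (5, ikey [:: sd; ST - x; blk; p])) =
          blockval s2 r kap sd (ST - x) blk by apply: eq_sem => p _; rewrite F4.
        by rewrite !E; apply: J1.
      - by move=> sd sd2; apply: HF.
      exact: (pt_inv PT4).
    exact: leqnn.
  rewrite /Tb -addnA leq_add2l leq_add2l leq_mul2l; apply/orP; right.
  exact: stage_cost.
- by move=> s' E [J1 J2]; rewrite subnn in J1.
have -> : expr_cost (EV 22) = 2 by [].
rewrite /Tb /bwd_loop_K; move: (static_cost _) (bwd_K) => X Y; nia.
Qed.

End BackwardStages.

(** * Polynomial multiplication: the whole procedure *)

Definition in_rs := [:: (30, EV 10); (33, EV 20)].
Definition conv_in (cA cB : cmd) : cmd :=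
  Seq (ILd 20 2 [:: KE (EAdd (EV 12) (EC 2))])
    (Seq (fill 5 [:: EC 0; EC 0] in_rs cA) (fill 5 [:: EC 1; EC 0] in_rs cB)).

Definition out_body : cmd :=
  Seq (FLd 1 5 [:: KE (EC 2); KE (EC 0); KE (EV 30); KE (EV 33)])
  (Seq (FLd 2 5 [:: KE (EC 2); KE (EC 0); KE (EV 30);
                    KE (EAdd (EMul (EV 28) (EV 20)) (EV 33))])
       (FBin OpSub 0 1 2)).
Definition out_rs := [:: (30, EV 10); (33, EV 27)].
Definition out_setup : cmd :=
  Seq (ILd 20 2 [:: KE (EAdd (EV 12) (EC 1))])
  (Seq (ILd 27 3 [:: KE (EAdd (EV 11) (EC 2))]) (ISet 28 (ESub (EV 6) (EC 1)))).
Definition conv_out : cmd := Seq out_setup (fill 8 [::] out_rs out_body).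

Definition conv_work : cmd :=
  Seq fwd_loop (Seq base_cmd (Seq bwd_loop conv_out)).

Definition conv (cA cB : cmd) : cmd :=
  Seq depth_cmd (Seq stages_cmd (Seq (conv_in cA cB) conv_work)).

Definition conv_regs : seq nat := iota 12 24.

Definition pure_cmd (c : cmd) : bool := [&& nilp (mod_ireg c),
  nilp (mod_itab c) & nilp (mod_ftab c)].

Section InputOutput.
Variables (F : finFieldType) (V : nat).
Implicit Types (s : store F).

Definition keeps_conv s s' :=
  [/\ forall x, x \notin conv_regs -> ir s' x = ir s x,
      forall z, it s' z = it s z &
      forall t ks, t \notin [:: 5; 6; 8] -> ft s' (t, ks) = ft s (t, ks)].

Lemma keeps_conv_trans s1 s2 s3 :
  keeps_conv s1 s2 -> keeps_conv s2 s3 -> keeps_conv s1 s3.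
Proof.
move=> [a1 b1 c1] [a2 b2 c2]; split=> [x n|z|t ks n].
- by rewrite a2 ?a1.
- by rewrite b2 b1.
by rewrite c2 ?c1.
Qed.

Lemma eqoff_keeps_conv c s s' : all (mem conv_regs) (mod_ireg c) -> nilp (mod_itab c) ->
  all (mem [:: 5; 6; 8]) (mod_ftab c) -> eqoff c s s' -> keeps_conv s s'.
Proof.
move=> /allP h1 /nilP h2 /allP h3 E; split=> [x n|[t ks]|t ks n].
- by apply: (eo_i E); apply: contra n; apply: h1.
- by apply: (eo_it E); rewrite h2.
by apply: (eo_ft E); apply: contra n; apply: h3.
Qed.

Lemma conv_mods cA cB : pure_cmd cA -> pure_cmd cB ->
  [/\ all (mem conv_regs) (mod_ireg (conv cA cB)), nilp (mod_itab (conv cA cB)) &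
      all (mem [:: 5; 6; 8]) (mod_ftab (conv cA cB))].
Proof.
move=> /and3P[/nilP a1 /nilP a2 /nilP a3] /and3P[/nilP b1 /nilP b2 /nilP b3].
by rewrite /conv /conv_in /fill /= a1 a2 a3 b1 b2 b3.
Qed.

Lemma in_mods cA cB : pure_cmd cA -> pure_cmd cB ->
  [/\ mod_ireg (conv_in cA cB) = [:: 20; 30; 33; 30; 33], mod_itab (conv_in cA cB) = [::] &
      mod_ftab (conv_in cA cB) = [:: 5; 5]].
Proof.
move=> /and3P[/nilP a1 /nilP a2 /nilP a3] /and3P[/nilP b1 /nilP b2 /nilP b3].
by rewrite /conv_in /fill /= a1 a2 a3 b1 b2 b3.
Qed.

Lemma pure_fill_wf cA c0 : pure_cmd cA -> fill_wf [:: EC c0; EC 0] in_rs cA.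
Proof.
by move=> /and3P[/nilP a1 /nilP a2 /nilP a3]; rewrite /fill_wf /= a1 a3.
Qed.

(** The operands of a multiplication are given by commands that are run in states
in which the multiplication has already used its own registers and tables. *)
Definition computes (c : cmd) s (B Tin : nat) (u : nat -> nat -> F) :=
  forall s' blk pos, keeps_conv s s' -> blk < B -> ir s' 30 = blk -> ir s' 33 = pos ->
    ok V c s' Tin (fun s2 => fr s2 0 = u blk pos).

Lemma computes_keeps c s s' B T u : keeps_conv s s' -> computes c s B T u -> computes c s' B T u.
Proof.
by move=> k H s2 blk pos k2; apply: H; apply: keeps_conv_trans k k2.
Qed.

Definition in_K := fillK [:: EC 0; EC 0] in_rs + 5.

Lemma conv_in_ok s cA cB B Tin a b L : pure_cmd cA -> pure_cmd cB ->
  computes cA s B Tin a -> computes cB s B Tin b ->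
  it s (2, ikey [:: ir s 12 + 2]) = L -> ir s 10 = B -> 0 < B <= V -> 0 < L <= V ->
  ok V (conv_in cA cB) s (2 * (B * L * (Tin + in_K)))
   (fun s' => forall blk p, blk < B -> p < L ->
     ft s' (5, ikey [:: 0; 0; blk; p]) = a blk p /\
     ft s' (5, ikey [:: 1; 0; blk; p]) = b blk p).
Proof.
move=> pA pB cmA cmB EL E10 /andP[B0 BV] /andP[L0 LV].
have in_ok c0 c u s1 : c0 < 2 -> pure_cmd c -> keeps_conv s s1 -> computes c s B Tin u ->
  ir s1 20 = L ->
  ok V (fill 5 [:: EC c0; EC 0] in_rs c) s1 (B * L * (Tin + fillK [:: EC 0; EC 0] in_rs))
    (fun s' => keeps_conv s s' /\ (forall blk p, blk < B -> p < L -> ft s' (5, ikey [:: c0; 0;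
      blk; p]) = u blk p) /\
      forall c1 l, c1 != c0 -> ft s' (5, ikey (c1 :: l)) = ft s1 (5, ikey (c1 :: l))).
  move=> c02 pc k1 cm e20; have /and3P[/nilP p1 /nilP p2 /nilP p3] := pc.
  have kc s' : eqoff (fill 5 [:: EC c0; EC 0] in_rs c) s1 s' -> keeps_conv s1 s'.
    by move=> E; apply: eqoff_keeps_conv E; rewrite /fill /= ?p1 ?p2 ?p3.
  pose val l := u (nth 0 l 0) (nth 0 l 1).
  apply: ok_conseq (@fill_ok F V 5 [:: EC c0; EC 0] in_rs c s1 [:: B;
    L] Tin val (pure_fill_wf c0 pc) _ _ _) _ _.
  - by rewrite /= e20; case: k1 => -> //; rewrite E10.
  - by rewrite /= B0 BV L0 LV.
  - move=> idx s' /box2P[blk [p [-> b1 b2]]] [E _] Hr.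
    have /= h0 := Hr 0 isT; have /= h1 := Hr 1 isT.
    by apply: cm => //; apply: keeps_conv_trans k1 _; apply: kc.
  - by rewrite !big_cons big_nil muln1.
  move=> s' E [h1 h2]; split; last split.
  - by apply: keeps_conv_trans k1 _; apply: kc.
  - move=> blk p b1 b2; have := h1 [:: blk; p] => /= ->; first by [].
    by rewrite /box /= b1 b2.
  move=> c1 l ne; rewrite h2 //.
  by move=> idx _ /ikey_inj[E1 _]; rewrite E1 eqxx in ne.
apply: (@ok_seq _ _ _ _ _ 5 _ _ (fun s' => ir s' 20 = L)).
- by apply: ok_lf => //=.
- move=> s1 E1 e20.
  have k1 : keeps_conv s s1 by apply: eqoff_keeps_conv E1.
  apply: ok_seq; first exact: (in_ok 0 cA a).
  + move=> s2 E2 [k2 [v2 _]].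
    apply: ok_conseq (in_ok 1 cB b s2 isT pB k2 cmB _) (leqnn _) _.
      have /and3P[/nilP p1 _ _] := pA.
      by rewrite (eo_i E2) // /fill /= p1.
    move=> s3 E3 [k3 [v3 w3]] blk p b1 b2; split; last exact: v3.
    by rewrite (w3 0 [:: _; _; _]) // v2.
  exact: leqnn.
rewrite /in_K; have : 0 < B * L by rewrite muln_gt0 B0.
by move: (B * L) (fillK _ _) => X Y; nia.
Qed.

Definition out_K := static_cost out_setup + static_cost out_body + fillK [::] out_rs.

Lemma conv_out_ok s lim r kap B h : pre_tabs s r lim ->
  ir s 12 = kap -> ir s 11 = h -> ir s 10 = B -> kap < lim -> h + 2 <= lim ->
  0 < B <= V -> 2 ^ (h + 2) <= V ->
  ok V conv_out s (B * 2 ^ (h + 2) * out_K)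
   (fun s' => forall blk p, blk < B -> p < 2 ^ (h + 2) ->
     ft s' (8, ikey [:: blk; p]) = (ft s (5, ikey [:: 2; 0; blk; p]) -
       ft s (5, ikey [:: 2; 0; blk; (r.-1 * r ^ kap.+1 + p)%N]))%R).
Proof.
move=> PT E12 E11 E10 klim hlim /andP[B0 BV] hV.
have h0 : 0 < 2 ^ (h + 2) by rewrite expn_gt0.
have V6 : ir s 6 = r := pt_r PT.
have r14 := pt_r23 PT.
have V3 : 2 < V by apply: leq_trans hV; apply: (@leq_trans (2 ^ 2));
  rewrite // leq_exp2l // leq_addl.
apply: (@ok_seq _ _ _ _ _ (static_cost out_setup) _ _ (fun s' => [/\ ir s' 20 = r ^ kap.+1,
   ir s' 27 = 2 ^ (h + 2) & ir s' 28 = r.-1])).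
- apply: ok_lf => //=; rewrite ?V6 ?subn1; first by do !split=> //; clear -r14 V3; lia.
  by rewrite E12 E11 !addn1 (pt_pw PT klim) (pt_p2 PT hlim).
- move=> s1 E1 [e20 e27 e28].
  pose val l := (ft s (5, ikey [:: 2; 0; nth 0%N l 0; nth 0%N l 1]) -
       ft s (5, ikey [:: 2; 0; nth 0%N l 0; (r.-1 * r ^ kap.+1 + nth 0 l 1)%N]))%R.
  apply: ok_conseq (@fill_lf F V 8 [::] out_rs out_body s1 [:: B;
    2 ^ (h + 2)] [::] val _ _ _ _ _ _ _) (leqnn _) _ => //.
  + by rewrite /= (eo_i E1) // E10 e27.
  + by rewrite /= B0 BV h0 hV.
  + move=> idx s' /box2P[blk [p [-> b1 b2]]] E _ Hr.
    have /= g0 := Hr 0 isT; have /= g1 := Hr 1 isT.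
    by rewrite /val /= g0 g1 !(eo_i E) // e28 e20 !(eo_ft E) // !(eo_ft E1).
  move=> s2 E2 [v2 _] blk p b1 b2; have := v2 [:: blk; p] => /= ->; first by [].
  by rewrite /box /= b1 b2.
rewrite !big_cons big_nil muln1 /out_K.
have : 0 < B * 2 ^ (h + 2) by rewrite muln_gt0 B0.
move: (B * _) (static_cost out_setup) (static_cost out_body) (fillK _ _) => X Y Z U; nia.
Qed.

End InputOutput.

Section Convolution.
Variables (F : finFieldType) (V : nat).
Implicit Types (s : store F).

(** 432 = 4 * 27 * 4, since r ^ kap <= 4 * 2 ^ h, r ^ 3 <= 27 and
r ^ ST <= (2 ^ ST) ^ 2 <= 4 * (h + 3) ^ 2. *)
Lemma conv_cost_pow r kap ST h : 1 < r < 4 -> kap <= h + 2 -> r ^ kap <= 2 ^ (h + 2) ->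
  ST <= kap -> 2 ^ ST <= 2 * kap + 1 ->
  ST.+1 * (kap.+1 * r ^ (kap + ST + 3)) <= 432 * 2 ^ h * (h + 3) ^ 4.
Proof.
move=> r14 kh rk STk p2.
have mono x y e : x <= y -> x ^ e <= y ^ e.
  by move=> le; elim: e => // e IH; rewrite !expnS leq_mul.
have rST : r ^ ST <= 4 * (h + 3) ^ 2.
  have r4 : r <= 4 by clear -r14; lia.
  have -> : 4 * (h + 3) ^ 2 = (2 * (h + 3)) ^ 2 by rewrite expnMn.
  apply: leq_trans (mono _ _ ST r4) _; rewrite -[4]/(2 ^ 2) expnAC.
  by apply: mono; apply: leq_trans p2 _; clear -kh; lia.
have r3 : r ^ 3 <= 27 by rewrite -[27]/(3 ^ 3); apply: mono; clear -r14; lia.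
have E : 432 * 2 ^ h * (h + 3) ^ 4 = (h + 3) * ((h + 3) * (2 ^ (h + 2) * (4 * (h + 3) ^ 2) * 27)).
  have -> : (h + 3) ^ 4 = (h + 3) ^ 2 * ((h + 3) * (h + 3)) by rewrite mulnn -expnD.
  have -> : 2 ^ (h + 2) = 4 * 2 ^ h by rewrite expnD mulnC.
  by clear; move: (2 ^ h) ((h + 3) ^ 2) (h + 3) => x y z; ring.
rewrite E [r ^ (_ + 3)]expnD [r ^ (_ + ST)]expnD; apply: leq_mul; first by clear -kh STk; lia.
apply: leq_mul; first by clear -kh; lia.
by do 2?apply: leq_mul.
Qed.

Definition conv_K : nat := 100 + 100 * in_K + 432 * (fwd_loop_K * 2 + base_K + bwd_loop_K) + 4
  * out_K.

Lemma ok_le c s T T' (P : store F -> Prop) : ok V c s T P -> T <= T' -> ok V c s T' P.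
Proof. by move=> H le; apply: ok_conseq H le _. Qed.

(** At the last stage y ^+ (r ^ 2) = 1, so [sem_mul] applies. *)
Lemma block_products_base s r kap B ST : 1 < r < 4 -> kap %/ 2 ^ ST = 0 ->
  (forall blk p, blk < B * r ^ (kap + ST) -> p < r ^ 2 ->
       ft s (5, ikey [:: 2; ST; blk; p]) =
       (\fsum_(i < r ^ 2) (ft s (5, ikey [:: 0; ST; blk; i : nat]) *
          ft s (5, ikey [:: 1; ST; blk; ((p + r ^ 2 - i) %% r ^ 2)%N]))%R)) ->
  block_products s r B kap ST.
Proof.
move=> r14 k0 H blk; rewrite /blockval k0 subn0 => bB; rewrite subn0.
have r1 : 1 < r by lia. have r0 : 0 < r by lia.
set N := r ^ kap.+1; set z := czeta F r N.
have N0 : 0 < N by rewrite expn_gt0 r0.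
rewrite -(@sem_mul F _ (cscal F r N) _ (r ^ 2)
   (fun i => ft s (5, ikey [:: 0; ST; blk; i])) (fun i => ft s (5, ikey [:: 1; ST; blk; i]))).
- by apply: eq_sem => p pL; apply: H.
- by rewrite expn_gt0 r0.
have -> : ((z ^+ (r ^ kap)) ^+ (r ^ 2) = (z ^+ N) ^+ r)%R.
  by rewrite -!exprM -expnD -expnSr addn2.
by apply: root_pow; exact: czeta_root.
Qed.

(** The backward stages give the cyclic product of length r ^ (kap + 2), and
[linear_of_cyclic] with N = r ^ (kap + 1) recovers the first 2 ^ (h + 2) <= N
coefficients of the product. *)
Theorem conv_ok s lim r B h cA cB Tin a b Da Db : pure_cmd cA -> pure_cmd cB ->
  pre_tabs s r lim -> ir s 10 = B -> ir s 11 = h -> h + h + 8 <= lim ->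
  0 < B -> B * 4 ^ (h + h + 8) <= V ->
  computes V cA s B Tin a -> computes V cB s B Tin b ->
  (forall blk p, Da <= p -> a blk p = 0%R) -> (forall blk p, Db <= p -> b blk p = 0%R) ->
  Da + Db <= (2 ^ (h + 2)).+1 -> lim <= V ->
  ok V (conv cA cB) s (B * 2 ^ h * (h + 3) ^ 4 * (conv_K + 100 * Tin))
   (fun s' => keeps_conv s s' /\ forall blk i, blk < B -> i < 2 ^ (h + 2) ->
      ft s' (8, ikey [:: blk; i]) = (\fsum_(j < i.+1) (a blk j * b blk (i - j)%N))%R).
Proof.
move=> pA pB PT E10 E11 hlim B0 BV cmA cmB ha hb hD limV.
have r14 := pt_r23 PT; have r0 : 0 < r by clear -r14; lia.
have r1 : 1 < r by clear -r14; lia. have r4 : r <= 4 by clear -r14; lia.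
have [m1 m2 m3] := conv_mods pA pB.
apply: (ok_conseq (Q' := fun s' => forall blk i, blk < B -> i < 2 ^ (h + 2) ->
      ft s' (8, ikey [:: blk; i]) = (\fsum_(j < i.+1) (a blk j * b blk (i - j)%N))%R) _ (leqnn _));
  last first.
  by move=> s' E H; split=> //; apply: eqoff_keeps_conv E.
set Q := B * 2 ^ h * (h + 3) ^ 4.
have H4 : 1 <= (h + 3) ^ 4 by rewrite expn_gt0 addn3.
have h3_4 : h + 3 <= (h + 3) ^ 4 by rewrite -{1}(expn1 (h + 3)) leq_pexp2l // addn3.
have BQ : B * 2 ^ h <= Q by rewrite leq_pmulr.
have hQ : h + 3 <= Q.
  by apply: leq_trans h3_4 _; rewrite leq_pmull // muln_gt0 B0 expn_gt0.
have kV : h + h + 8 < V.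
  by apply: leq_trans (ltn_expl _ (isT : 1 < 4)) _; apply: leq_trans BV; rewrite leq_pmull.
have hl4 : h + 4 <= lim by clear -hlim; lia.
pose T6 := 4 * out_K * Q.
pose T5 := bwd_loop_K * (432 * Q) + T6.
pose T4 := base_K * (432 * Q) + T5.
pose T3 := fwd_loop_K * (2 * (432 * Q)) + T4.
pose T2 := 72 * Q * (Tin + in_K) + T3.
pose T1 := 30 * Q + T2.
apply: (ok_seq (T2 := T1) (ok_le (depth_ok PT E11 hl4 limV) (_ : _ <= 30 * Q))).
- by rewrite leq_mul2l.
move=> s1 E1 /=; set kap := ir s1 12 => -[kh p2 rk].
have k1 : keeps_conv s s1 by apply: eqoff_keeps_conv E1.
have kV1 : kap < V by clear -kV kh; lia.
apply: (ok_seq (T2 := T2) (ok_le (@stages_ok F V s1 kap erefl kV1) (_ : _ <= 30 * Q)));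
  last exact: leqnn.
  by rewrite leq_mul2l; apply: leq_trans hQ; clear -kh; lia.
move=> s2 E2 /=; set ST := ir s2 22 => -[kS STk pS].
have k2 : keeps_conv s1 s2 by apply: eqoff_keeps_conv E2.
have k12 := keeps_conv_trans k1 k2.
have PT1 := pre_tabs_eqoff PT E1 isT isT isT isT.
have PT2 := pre_tabs_eqoff PT1 E2 isT isT isT isT.
have klim : kap + kap + 4 <= lim by clear -hlim kh; lia.
have BrV : B * r ^ (kap + kap + 4) <= V.
  apply: leq_trans BV; rewrite leq_mul //; apply: leq_trans (_ : 4 ^ (kap + kap + 4) <= _).
    by rewrite leq_exp2r //; clear; lia.
  by rewrite leq_exp2l //; clear -kh; lia.
have BrV' j : j <= kap + kap + 4 -> B * r ^ j <= V.
  by move=> le; apply: leq_trans BrV; rewrite leq_mul // leq_pexp2l.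
have rV j : j <= kap + kap + 4 -> r ^ j <= V.
  by move=> le; apply: leq_trans (BrV' j le); rewrite leq_pmull.
have k2l : kap + 2 <= lim by clear -klim; lia.
have e12 : ir s2 12 = kap by rewrite (eo_i E2).
have e10 : ir s2 10 = B by case: k12 => -> //.
have BV' : 0 < B <= V.
  by rewrite B0; apply: leq_trans (BrV' 0 _); rewrite ?muln1.
have LV : 0 < r ^ (kap + 2) <= V.
  by rewrite expn_gt0 r0 rV //; clear; lia.
have eL : it s2 (2, ikey [:: ir s2 12 + 2]) = r ^ (kap + 2) by rewrite e12 (pt_pw PT2).
have cost := conv_cost_pow r14 kh rk STk pS.
have costB : ST.+1 * (kap.+1 * (B * r ^ (kap + ST + 3))) <= 432 * Q.
  have -> : ST.+1 * (kap.+1 * (B * r ^ (kap + ST + 3))) =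
     B * (ST.+1 * (kap.+1 * r ^ (kap + ST + 3))) by rewrite (mulnCA _ B) (mulnCA _ B).
  have -> : 432 * Q = B * (432 * 2 ^ h * (h + 3) ^ 4).
    by rewrite /Q; clear; move: (2 ^ h) ((h + 3) ^ 4) => x y; ring.
  by rewrite leq_mul.
apply: (ok_seq (T2 := T3) (ok_le (@conv_in_ok F V s2 cA cB B Tin a b (r ^ (kap + 2)) pA pB
   (computes_keeps k12 cmA) (computes_keeps k12 cmB) eL e10 BV' LV) (_ : _ <= 72 * Q * (Tin +
     in_K)))); last exact: leqnn.
  have r9 : r ^ 2 <= 9.
    by rewrite -[9]/(3 ^ 2) leq_exp2r //; clear -r14; lia.
  have : B * r ^ (kap + 2) <= 36 * Q.
    apply: leq_trans (_ : B * (2 ^ (h + 2) * 9) <= _).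
      by rewrite leq_mul // [r ^ _]expnD; apply: leq_mul.
    by move: BQ; rewrite expnD; clear; lia.
  by move=> le; rewrite mulnA leq_mul //; move: (B * r ^ _) le => x; clear; lia.
move=> s3 E3 v3; have [i1 i2 i3] := in_mods pA pB.
have PT3 : pre_tabs s3 r lim.
  by apply: pre_tabs_eqoff PT2 E3 _ _ _ _; rewrite ?i1 ?i2 ?i3.
have f12 : ir s3 12 = kap by rewrite (eo_i E3) ?i1.
have f22 : ir s3 22 = ST by rewrite (eo_i E3) ?i1.
have f10 : ir s3 10 = B by rewrite (eo_i E3) ?i1.
have f11 : ir s3 11 = h by rewrite (eo_i E3) ?i1 //; case: k12 => ->.
apply: (ok_seq (T2 := T4) (ok_le (fwd_loop_ok PT3 f12 f22 f10 STk klim B0 BrV) (_ : _ <=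
  fwd_loop_K * (2 * (432 * Q))))); last exact: leqnn.
  by rewrite leq_mul // -mulnA leq_mul.
move=> s4 E4 [w1 w2].
have PT4 := pre_tabs_eqoff PT3 E4 isT isT isT isT.
have g12 : ir s4 12 = kap by rewrite (eo_i E4).
have g22 : ir s4 22 = ST by rewrite (eo_i E4).
have g10 : ir s4 10 = B by rewrite (eo_i E4).
apply: (ok_seq (T2 := T5) (ok_le (base_ok PT4 g12 g22 g10 STk klim B0 BrV) (_ : _ <= base_K *
  (432 * Q)))); last exact: leqnn.
  rewrite leq_mul2l; apply/orP; right; apply: leq_trans costB.
  by rewrite mulnA leq_pmull.
move=> s5 E5 [b1 b2].
have K5 sd st l : sd < 2 -> ft s5 (5, ikey (sd :: st :: l)) = ft s4 (5, ikey (sd :: st :: l)).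
  by move=> sd2; rewrite b2 // => l' /ikey_inj[x1 _ _]; rewrite x1 in sd2.
have P5 : block_products s5 r B kap ST.
  apply: block_products_base => // blk p b1' b2'; rewrite b1 //; apply: eq_bigr => i _.
  by rewrite (K5 0 ST [:: _; _]) // (K5 1 ST [:: _; _]).
have W5 sd st : sd < 2 -> st < ST -> forward_dft s5 r B kap sd st.
  by move=> d2 sST; apply: forward_dft_ext (w1 _ _ d2 sST) => l; apply: K5.
have PT5 := pre_tabs_eqoff PT4 E5 isT isT isT isT.
have x12 : ir s5 12 = kap by rewrite (eo_i E5).
have x22 : ir s5 22 = ST by rewrite (eo_i E5).
have x10 : ir s5 10 = B by rewrite (eo_i E5).
apply: (ok_seq (T2 := T6) (ok_le (bwd_loop_ok PT5 x12 x22 x10 STk klim B0 BrV W5 P5) (_ : _ <=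
  bwd_loop_K * (432 * Q)))); last exact: leqnn.
  by rewrite leq_mul.
move=> s6 E6 [P6 K6].
have PT6 := pre_tabs_eqoff PT5 E6 isT isT isT isT.
have y12 : ir s6 12 = kap by rewrite (eo_i E6).
have y11 : ir s6 11 = h by rewrite (eo_i E6) // (eo_i E5) // (eo_i E4).
have y10 : ir s6 10 = B by rewrite (eo_i E6).
have hV : 2 ^ (h + 2) <= V.
  apply: leq_trans p2 _; apply: rV; clear; lia.
have kl : kap < lim by clear -klim; lia.
have h2l : h + 2 <= lim by clear -hl4; lia.
apply: ok_conseq (conv_out_ok PT6 y12 y11 y10 kl h2l BV' hV) _ _.
  have -> : T6 = 4 * Q * out_K by rewrite /T6 mulnAC.
  rewrite leq_mul //.
  by move: BQ; rewrite expnD; clear; lia.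
move=> s7 E7 v7 blk i bB iD; rewrite v7 //.
have N0 : 0 < r ^ kap.+1 by rewrite expn_gt0 r0.
have EL : r ^ (kap + 2) = r * r ^ kap.+1 by rewrite addn2 expnS.
have b0 : blk < B * r ^ (kap + 0 - kap %/ 2 ^ 0) by rewrite addn0 divn1 subnn muln1.
have := P6 blk b0; rewrite /blockval divn1 subnn expn0 expr1 EL => HX.
have val0 p : p < r * r ^ kap.+1 -> ft s6 (5, ikey [:: 0; 0; blk; p]) = a blk p /\
   ft s6 (5, ikey [:: 1; 0; blk; p]) = b blk p.
  rewrite -EL => pL; rewrite (K6 0 0 [:: _; _]) // (K6 1 0 [:: _; _]) //.
  rewrite (K5 0 0 [:: _; _]) // (K5 1 0 [:: _; _]) //.
  by rewrite (w2 0 [:: _; _]) (w2 1 [:: _; _]); apply: v3.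
apply: (@linear_of_cyclic F r (r ^ kap.+1) (a blk) (b blk) (fun p => ft s6 (5, ikey [:: 2; 0;
  blk; p])) Da Db) => //.
- exact: ha.
- exact: hb.
- by apply: leq_trans hD _; rewrite ltnS.
- rewrite HX; congr (_ * _)%R; apply: eq_sem => p pL; have [v1 v2] := val0 p pL;
  [exact: v1|exact: v2].
  by apply: leq_trans p2.
rewrite /T1 /T2 /T3 /T4 /T5 /T6 /conv_K.
move: in_K fwd_loop_K base_K bwd_loop_K out_K => x1 x2 x3 x4 x5; clear; nia.
Qed.

End Convolution.

#[global] Opaque conv_K.

(** * Batched multipoint evaluation *)

(** Reading beyond the length n gives 0.

Index registers of the evaluation: 40 the number J of polynomials; 41 the height K of the
trees; 42 the number 2 ^ K of points of each; 43 a loop counter; 44 the level h; 46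
and 47 hold 2 ^ h and 2 ^ (h + 1); 48 the number of nodes of a tree on the level
being filled; 50 and 51 counters.  Field tables: 10 the coefficients of the
polynomials; 11 the node polynomials, with keys level, node, index; 12 the Newton
iterates; 13 the Newton corrections; 14 the expansions at infinity, with keys level,
node, index, so that the values are on level 0. *)
Definition ldif (i n : iexpr) (tab : nat) (ks : seq iexpr) : cmd :=
  IfLt i n (FLd 0 tab (map KE ks)) (FCst 0 false).

(** The J trees form one forest with J * 2 ^ (K - h) nodes on level h; the children of
node v are the nodes 2 v and 2 v + 1 of the level below. *)
Definition tree_in c := ldif (EV 33) (EAdd (EV 46) (EC 1)) 11
  [:: EV 44; EAdd (EMul (EC 2) (EV 30)) (EC c); EV 33].
Definition tree_setup : cmd := seqs
  [:: ISet 44 (EV 43); ILd 46 3 [:: KE (EV 44)];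
      ILd 48 3 [:: KE (ESub (EV 41) (EAdd (EV 44) (EC 1)))];
      ISet 10 (EMul (EV 40) (EV 48)); ISet 11 (EV 44);
      ILd 47 3 [:: KE (EAdd (EV 44) (EC 1))]].
Definition copy_body : cmd := FLd 0 8 [:: KE (EV 50); KE (EV 51)].
Definition tree_rs := [:: (50, EV 10); (51, EAdd (EV 47) (EC 1))].
Definition tree_copy : cmd := fill 11 [:: EAdd (EV 44) (EC 1)] tree_rs copy_body.
Definition tree_step : cmd := Seq tree_setup (Seq (conv (tree_in 0) (tree_in 1)) tree_copy).
Definition tree_cmd : cmd := For 43 (EV 41) tree_step.

Lemma level_arith K P A B C : 0 < P ->
  2 + 3 + K * (A + (P * B + 4 * P * C) + 6) <= (20 + A + B + 4 * C) * (K.+1 * P).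
Proof. nia. Qed.

Section NodeTree.
Variables (F : finFieldType) (V : nat).
Implicit Types (s : store F).
Variables (r lim J K : nat).

Record mcore s : Prop := MCore {
  mc_pt : pre_tabs s r lim;
  mc_J : ir s 40 = J;
  mc_K : ir s 41 = K;
  mc_S : ir s 42 = 2 ^ K
}.

Lemma mcore_conv s s' : keeps_conv s s' -> mcore s -> mcore s'.
Proof.
move=> [a b c] [[h1 h2 h3 h4 h5] e1 e2 e3]; split; try by rewrite a.
split=> //; first by rewrite a.
- by move=> i /h3; rewrite b.
- by move=> i /h4; rewrite b.
by move=> i /h5; rewrite c.
Qed.

Lemma mcore_eqoff c s s' : eqoff c s s' -> ~~ has (mem [:: 6; 40; 41; 42]) (mod_ireg c) ->
  2 \notin mod_itab c -> 3 \notin mod_itab c -> 7 \notin mod_ftab c -> mcore s -> mcore s'.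
Proof.
move=> E /hasPn n n2 n3 n7 [h e1 e2 e3].
have nn x : x \in [:: 6; 40; 41; 42] -> x \notin mod_ireg c.
  by move=> xin; apply/negP => /n; rewrite /= xin.
by split; rewrite ?(eo_i E) ?nn //; apply: pre_tabs_eqoff h E _ _ _ _; rewrite ?nn.
Qed.

Hypothesis J0 : 0 < J.
Hypothesis Klim : K + K + 8 <= lim.
Hypothesis limV : lim <= V.
Hypothesis HV : J * 2 ^ K * 4 ^ (K + K + 8) <= V.

(** Up to a constant, the cost of one multiplication for each of the J instances. *)
Definition mpe_P := J * 2 ^ K * (K + 3) ^ 4.

Lemma JK_V : J * 2 ^ K * 4 <= V.
Proof.
apply: leq_trans HV; rewrite leq_mul // -{1}(expn1 4) leq_pexp2l //.
by rewrite addn_gt0 orbT.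
Qed.

(** The products for all nodes of a level are no larger than those for the roots. *)
Lemma conv_side h B : h <= K -> B * 2 ^ h <= J * 2 ^ K ->
  [/\ h + h + 8 <= lim, B * 4 ^ (h + h + 8) <= V &
      B * 2 ^ h * (h + 3) ^ 4 <= mpe_P].
Proof.
move=> hK le; split.
- by apply: leq_trans Klim; rewrite leq_add2r leq_add.
- apply: leq_trans HV; apply: leq_mul.
    by apply: leq_trans le; rewrite leq_pmulr // expn_gt0.
  by rewrite leq_exp2l // leq_add2r leq_add.
by rewrite leq_mul // leq_exp2r // leq_add2r.
Qed.

Definition tree_K := 20 + static_cost tree_setup + (conv_K + 100 * (static_cost (tree_in 0) +
  static_cost (tree_in 1))) +
  4 * (static_cost copy_body + fillK [:: EAdd (EV 44) (EC 1)] tree_rs).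

Lemma tree_ok s (xs : nat -> F) : mcore s ->
  (forall v i, v < J * 2 ^ K -> i < 2 -> ft s (11, ikey [:: 0; v; i]) = ((nodepoly xs 0 v)`_i)%R) ->
  ok V tree_cmd s (tree_K * (K.+1 * mpe_P)) (fun s' =>
    forall h v i, h <= K -> v < J * 2 ^ (K - h) -> i < (2 ^ h).+1 ->
      ft s' (11, ikey [:: h; v; i]) = ((nodepoly xs h v)`_i)%R).
Proof.
move=> C leaf.
have P0 : 0 < mpe_P by rewrite !muln_gt0 J0 !expn_gt0 addn3.
pose Inv x (s' : store F) := forall h v i, h <= x -> v < J * 2 ^ (K - h) -> i < (2 ^ h).+1 ->
      ft s' (11, ikey [:: h; v; i]) = ((nodepoly xs h v)`_i)%R.
have KV : K < V by apply: leq_trans limV; apply: leq_trans Klim; clear; lia.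
pose TX := static_cost (tree_in 0) + static_cost (tree_in 1).
pose T2 := mpe_P * (conv_K + 100 * TX).
pose T3 := 4 * mpe_P * (static_cost copy_body + fillK [:: EAdd (EV 44) (EC 1)] tree_rs).
apply: (@ok_for F V 43 _ _ s K _ (static_cost tree_setup + (T2 + T3)) Inv) => //.
- by rewrite /= (mc_K C).
- exact: ltnW.
- move=> [|//] v i _; rewrite subn0 expn0; exact: leaf.
- move=> h s1 hK E1 I1.
  have C1 : mcore (seti 43 h s1).
    have := mcore_eqoff E1 isT isT isT isT C.
    by case=> [[a1 a2 a3 a4 a5] b1 b2 b3].
  have hlim : h.+1 <= lim by apply: leq_trans Klim; clear -hK; lia.
  pose B := J * 2 ^ (K - h.+1).
  have B0 : 0 < B by rewrite muln_gt0 J0 expn_gt0.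
  have BE : B * 2 ^ h.+1 = J * 2 ^ K by rewrite /B -mulnA -expnD subnK.
  have BE2 : B * 2 ^ h <= J * 2 ^ K by rewrite -BE leq_mul // leq_exp2l.
  have BV : B <= V.
    apply: leq_trans JK_V; rewrite -BE -mulnA leq_pmulr //.
    by rewrite muln_gt0 expn_gt0.
  have [s11 s12 s13] := conv_side (ltnW hK) BE2.
  pose Q2 (s' : store F) := [/\ ir s' 10 = B, ir s' 11 = h, ir s' 44 = h,
    ir s' 46 = 2 ^ h & ir s' 47 = 2 ^ h.+1].
  apply: (@ok_seq _ _ _ _ _ (static_cost tree_setup) (T2 + T3) _ Q2) => //.
  + have /= p1 := @pt_p2 _ _ _ _ (mc_pt C1) h (ltnW hlim).
    have /= p2 := @pt_p2 _ _ _ _ (mc_pt C1) h.+1 hlim.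
    have /= p3 : it (seti 43 h s1) (3, ikey [:: K - h.+1]) = 2 ^ (K - h.+1).
      by apply: (pt_p2 (mc_pt C1)); apply: leq_trans Klim; clear; lia.
    have /= k1 := mc_K C1; have /= k2 := mc_J C1.
    have hV : h <= V by apply: ltnW; apply: leq_ltn_trans KV; apply: ltnW.
    by apply: ok_lf => //=; rewrite ?k1 ?k2 ?addn1 ?p1 ?p2 ?p3.
  move=> s2 E2 [e10 e11 e44 e46 e47].
  have C2 := mcore_eqoff E2 isT isT isT isT C1.
  have F2 l : ft s2 (11, l) = ft s1 (11, l) by rewrite (eo_ft E2).
  pose a c blk pos := ((nodepoly xs h (blk.*2 + c))`_pos)%R.
  have comp c : c < 2 -> computes V (tree_in c) s2 B TX (a c).
    move=> c2 s' blk pos [r1 r2 r3] bB e30 e33.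
    apply: ok_le (ok_lf (c := tree_in c) _ _ _) _ => //.
    - by rewrite /=; case: ifP.
    - rewrite /= e33 r1 // e46; case: ifP => /= lt; last first.
        rewrite /a nth_default //; apply: leq_trans (size_nodepoly _ _ _) _.
        by move: lt; clear; lia.
      rewrite e30 r1 // e44 r3 // F2 mul2n (I1 h (blk.*2 + c) pos) //; last by move: lt; clear; lia.
      have -> : K - h = (K - h.+1).+1 by clear -hK; lia.
      rewrite expnS mulnCA -/B; move: c2 bB; clear; lia.
  have szc c blk pos : (2 ^ h).+1 <= pos -> a c blk pos = 0%R.
    by move=> le; apply: nth_default; apply: leq_trans (size_nodepoly _ _ _) le.
  have p2h : 0 < 2 ^ h by rewrite expn_gt0.
  apply: (@ok_seq _ _ _ _ _ T2 T3) => //.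
  + apply: ok_le (@conv_ok F V s2 lim r B h (tree_in 0) (tree_in 1) TX (a 0) (a 1)
      (2 ^ h).+1 (2 ^ h).+1 isT isT (mc_pt C2) e10 e11 s11 B0 s12 (comp 0 isT) (comp 1 isT)
        (szc 0) (szc 1) _ limV) _.
      by rewrite expnD; move: p2h; clear; lia.
    exact: leq_mul s13 (leqnn _).
  move=> s3 E3 [k3 v3].
  have [r1 r2 r3] := k3.
  pose val l := ft s3 (8, ikey [:: nth 0 l 0; nth 0 l 1]).
  apply: ok_conseq (@fill_lf F V 11 [:: EAdd (EV 44) (EC 1)] tree_rs copy_body s3
     [:: B; (2 ^ h.+1).+1] [:: h.+1] val _ _ _ _ _ _ _) _ _ => //.
  + by rewrite /= r1 // e44 addn1.
  + by rewrite /= !r1 // e10 e47 addn1.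
  + rewrite /= B0 BV /= andbT; apply: leq_trans JK_V; rewrite -BE expnS.
    by move: p2h B0; clear; nia.
  + move=> idx s' /box2P[blk [p [-> b1 b2]]] E _ Hr.
    have /= g0 := Hr 0 isT; have /= g1 := Hr 1 isT.
    by rewrite /val /= g0 g1 (eo_ft E).
  + rewrite !big_cons big_nil muln1 /T3; apply: leq_mul (leqnn _).
    rewrite /mpe_P -BE expnS; have : 0 < (K + 3) ^ 4 by rewrite expn_gt0 addn3.
    by move: (2 ^ h) p2h ((K + 3) ^ 4) B0; clear; nia.
  move=> s4 E4 [v4 k4] h' v i; rewrite leq_eqVlt => /orP[/eqP ->|lt] vB ib; last first.
    rewrite k4; first by rewrite r3 // F2; apply: I1.
    by move=> idx _ /ikey_inj[E5 _]; rewrite E5 ltnn in lt.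
  have := v4 [:: v; i] => /= ->; last by rewrite /box /= vB ib.
  rewrite /val /= (v3 v i) //; last first.
    apply: leq_trans ib _; rewrite !expnS expnD; move: p2h; clear; lia.
  by rewrite nodepolyS coefM; apply: eq_bigr => j _; rewrite /a addn0 addn1.
exact: level_arith P0.
Qed.

End NodeTree.

Definition inst_rs := [:: (50, EV 40); (51, EV 42)].
Definition delta_body : cmd := IfLt (EV 51) (EC 1) (FCst 0 true) (FCst 0 false).
Definition nwt_start : cmd := fill 12 [:: EC 0] inst_rs delta_body.
Definition nwt_setup : cmd := Seq (ISet 10 (EV 40)) (ISet 11 (EV 41)).
Definition nwt_a := ldif (EV 33) (EAdd (EV 42) (EC 1)) 11 [:: EV 41; EV 30; EV 33].
Definition nwt_b := ldif (EV 33) (EV 42) 12 [:: EV 43; EV 30; EV 33].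
Definition nwt_d := ldif (EV 33) (EV 42) 13 [:: EV 30; EV 33].
Definition nwt_body : cmd :=
  Seq (FLd 1 8 [:: KE (EV 50); KE (EV 51)])
  (Seq delta_body (Seq (FBin OpAdd 0 0 0) (FBin OpSub 0 0 1))).
(** G becomes G (2 - R G) modulo X^(2 ^ K), where R is the polynomial of the root. *)
Definition nwt_step : cmd :=
  Seq (conv nwt_a nwt_b) (Seq (fill 13 [::] inst_rs nwt_body)
    (Seq (conv nwt_d nwt_b) (fill 12 [:: EAdd (EV 43) (EC 1)] inst_rs copy_body))).
Definition nwt_cmd : cmd := Seq nwt_start (Seq nwt_setup (For 43 (EV 41) nwt_step)).

Definition root_a := ldif (EV 33) (EV 42) 10 [:: EV 30; ESub (ESub (EV 42) (EC 1)) (EV 33)].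
Definition root_b := ldif (EV 33) (EV 42) 12 [:: EV 41; EV 30; EV 33].
Definition root_cmd : cmd :=
  Seq nwt_setup (Seq (conv root_a root_b) (fill 14 [:: EV 41] inst_rs copy_body)).

Section NewtonInverse.
Variables (F : finFieldType) (V : nat).
Implicit Types (s : store F).
Variables (r lim J K : nat).
Hypothesis J0 : 0 < J.
Hypothesis Klim : K + K + 8 <= lim.
Hypothesis limV : lim <= V.
Hypothesis HV : J * 2 ^ K * 4 ^ (K + K + 8) <= V.
Local Notation mcore := (@mcore F r lim J K).
Local Notation mpe_P := (mpe_P J K).

Lemma ldif_computes s B n tab ks u : tab \notin [:: 5; 6; 8] ->
  (forall s' blk pos, keeps_conv s s' -> blk < B -> ir s' 30 = blk -> ir s' 33 = pos ->
    if pos < ev (ir s') n then ft s (tab, ikey (map (ev (ir s')) ks)) = u blk pos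
    else u blk pos = 0%R) ->
  computes V (ldif (EV 33) n tab ks) s B (static_cost (ldif (EV 33) n tab ks)) u.
Proof.
move=> nt H s' blk pos k bB e30 e33; apply: ok_lf => //.
  by rewrite /=; case: ifP.
have := H s' blk pos k bB e30 e33; rewrite /= e33; case: ifP => //= _ <-.
by case: k => _ _ k3; rewrite k3 // /ikey -!map_comp.
Qed.

Lemma mconv_ok s h B cA cB T a b Da Db : mcore s -> pure_cmd cA -> pure_cmd cB ->
  ir s 10 = B -> ir s 11 = h -> h <= K -> 0 < B -> B * 2 ^ h <= J * 2 ^ K ->
  computes V cA s B (static_cost cA) a -> computes V cB s B (static_cost cB) b ->
  static_cost cA <= T -> static_cost cB <= T ->
  (forall blk p, Da <= p -> a blk p = 0%R) -> (forall blk p, Db <= p -> b blk p = 0%R) ->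
  Da + Db <= (2 ^ (h + 2)).+1 ->
  ok V (conv cA cB) s (mpe_P * (conv_K + 100 * T))
   (fun s' => [/\ keeps_conv s s', mcore s' & forall blk i, blk < B -> i < 2 ^ (h + 2) ->
      ft s' (8, ikey [:: blk; i]) = (\fsum_(j < i.+1) (a blk j * b blk (i - j)%N))%R]).
Proof.
move=> C pA pB e10 e11 hK B0 le cmA cmB lA lB ha hb hD.
have [s1 s2 s3] := conv_side Klim HV hK le.
have cmA' : computes V cA s B T a.
  by move=> s' blk pos k b1 e1 e2; apply: ok_le (cmA _ _ _ k b1 e1 e2) lA.
have cmB' : computes V cB s B T b.
  by move=> s' blk pos k b1 e1 e2; apply: ok_le (cmB _ _ _ k b1 e1 e2) lB.
apply: ok_conseq (conv_ok pA pB (mc_pt C) e10 e11 s1 B0 s2 cmA' cmB' ha hb hD limV) (leq_mul s3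
  (leqnn _)) _.
by move=> s' _ [k H]; split=> //; apply: mcore_conv k C.
Qed.

Lemma mpe_P0 : 0 < mpe_P.
Proof. by rewrite !muln_gt0 J0 !expn_gt0 addn3. Qed.

Lemma JKP : J * 2 ^ K <= mpe_P.
Proof. by rewrite leq_pmulr // expn_gt0 addn3. Qed.

Lemma SV : 2 ^ K <= V.
Proof.
apply: leq_trans (JK_V HV); apply: leq_trans (leq_pmulr _ _) => //.
by rewrite leq_pmull.
Qed.

Lemma JV : J <= V.
Proof.
apply: leq_trans (JK_V HV); apply: leq_trans (leq_pmulr _ _) => //.
by rewrite leq_pmulr // expn_gt0.
Qed.

Lemma KV : K < V.
Proof. by apply: leq_trans (ltn_expl _ _) SV. Qed.

Lemma inst_fill_ok s tab pre b pv (val : nat -> nat -> F) : mcore s ->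
  fill_wf pre inst_rs b -> loopfree b -> (forall s' : store F, safe V b s') ->
  [seq ev (ir s) e | e <- pre] = pv ->
  (forall s' j i, eqoff (fill tab pre inst_rs b) s s' -> ir s' 50 = j -> ir s' 51 = i ->
     j < J -> i < 2 ^ K -> fr (run b s') 0 = val j i) ->
  ok V (fill tab pre inst_rs b) s (mpe_P * (static_cost b + fillK pre inst_rs))
   (fun s2 => (forall j i, j < J -> i < 2 ^ K -> ft s2 (tab, ikey (pv ++ [:: j; i])) = val j i) /\
     forall ks, (forall j i, ks <> ikey (pv ++ [:: j; i])) ->
        ft s2 (tab, ks) = ft s (tab, ks)).
Proof.
move=> C wfb lf sf Epv H.
apply: ok_conseq (@fill_lf F V tab pre inst_rs b s [:: J; 2 ^ K] pv
  (fun l => val (nth 0 l 0) (nth 0 l 1)) wfb lf sf Epv _ _ _) _ _.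
- by rewrite /= (mc_J C) (mc_S C).
- by rewrite /= J0 JV expn_gt0 SV.
- move=> idx s' /box2P[j [i [-> b1 b2]]] E _ Hr.
  by apply: (H s' j i E (Hr 0 isT) (Hr 1 isT)).
- by rewrite !big_cons big_nil muln1 leq_mul // JKP.
move=> s' E [h1 h2]; split=> [j i b1 b2|ks nk].
  by have := h1 [:: j; i] => /= ->; rewrite // /box /= b1 b2.
by apply: h2 => idx /box2P[j [i [-> _ _]]]; apply: nk.
Qed.

Definition nwt_T := static_cost nwt_a + static_cost nwt_b + static_cost nwt_d.
Definition nwt_K := 50 + static_cost nwt_setup + (static_cost delta_body + fillK [:: EC 0]
  inst_rs) +
  2 * (conv_K + 100 * nwt_T) + (static_cost nwt_body + fillK [::] inst_rs) +
  (static_cost copy_body + fillK [:: EAdd (EV 43) (EC 1)] inst_rs).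

Definition Gpoly s t j : {poly F} := (\poly_(i < 2 ^ K) ft s (12, ikey [:: t; j; i]))%R.

Lemma nwt_arith P A B C D E : 0 < P ->
  P * A + (B + (2 + 3 + K * (P * C + (P * D + (P * C + P * E)) + 6))) <=
  (50 + B + A + 2 * C + D + E) * (K.+1 * P).
Proof. clear; nia. Qed.

Lemma nwt_ok s (xs : nat -> F) : mcore s ->
  (forall v i, v < J -> i < (2 ^ K).+1 ->
    ft s (11, ikey [:: K; v; i]) = ((nodepoly xs K v)`_i)%R) ->
  ok V nwt_cmd s (nwt_K * (K.+1 * mpe_P)) (fun s' =>
    forall j, j < J -> eqX (2 ^ K) (nodepoly xs K j * Gpoly s' K j)%R 1%R).
Proof.
move=> C TR; have S0 : 0 < 2 ^ K by rewrite expn_gt0.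
have T1 : static_cost nwt_a <= nwt_T by rewrite /nwt_T -addnA leq_addr.
have T2 : static_cost nwt_b <= nwt_T by rewrite /nwt_T addnAC leq_addl.
have T3 : static_cost nwt_d <= nwt_T by rewrite /nwt_T leq_addl.
pose C1 := conv_K + 100 * nwt_T.
pose C2 := static_cost nwt_body + fillK [::] inst_rs.
pose C3 := static_cost copy_body + fillK [:: EAdd (EV 43) (EC 1)] inst_rs.
pose Tb := mpe_P * C1 + (mpe_P * C2 + (mpe_P * C1 + mpe_P * C3)).
apply: (ok_seq (T2 := static_cost nwt_setup + (2 + 3 + K * (Tb + 6)))
  (@inst_fill_ok s 12 [:: EC 0] delta_body [:: 0] (fun j i => (i == 0)%:R%R) C isT isT _ erefl _)).
- by move=> s' /=; case: ifP.
- move=> s' j i E _ e51 _ _; rewrite /= e51; case: i {e51} => //.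
- move=> s1 E1 [g0 _].
  have CC1 := mcore_eqoff E1 isT isT isT isT C.
  apply: (@ok_seq _ _ _ _ _ (static_cost nwt_setup) (2 + 3 + K * (Tb + 6)) _ (fun s' =>
    ir s' 10 = J /\ ir s' 11 = K)) => //.
    by apply: ok_lf => //=; rewrite (mc_J CC1) (mc_K CC1) // JV (ltnW KV).
  move=> s2 E2 [e10 e11].
  have CC2 := mcore_eqoff E2 isT isT isT isT CC1.
  pose Inv x (s' : store F) := forall j, j < J ->
    eqX (2 ^ x) (nodepoly xs K j * Gpoly s' x j)%R 1%R.
  apply: (@ok_for F V 43 _ _ s2 K _ Tb Inv) => //.
  + by rewrite /= (mc_K CC2).
  + exact: ltnW KV.
  + move=> j jJ i; rewrite expn0 ltnS leqn0 => /eqP ->.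
    rewrite coefM big_ord1 nodepoly_coef0 mul1r coef_poly S0 subn0 (eo_ft E2) // g0 //.
    by rewrite coef1.
  move=> x s3 xK E3 I3.
  have CC3 : mcore (seti 43 x s3).
    have := mcore_eqoff E3 isT isT isT isT CC2.
    by case=> [[a1 a2 a3 a4 a5] b1 b2 b3].
  have f10 : ir (seti 43 x s3) 10 = J by rewrite /= (eo_i E3).
  have f11 : ir (seti 43 x s3) 11 = K by rewrite /= (eo_i E3).
  have f43 : ir (seti 43 x s3) 43 = x by [].
  have TR3 v i : v < J -> i < (2 ^ K).+1 ->
    ft (seti 43 x s3) (11, ikey [:: K; v; i]) = ((nodepoly xs K v)`_i)%R.
    by move=> vJ ik; rewrite /= (eo_ft E3) // (eo_ft E2) // (eo_ft E1) //; apply: TR.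
  have I3' j : j < J -> eqX (2 ^ x) (nodepoly xs K j * Gpoly (seti 43 x s3) x j)%R 1%R := I3 j.
  move: (seti 43 x s3) CC3 f10 f11 f43 TR3 I3' => s4 CC4 f10 f11 f43 TR4 I4.
  pose a j i := ((nodepoly xs K j)`_i)%R.
  pose b j i := ((Gpoly s4 x j)`_i)%R.
  have ha blk p : (2 ^ K).+1 <= p -> a blk p = 0%R.
    by move=> le; apply: nth_default; apply: leq_trans (size_nodepoly _ _ _) le.
  have hb blk p : 2 ^ K <= p -> b blk p = 0%R.
    by move=> le; apply: nth_default; apply: leq_trans (size_poly _ _) le.
  have hD : (2 ^ K).+1 + 2 ^ K <= (2 ^ (K + 2)).+1.
    by rewrite expnD; move: S0; clear; lia.
  have cb s' : keeps_conv s4 s' -> eqoff (fill 13 [::] inst_rs nwt_body) s' s' -> True by [].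
  apply: (ok_seq (T2 := mpe_P * C2 + (mpe_P * C1 + mpe_P * C3))
    (@mconv_ok s4 K J nwt_a nwt_b nwt_T a b (2 ^ K).+1 (2 ^ K) CC4 isT isT f10 f11 (leqnn _) J0
      (leqnn _) _ _ T1 T2 ha hb hD)); last exact: leqnn.
  + apply: ldif_computes => // s' blk pos k bJ e30 e33; have [r1 r2 r3] := k.
    rewrite /= e30 e33 !r1 // (mc_S CC4) (mc_K CC4) addn1; case: ifP => lt.
      exact: TR4.
    by apply: ha; rewrite leqNgt lt.
  + apply: ldif_computes => // s' blk pos k bJ e30 e33; have [r1 r2 r3] := k.
    rewrite /= e30 e33 !r1 // (mc_S CC4) f43; case: ifP => lt.
      by rewrite /b coef_poly lt.
    by apply: hb; rewrite leqNgt lt.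
  move=> s5 E5 [k5 CC5 v5]; have [r1 r2 r3] := k5.
  pose Np j : {poly F} := (2%:R - nodepoly xs K j * Gpoly s4 x j)%R.
  apply: (ok_seq (T2 := mpe_P * C1 + mpe_P * C3)
    (@inst_fill_ok s5 13 [::] nwt_body [::] (fun j i => ((Np j)`_i)%R) CC5 isT isT _ erefl _));
      last exact: leqnn.
  + by move=> s' /=; case: ifP.
  + move=> s' j i E e50 e51 jJ iK; rewrite /= e50 e51 /Np coefB coefM.
    rewrite (eo_ft E) // v5 //; last by apply: leq_trans iK _; rewrite leq_exp2l // leq_addr.
    have -> : (((2%:R : {poly F})`_i) = (i == 0)%:R + (i == 0)%:R)%R.
      by rewrite coefMn coef1 mulr2n.
    by case: (i).
  move=> s6 E6 [v6 _].
  have CC6 := mcore_eqoff E6 isT isT isT isT CC5.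
  pose d j i := ((\poly_(i < 2 ^ K) (Np j)`_i)`_i)%R.
  have hd blk p : 2 ^ K <= p -> d blk p = 0%R.
    by move=> le; apply: nth_default; apply: leq_trans (size_poly _ _) le.
  have h10 : ir s6 10 = J by rewrite (eo_i E6) // r1.
  have h11 : ir s6 11 = K by rewrite (eo_i E6) // r1.
  have h43 : ir s6 43 = x by rewrite (eo_i E6) // r1.
  have hD2 : 2 ^ K + 2 ^ K <= (2 ^ (K + 2)).+1 by apply: leq_trans hD; rewrite leq_add2r.
  apply: (ok_seq (T2 := mpe_P * C3)
    (@mconv_ok s6 K J nwt_d nwt_b nwt_T d b (2 ^ K) (2 ^ K) CC6 isT isT h10 h11 (leqnn _) J0
      (leqnn _) _ _ T3 T2 hd hb hD2)); last exact: leqnn.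
  + apply: ldif_computes => // s' blk pos k bJ e30 e33; have [q1 q2 q3] := k.
    rewrite /= e30 e33 !q1 // (mc_S CC6); case: ifP => lt.
      by rewrite /d coef_poly lt; apply: v6.
    by apply: hd; rewrite leqNgt lt.
  + apply: ldif_computes => // s' blk pos k bJ e30 e33; have [q1 q2 q3] := k.
    rewrite /= e30 e33 !q1 // (mc_S CC6) h43; case: ifP => lt.
      by rewrite /b coef_poly lt (eo_ft E6) // r3.
    by apply: hb; rewrite leqNgt lt.
  move=> s7 E7 [k7 CC7 v7]; have [q1 q2 q3] := k7.
  have h43' : ir s7 43 = x by rewrite q1.
  apply: ok_conseq (@inst_fill_ok s7 12 [:: EAdd (EV 43) (EC 1)] copy_body [:: x.+1]
    (fun j i => ft s7 (8, ikey [:: j; i])) CC7 isT isT _ _ _) (leqnn _) _ => //.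
  + by rewrite /= h43' addn1.
  + by move=> s' j i E e50 e51 _ _; rewrite /= e50 e51 (eo_ft E).
  move=> s8 E8 [v8 _] j jJ.
  have x2 : 2 ^ x.+1 = 2 ^ x + 2 ^ x by rewrite expnS mul2n addnn.
  apply: (@newton_step F (2 ^ K) (2 ^ x) _ (Gpoly s4 x j) (Gpoly s8 x.+1 j)
    (\poly_(i < 2 ^ K) (Np j)`_i)%R _ (I4 j jJ)) => //.
  + by rewrite leq_exp2l // ltnW.
  + by move=> i iK; rewrite coef_poly iK.
  + move=> i iK; rewrite coef_poly iK (v8 j i jJ iK) v7 //; last first.
      by apply: leq_trans iK _; rewrite leq_exp2l // leq_addr.
    by rewrite mulrC coefM.
  + by rewrite x2.
  by rewrite leq_exp2l.
exact: nwt_arith mpe_P0.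
Qed.

End NewtonInverse.

Definition dn_setup : cmd := seqs
  [:: ISet 44 (ESub (ESub (EV 41) (EC 1)) (EV 43)); ILd 46 3 [:: KE (EV 44)];
      ILd 48 3 [:: KE (ESub (EV 41) (EV 44))];
      ISet 10 (EMul (EV 40) (EV 48)); ISet 11 (EV 44);
      ILd 47 3 [:: KE (EAdd (EV 44) (EC 1))]].
(** Block c of the product belongs to the child c; c + 1 - 2 (c mod 2) is its sibling, whose
node polynomial multiplies the expansion of the parent. *)
Definition dn_a := ldif (EV 33) (EAdd (EV 46) (EC 1)) 11
  [:: EV 44; ESub (EAdd (EV 30) (EC 1)) (EMul (EC 2) (EMod (EV 30) (EC 2))); EV 33].
Definition dn_b := ldif (EV 33) (EV 47) 14
  [:: EAdd (EV 44) (EC 1); EDiv (EV 30) (EC 2); EV 33].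
Definition dn_body : cmd := FLd 0 8 [:: KE (EV 50); KE (EAdd (EV 51) (EV 46))].
Definition dn_rs := [:: (50, EV 10); (51, EV 46)].
Definition dn_step : cmd :=
  Seq dn_setup (Seq (conv dn_a dn_b) (fill 14 [:: EV 44] dn_rs dn_body)).
Definition dn_cmd : cmd := For 43 (EV 41) dn_step.

Definition leaf_body (cX : cmd) : cmd :=
  IfLt (EV 51) (EC 1) (FCst 0 true) (Seq cX (Seq (FCst 2 false) (FBin OpSub 0 2 0))).
Definition leaf_rs := [:: (50, EMul (EV 40) (EV 42)); (51, EC 2)].
Definition mpe_load : cmd := ILd 42 3 [:: KE (EV 41)].
(** cF computes the coefficient of index I[51] of polynomial I[50], and cX the point
I[50], where point v belongs to polynomial v / 2 ^ K. *)
Definition mpe (cF cX : cmd) : cmd :=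
  Seq mpe_load (Seq (fill 10 [::] inst_rs cF)
    (Seq (fill 11 [:: EC 0] leaf_rs (leaf_body cX))
       (Seq tree_cmd (Seq nwt_cmd (Seq root_cmd dn_cmd))))).

Lemma sibling c : c + 1 - 2 * (c %% 2) = if odd c then c.-1 else c.+1.
Proof. by rewrite modn2; case: odd; lia. Qed.

Lemma root_arith P A C1 C3 : 0 < P -> A + (P * C1 + P * C3) <= (A + C1 + C3) * P.
Proof. nia. Qed.

Lemma addnn_exp h : 2 ^ h.+1 = 2 ^ h + 2 ^ h.
Proof. by rewrite expnS mul2n addnn. Qed.

Section DownwardPass.
Variables (F : finFieldType) (V : nat).
Implicit Types (s : store F).
Variables (r lim J K : nat).
Hypothesis J0 : 0 < J.
Hypothesis Klim : K + K + 8 <= lim.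
Hypothesis limV : lim <= V.
Hypothesis HV : J * 2 ^ K * 4 ^ (K + K + 8) <= V.
Local Notation mcore := (@mcore F r lim J K).
Local Notation mpe_P := (mpe_P J K).

Definition root_T := static_cost root_a + static_cost root_b.
Definition root_K := static_cost nwt_setup + (conv_K + 100 * root_T) +
  (static_cost copy_body + fillK [:: EV 41] inst_rs).

Lemma root_ok s (f : nat -> nat -> F) : mcore s ->
  (forall j k, j < J -> k < 2 ^ K -> ft s (10, ikey [:: j; k]) = f j k) ->
  ok V root_cmd s (root_K * mpe_P) (fun s' =>
    forall j t, j < J -> t < 2 ^ K -> ft s' (14, ikey [:: K; j; t]) =
      midcoef (f j) (2 ^ K) (Gpoly K s K j) (2 ^ K) t).
Proof.
move=> C Hf; have S0 : 0 < 2 ^ K by rewrite expn_gt0.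
have T1 : static_cost root_a <= root_T by rewrite leq_addr.
have T2 : static_cost root_b <= root_T by rewrite leq_addl.
pose C1 := conv_K + 100 * root_T.
pose C3 := static_cost copy_body + fillK [:: EV 41] inst_rs.
apply: (@ok_seq _ _ _ _ _ (static_cost nwt_setup) (mpe_P * C1 + mpe_P * C3) _ (fun s' =>
  ir s' 10 = J /\ ir s' 11 = K)).
- by apply: ok_lf => //=; rewrite (mc_J C) (mc_K C) // (JV HV) (ltnW (KV J0 HV)).
- move=> s1 E1 [e10 e11].
  have CC1 := mcore_eqoff E1 isT isT isT isT C.
  pose a j i := if i < 2 ^ K then f j (2 ^ K - 1 - i) else 0%R.
  pose b j i := ((Gpoly K s K j)`_i)%R.
  have ha blk p : 2 ^ K <= p -> a blk p = 0%R by rewrite /a leqNgt => /negbTE ->.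
  have hb blk p : 2 ^ K <= p -> b blk p = 0%R.
    by move=> le; apply: nth_default; apply: leq_trans (size_poly _ _) le.
  have hD : 2 ^ K + 2 ^ K <= (2 ^ (K + 2)).+1.
    by rewrite expnD; move: S0; clear; lia.
  apply: (ok_seq (T2 := mpe_P * C3)
    (@mconv_ok F V r lim J K Klim limV HV s1 K J root_a root_b root_T a b (2 ^ K) (2 ^ K) CC1
      isT isT e10 e11 (leqnn _) J0 (leqnn _) _ _ T1 T2 ha hb hD)); last exact: leqnn.
  + apply: ldif_computes => // s' blk pos k bJ e30 e33; have [r1 r2 r3] := k.
    rewrite /= e30 e33 !r1 // (mc_S CC1) /a; case: ifP => lt; rewrite lt //.
    rewrite (eo_ft E1) //. apply: Hf => //.
    by move: S0; clear; lia.
  + apply: ldif_computes => // s' blk pos k bJ e30 e33; have [r1 r2 r3] := k.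
    rewrite /= e30 e33 !r1 // (mc_S CC1) (mc_K CC1); case: ifP => lt.
      by rewrite /b coef_poly lt (eo_ft E1).
    by apply: hb; rewrite leqNgt lt.
  move=> s2 E2 [k2 CC2 v2].
  apply: ok_conseq (@inst_fill_ok F V r lim J K J0 HV s2 14 [:: EV 41] copy_body [:: K]
    (fun j i => ft s2 (8, ikey [:: j; i])) CC2 isT isT _ _ _) (leqnn _) _ => //.
  + by rewrite /= (mc_K CC2).
  + by move=> s' j i E e50 e51 _ _; rewrite /= e50 e51 (eo_ft E).
  move=> s3 E3 [v3 _] j t jJ tS; rewrite (v3 j t jJ tS) v2 //; last first.
    by apply: leq_trans tS _; rewrite leq_exp2l // leq_addr.
  rewrite midcoef_root //; apply: eq_bigr => u _.
  by rewrite /a (leq_ltn_trans _ tS) // -ltnS.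
exact: root_arith (mpe_P0 K J0).
Qed.

Definition dn_T := static_cost dn_a + static_cost dn_b.
Definition dn_K := 20 + static_cost dn_setup + (conv_K + 100 * dn_T) +
  4 * (static_cost dn_body + fillK [:: EV 44] dn_rs).

Lemma down_ok s (f : nat -> nat -> F) (xs : nat -> F) (G : nat -> {poly F}) : mcore s ->
  (forall h v i, h <= K -> v < J * 2 ^ (K - h) -> i < (2 ^ h).+1 ->
      ft s (11, ikey [:: h; v; i]) = ((nodepoly xs h v)`_i)%R) ->
  (forall j, j < J -> eqX (2 ^ K) (nodepoly xs K j * G j)%R 1%R) ->
  (forall j t, j < J -> t < 2 ^ K -> ft s (14, ikey [:: K; j; t]) =
      midcoef (f j) (2 ^ K) (G j) (2 ^ K) t) ->
  ok V dn_cmd s (dn_K * (K.+1 * mpe_P)) (fun s' =>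
    forall v, v < J * 2 ^ K -> ft s' (14, ikey [:: 0; v; 0]) =
      (\fsum_(k < 2 ^ K) (f (v %/ 2 ^ K)%N k * xs v ^+ k))%R).
Proof.
move=> C TR HG H14.
pose Inv x (s' : store F) := forall c, c < J * 2 ^ x -> exists2 Gc : {poly F},
   eqX (2 ^ K) (nodepoly xs (K - x) c * Gc)%R 1%R &
   forall t, t < 2 ^ (K - x) -> ft s' (14, ikey [:: K - x; c; t]) =
      midcoef (f (c %/ 2 ^ x)) (2 ^ K) Gc (2 ^ (K - x)) t.
have KV' := KV J0 HV.
have Tl1 : static_cost dn_a <= dn_T by rewrite leq_addr.
have Tl2 : static_cost dn_b <= dn_T by rewrite leq_addl.
pose T2 := mpe_P * (conv_K + 100 * dn_T).
pose T3 := 4 * mpe_P * (static_cost dn_body + fillK [:: EV 44] dn_rs).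
apply: (@ok_for F V 43 _ _ s K _ (static_cost dn_setup + (T2 + T3)) Inv).
- by rewrite /= (mc_K C).
- exact: ltnW.
- move=> c; rewrite expn0 muln1 subn0 divn1 => cJ; exists (G c); first exact: HG.
  by move=> t tS; apply: H14.
- move=> x s1 xK E1 I1.
  have C1 : mcore (seti 43 x s1).
    have := mcore_eqoff E1 isT isT isT isT C.
    by case=> [[a1 a2 a3 a4 a5] b1 b2 b3].
  pose h := K - 1 - x.
  have hK : h < K by rewrite /h; clear -xK; lia.
  have Eh : K - x = h.+1 by rewrite /h; clear -xK; lia.
  have Eh2 : K - x.+1 = h by rewrite /h; clear; lia.
  have Ex : K - h = x.+1 by rewrite /h; clear -xK; lia.
  have hlim : h.+1 <= lim by apply: leq_trans Klim; clear -hK; lia.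
  pose B := J * 2 ^ x.+1.
  have B0 : 0 < B by rewrite muln_gt0 J0 expn_gt0.
  have BE : B * 2 ^ h = J * 2 ^ K.
    by rewrite /B -Ex -mulnA -expnD subnK // ltnW.
  have BE2 : B * 2 ^ h <= J * 2 ^ K by rewrite BE.
  have p2h : 0 < 2 ^ h by rewrite expn_gt0.
  have BV : B <= V.
    by apply: leq_trans (JK_V HV); rewrite -BE -mulnA leq_pmulr // muln_gt0 p2h.
  pose Q2 (s' : store F) := [/\ ir s' 10 = B, ir s' 11 = h, ir s' 44 = h,
    ir s' 46 = 2 ^ h & ir s' 47 = 2 ^ h.+1].
  apply: (@ok_seq _ _ _ _ _ (static_cost dn_setup) (T2 + T3) _ Q2); last exact: leqnn.
  + have /= p1 := @pt_p2 _ _ _ _ (mc_pt C1) h (ltnW hlim).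
    have /= p2 := @pt_p2 _ _ _ _ (mc_pt C1) h.+1 hlim.
    have /= p3 : it (seti 43 x s1) (3, ikey [:: K - h]) = 2 ^ x.+1.
      by rewrite (pt_p2 (mc_pt C1)) ?Ex //; apply: leq_trans Klim; clear -xK; lia.
    have /= k1 := mc_K C1; have /= k2 := mc_J C1.
    have hV : h <= V by apply: ltnW; apply: leq_ltn_trans KV'; apply: ltnW.
    by apply: ok_lf => //=; rewrite ?k1 ?k2 -/h ?addn1 ?p1 ?p2 ?p3.
  move=> s2 E2 [e10 e11 e44 e46 e47].
  have C2 := mcore_eqoff E2 isT isT isT isT C1.
  have F11 l : ft s2 (11, l) = ft s (11, l).
    by rewrite (eo_ft E2) //; exact: (eo_ft E1).
  have F14 l : ft s2 (14, l) = ft s1 (14, l) by rewrite (eo_ft E2).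
  pose sib c := if odd c then c.-1 else c.+1.
  have sibB c : c < B -> sib c < B.
    rewrite /sib /B expnS mulnCA; move: (J * 2 ^ x) => m; clear.
    by case: ifP => //; lia.
  pose a c pos := ((nodepoly xs h (sib c))`_pos)%R.
  pose b c pos := if pos < 2 ^ h.+1 then ft s1 (14, ikey [:: h.+1; c %/ 2; pos]) else 0%R.
  have ha blk p : (2 ^ h).+1 <= p -> a blk p = 0%R.
    by move=> le; apply: nth_default; apply: leq_trans (size_nodepoly _ _ _) le.
  have hb blk p : 2 ^ h.+1 <= p -> b blk p = 0%R by rewrite /b leqNgt => /negbTE ->.
  have hD : (2 ^ h).+1 + 2 ^ h.+1 <= (2 ^ (h + 2)).+1.
    by rewrite expnD expnS; move: p2h; clear; lia.
  apply: (ok_seq (T2 := T3)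
    (@mconv_ok F V r lim J K Klim limV HV s2 h B dn_a dn_b dn_T a b (2 ^ h).+1 (2 ^ h.+1) C2
      isT isT e10 e11 (ltnW hK) B0 BE2 _ _ Tl1 Tl2 ha hb hD)); last exact: leqnn.
  + apply: ldif_computes => // s' blk pos k bB e30 e33; have [r1 r2 r3] := k.
    rewrite /= sub_divn_mod e30 e33 !r1 // e44 e46 addn1 sibling -/(sib blk); case: ifP => lt.
      by rewrite F11; apply: TR => //; rewrite ?Ex; [exact: ltnW|exact: sibB].
    by apply: ha; rewrite leqNgt lt.
  + apply: ldif_computes => // s' blk pos k bB e30 e33; have [r1 r2 r3] := k.
    by rewrite /= e30 e33 !r1 // e44 e47 addn1 /b; case: ifP => lt; rewrite lt ?F14.
  move=> s3 E3 [k3 CC3 v3]; have [r1 r2 r3] := k3.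
  pose val l := ft s3 (8, ikey [:: nth 0 l 0; nth 0 l 1 + 2 ^ h]).
  apply: ok_conseq (@fill_lf F V 14 [:: EV 44] dn_rs dn_body s3
     [:: B; 2 ^ h] [:: h] val _ _ _ _ _ _ _) _ _.
  + by [].
  + by [].
  + by [].
  + by rewrite /= r1 // e44.
  + by rewrite /= !r1 // e10 e46.
  + rewrite /= B0 BV p2h /= andbT; apply: leq_trans (JK_V HV).
    by rewrite -BE mulnAC leq_pmull // muln_gt0 B0.
  + move=> idx s' /box2P[blk [p [-> b1 b2]]] E _ Hr.
    have /= g0 := Hr 0 isT; have /= g1 := Hr 1 isT.
    by rewrite /val /= g0 g1 (eo_i E) // r1 // e46 (eo_ft E).
  + rewrite !big_cons big_nil muln1 /T3; apply: leq_mul (leqnn _).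
    by rewrite BE; apply: leq_trans (JKP J K) _; rewrite leq_pmull.
  move=> s4 E4 [v4 k4] c cB; rewrite Eh2.
  have c2B : c %/ 2 < J * 2 ^ x.
    by rewrite ltn_divLR // -mulnA -expnSr.
  have := I1 _ c2B; rewrite Eh => -[Gv Gv1 Gv2].
  have Enode : nodepoly xs h.+1 (c %/ 2) = (nodepoly xs h c * nodepoly xs h (sib c))%R.
    rewrite nodepolyS divn2 /sib; have := odd_double_half c.
    case: (odd c) => /= e; move: (c./2) e => k <-; last by rewrite add0n.
    by rewrite add1n mulrC.
  exists (nodepoly xs h (sib c) * Gv)%R; first by rewrite mulrA -Enode.
  move=> t th; have := v4 [:: c; t] => /= ->; last by rewrite /box /= cB th.
  rewrite /val /= v3 //; last by rewrite expnD; move: th p2h; clear; lia.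
  rewrite (@midcoef_down F (f (c %/ 2 ^ x.+1)) (2 ^ K) Gv (nodepoly xs h (sib c)) (2 ^ h) t (b
    c)) //.
    exact: size_nodepoly.
  move=> i; rewrite -addnn_exp => ilt; rewrite /b ilt Gv2 //.
  by rewrite -divnMA -expnS.
- move=> s' E I v vB; have [Gv Gv1 Gv2] := I v vB.
  rewrite subnn in Gv1 Gv2; rewrite Gv2 // expn0; apply: midcoef_leaf.
  by rewrite -nodepoly0.
apply: level_arith; exact: mpe_P0.
Qed.

End DownwardPass.

Lemma mpe_arith P K L A B T N R D : 0 < P ->
  L + (P * A + (2 * P * B + (T * (K.+1 * P) + (N * (K.+1 * P) + (R * P + D * (K.+1 * P)))))) <=
  (L + A + 2 * B + T + N + R + D) * (K.+1 * P).
Proof.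
move=> P0; rewrite (mulnCA T) (mulnCA N) (mulnCA D) -!(mulnCA _ K.+1).
have le X : X * P <= X * (K.+1 * P) by rewrite leq_mul2l leq_pmull ?orbT.
have := le L; have := le A; have := le B; have := le R.
have : L <= L * P by rewrite leq_pmulr.
move: (K.+1 * P) => Z; clear; lia.
Qed.

Section Evaluation.
Variables (F : finFieldType) (V : nat).
Implicit Types (s : store F).
Variables (r lim J K : nat).
Hypothesis J0 : 0 < J.
Hypothesis Klim : K + K + 8 <= lim.
Hypothesis limV : lim <= V.
Hypothesis HV : J * 2 ^ K * 4 ^ (K + K + 8) <= V.
Local Notation mcore := (@mcore F r lim J K).
Local Notation mpe_P := (mpe_P J K).

(** The states in which the commands for the input of an evaluation are run. *)
Definition in_keeps s s' :=
  [/\ forall x, x \notin [:: 42; 50; 51] -> ir s' x = ir s x,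
      forall z, it s' z = it s z &
      forall t ks, t \notin [:: 10; 11] -> ft s' (t, ks) = ft s (t, ks)].

Definition reader (c : cmd) := [&& pure_cmd c & loopfree c].

Definition mpe_K cF cX := static_cost mpe_load + (static_cost cF + fillK [::] inst_rs) +
  2 * (static_cost (leaf_body cX) + fillK [:: EC 0] leaf_rs) + tree_K + nwt_K + root_K + dn_K.

Lemma mpe_ok s cF cX (f : nat -> nat -> F) (xs : nat -> F) :
  reader cF -> reader cX -> (forall s' : store F, safe V cF s') ->
  (forall s' : store F, safe V cX s') ->
  pre_tabs s r lim -> ir s 40 = J -> ir s 41 = K ->
  (forall s' j k, in_keeps s s' -> ir s' 50 = j -> ir s' 51 = k -> j < J -> k < 2 ^ K ->
     fr (run cF s') 0 = f j k) ->
  (forall s' v, in_keeps s s' -> ir s' 50 = v -> v < J * 2 ^ K ->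
     fr (run cX s') 0 = xs v) ->
  ok V (mpe cF cX) s (mpe_K cF cX * (K.+1 * mpe_P)) (fun s' =>
    forall v, v < J * 2 ^ K -> ft s' (14, ikey [:: 0; v; 0]) =
      (\fsum_(k < 2 ^ K) (f (v %/ 2 ^ K)%N k * xs v ^+ k))%R).
Proof.
move=> /andP[pF lF] /andP[pX lX] sF sX PT e40 e41 HF HX.
have P0 := mpe_P0 K J0; have KV' := KV J0 HV.
have KV1 : K <= lim by apply: leq_trans Klim; clear; lia.
pose A := static_cost cF + fillK [::] inst_rs.
pose B := static_cost (leaf_body cX) + fillK [:: EC 0] leaf_rs.
have /and3P[/nilP f1 /nilP f2 /nilP f3] := pF.
have /and3P[/nilP x1 /nilP x2 /nilP x3] := pX.
pose T5 := root_K * mpe_P + dn_K * (K.+1 * mpe_P).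
pose T4 := nwt_K * (K.+1 * mpe_P) + T5.
pose T3 := tree_K * (K.+1 * mpe_P) + T4.
pose T2 := 2 * mpe_P * B + T3.
pose T1 := mpe_P * A + T2.
apply: (@ok_seq _ _ _ _ _ (static_cost mpe_load) T1 _ (fun s' => ir s' 42 = 2 ^ K)).
- by apply: ok_lf => //=; rewrite e41 (pt_p2 PT KV1).
- move=> s1 E1 e42.
  have PT1 := pre_tabs_eqoff PT E1 isT isT isT isT.
  have C1 : mcore s1 by split; rewrite // (eo_i E1).
  have k1 : in_keeps s s1.
    by split=> [x nx|[t ks]|t ks _]; [apply: (eo_i E1); apply: contra nx;
      rewrite !inE => ->|apply: (eo_it E1)|apply: (eo_ft E1)].
  have wF : fill_wf [::] inst_rs cF by rewrite /fill_wf /= f1 f3.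
  apply: (ok_seq (T2 := T2) (@inst_fill_ok F V r lim J K J0 HV s1 10 [::] cF [::] f C1 wF lF sF
    erefl _)); last exact: leqnn.
  + move=> s' j i E e50 e51 jJ iK; apply: HF => //; case: k1 => a1 a2 a3.
    split=> [x nx|z|t ks nt].
    * rewrite (eo_i E) ?a1 // /fill /= f1 /= !inE; move: nx; rewrite !inE !negb_or.
      by case/and3P=> _ -> ->.
    * by case: z => t ks; rewrite (eo_it E) ?a2 // /fill /= f2.
    rewrite (eo_ft E) ?a3 // /fill /= f3 /=; move: nt; rewrite !inE negb_or.
    by case/andP.
  move=> s2 E2 [v2 _].
  have k2 : in_keeps s s2.
    case: k1 => a1 a2 a3; split=> [x nx|z|t ks nt].
    * rewrite (eo_i E2) ?a1 // /fill /= f1 /= !inE; move: nx; rewrite !inE !negb_or.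
      by case/and3P=> _ -> ->.
    * by case: z => t ks; rewrite (eo_it E2) ?a2 // /fill /= f2.
    rewrite (eo_ft E2) ?a3 // /fill /= f3 /=; move: nt; rewrite !inE negb_or.
    by case/andP.
  have C2 : mcore s2.
    by apply: mcore_eqoff E2 _ _ _ _ C1; rewrite /fill /= ?f1 ?f2 ?f3.
  have wX : fill_wf [:: EC 0] leaf_rs (leaf_body cX) by rewrite /fill_wf /= x1 x3.
  pose val l := if nth 0 l 1 < 1 then 1%R else (- xs (nth 0%N l 0))%R.
  have S0 : 0 < 2 ^ K by rewrite expn_gt0.
  apply: (ok_seq (T2 := T3) (ok_le (@fill_lf F V 11 [:: EC 0] leaf_rs (leaf_body cX) s2
    [:: J * 2 ^ K; 2] [:: 0] val wX _ _ erefl _ _ _) (_ : _ <= 2 * mpe_P * B))); last exact: leqnn.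
  + by rewrite /= lX.
  + by move=> s'; rewrite /=; case: ifP => // _; split.
  + by rewrite /= (mc_J C2) (mc_S C2).
  + have := JK_V HV; have : 0 < J * 2 ^ K by rewrite muln_gt0 J0.
    by rewrite /=; move: (J * 2 ^ K) => X; clear; lia.
  + move=> idx s' /box2P[v [i [-> b1 b2]]] E _ Hr.
    have /= g0 := Hr 0 isT; have /= g1 := Hr 1 isT.
    rewrite /val /= g1; case: ifP => //= _; rewrite mulr0n sub0r.
    rewrite (HX _ v) //; case: k2 => a1 a2 a3; split=> [x nx|z|t ks nt].
    * rewrite (eo_i E) ?a1 // /fill /= x1 /= !inE; move: nx; rewrite !inE !negb_or.
      by case/and3P=> _ -> ->.
    * by case: z => t ks; rewrite (eo_it E) ?a2 // /fill /= x2.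
    rewrite (eo_ft E) ?a3 // /fill /= x3 /=; move: nt; rewrite !inE negb_or.
    by case/andP.
  + rewrite !big_cons big_nil muln1 -/B; apply: leq_mul (leqnn _).
    by rewrite mulnC leq_mul // JKP.
  move=> s3 E3 [v3 _].
  have C3 : mcore s3.
    by apply: mcore_eqoff E3 _ _ _ _ C2; rewrite /fill /= ?x1 ?x2 ?x3.
  apply: (ok_seq (T2 := T4) (@tree_ok F V r lim J K J0 Klim limV HV s3 xs C3 _)); last exact: leqnn.
    move=> v i vJ i2; have := v3 [:: v; i] => /= ->; last by rewrite /box /= vJ i2.
    rewrite /val nodepoly0 coefB coefCM coef1 coefX; case: i i2 => [|[|]] //= _.
      by rewrite mulr0 subr0.
    by rewrite mulr1 sub0r.
  move=> s4 E4 TR.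
  have C4 := mcore_eqoff E4 isT isT isT isT C3.
  apply: (ok_seq (T2 := T5) (@nwt_ok F V r lim J K J0 Klim limV HV s4 xs C4 _)); last exact: leqnn.
    by move=> v i vJ iK; apply: TR; rewrite ?subnn ?muln1.
  move=> s5 E5 HG.
  have C5 := mcore_eqoff E5 isT isT isT isT C4.
  apply: (ok_seq (T2 := dn_K * (K.+1 * mpe_P)) (@root_ok F V r lim J K J0 Klim limV HV s5 f C5
    _)); last exact: leqnn.
    move=> j k jJ kK; rewrite (eo_ft E5) // (eo_ft E4) // (eo_ft E3); last by rewrite /fill /= x3.
    exact: (v2 j k jJ kK).
  move=> s6 E6 H14.
  have C6 := mcore_eqoff E6 isT isT isT isT C5.
  apply: (@down_ok F V r lim J K J0 Klim limV HV s6 f xs (Gpoly K s5 K) C6) => //.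
  move=> h v i hK vB ih; rewrite (eo_ft E6) // (eo_ft E5) //.
  exact: TR.
exact: mpe_arith.
Qed.

End Evaluation.

(** * Radix, sizes and tables of powers *)

(** The radix must be invertible in F, so it is 2 unless 1 + 1 = 0.  Field register 5
receives its inverse. *)
Definition char_cmd : cmd := seqs
  [:: FCst 1 true; FBin OpAdd 6 1 1; FCst 3 false;
      IfFeq 6 3 (Seq (ISet 6 (EC 3)) (FBin OpAdd 6 6 1)) (ISet 6 (EC 2));
      FBin OpDiv 5 1 6; FCst 4 true].
Definition lg_step : cmd :=
  IfLt (EV 53) (EV 52)
    (Seq (ISet 53 (EMul (EV 53) (EC 2))) (ISet 7 (EAdd (EV 7) (EC 1)))) Skip.
(** The bound a + m + n + q on all sizes; register 7 receives the exponent of the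
least power of 2 that is not smaller. *)
Definition lg_start : cmd := seqs
  [:: ISet 52 (EAdd (EAdd (EV 0) (EV 2)) (EAdd (EV 3) (EV 5))); ISet 7 (EC 0); ISet 53 (EC 1)].
Definition lg_cmd : cmd := Seq lg_start (For 54 (EV 52) lg_step).
Definition pow_step : cmd := seqs
  [:: ISt 2 [:: KE (EV 54)] (EV 55); ISt 3 [:: KE (EV 54)] (EV 56);
      FSt 7 [:: KE (EV 54)] 4; ISet 55 (EMul (EV 55) (EV 6)); ISet 56 (EMul (EV 56) (EC 2));
      FBin OpMul 4 4 5].
Definition pow_start : cmd := Seq (ISet 55 (EC 1)) (ISet 56 (EC 1)).
Definition pow_cmd : cmd :=
  Seq pow_start (For 54 (EAdd (EMul (EC 2) (EV 7)) (EAdd (EC 9) (EC 2))) pow_step).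
Definition prelude : cmd := Seq char_cmd (Seq lg_cmd pow_cmd).

Definition kset_step : cmd :=
  Seq (ILd 55 3 [:: KE (EV 41)]) (IfLt (EV 55) (EV 57) (ISet 41 (EAdd (EV 41) (EC 1))) Skip).
(** Register 41 receives the least exponent of a power of 2 that is not below register
57, and register 58 that power. *)
Definition kset : cmd :=
  Seq (ISet 41 (EC 0)) (Seq (For 54 (EAdd (EV 7) (EC 1)) kset_step) (ILd 58 3 [:: KE (EV 41)])).

Section Prelude.
Variables (F : finFieldType) (V : nat).
Implicit Types (s : store F).

Lemma prelude_ok s N : ir s 0 + ir s 2 + (ir s 3 + ir s 5) = N -> 0 < N ->
  4 ^ 13 * N ^ 6 <= V ->
  ok V prelude s (500 * N + 3000) (fun s' => exists r l,
    [/\ pre_tabs s' r (2 * l + 10), ir s' 7 = l, N <= 2 ^ l & 2 ^ l <= 2 * N]).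
Proof.
move=> EN N0 NV.
have N6 : N <= N ^ 6 by rewrite -{1}(expn1 N) leq_pexp2l.
have NV' : N * 4 ^ 13 <= V by apply: leq_trans NV; rewrite mulnC leq_mul2l N6 orbT.
have V1000 : 1000 * N <= V by apply: leq_trans NV'; rewrite mulnC leq_mul2l; apply/orP; right.
pose Q1 (s' : store F) := exists2 r, 1 < r < 4 & [/\ ir s' 6 = r,
  fr s' 4 = 1%R & (fr s' 5 * r%:R = 1)%R].
pose T2 := 40 * N + 100. pose T3 := 400 * N + 2000.
apply: (@ok_seq _ _ _ _ _ (static_cost char_cmd) (T2 + T3) _ Q1).
- apply: ok_lf => //=; first by case: ifP => /= _; do !split=> //; move: V1000 N0; clear; lia.
  rewrite /Q1; have E2 : (1%:R + 1%:R = 2%:R :> F)%R by rewrite -natrD.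
  case: ifP => /=; rewrite E2 => /eqP h.
    exists 3 => //; split=> //; rewrite -natrD mulrAC mul1r divff //.
    by rewrite (natrD _ 2 1) h add0r oner_eq0.
  by exists 2 => //; split=> //; rewrite mulrAC mul1r divff //; apply/eqP.
- move=> s1 E1 [r r14 [e6 f4 f5]].
  pose Q2 (s' : store F) := [/\ N <= 2 ^ ir s' 7 & 2 ^ ir s' 7 <= 2 * N].
  apply: (@ok_seq _ _ _ _ _ T2 T3 _ Q2) => //.
  + pose Inv j (s' : store F) := let l := ir s' 7 in
      [/\ ir s' 53 = 2 ^ l, l <= j, (N <= 2 ^ l) || (l == j) & 2 ^ l <= 2 * N].
    apply: (@ok_seq _ _ _ _ _ (static_cost lg_start) (40 * N + 10) _ (fun s' =>
      ir s' 52 = N /\ Inv 0 s')).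
    * apply: ok_lf => //=; rewrite ?(eo_i E1) // EN.
        by do !split=> //; move: V1000 N0; clear; lia.
      by split=> //; rewrite /Inv /= expn0 eqxx orbT muln_gt0 N0.
    * move=> s2 E2 [e52 I0].
      apply: (@ok_for F V 54 _ _ s2 N _ (static_cost lg_step) Inv) => //.
      - by move: V1000; clear; lia.
      - move=> j s3 jN E3 [i1 i2 i3 i4].
        have f52 : ir s3 52 = N by rewrite (eo_i E3).
        apply: ok_lf => //=; rewrite f52 i1.
          case: ltnP => //= lt; move: i2 jN lt V1000; move: (ir s3 7) (2 ^ _) => l x; clear; lia.
        rewrite /Inv; case: ltnP => /= lt.
          rewrite !addn1 eqSS expnSr ltnS; split=> //; last by rewrite mulnC leq_mul2l ltnW.
          by case/orP: i3 => [h|->]; [move: lt; rewrite ltnNge h|rewrite orbT].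
        by split=> //; rewrite ?lt // leqW.
      - move=> s3 E3 [i1 i2 i3 i4]; split=> //.
        by case/orP: i3 => // /eqP ->; apply: ltnW; apply: ltn_expl.
      by rewrite [static_cost _]/= [expr_cost _]/=; clear; lia.
    by rewrite [static_cost _]/= /T2; clear; lia.
  move=> s2 E2 [l1 l2]; set l := ir s2 7 in l1 l2.
  have lN : l < 2 * N by apply: leq_trans l2; apply: ltn_expl.
  have pV i : i <= 2 * l + 11 -> 4 ^ i <= V.
    move=> il; apply: leq_trans NV; apply: leq_trans (_ : 4 ^ (2 * l + 11) <= _).
      by rewrite leq_exp2l.
    have l4 : 4 ^ l <= 4 * N ^ 2.
      rewrite -[4 ^ l]/((2 ^ 2) ^ l) expnAC -[4]/(2 ^ 2) -expnMn leq_exp2r //.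
    have -> : 4 ^ (2 * l + 11) = 4 ^ l * 4 ^ l * 4 ^ 11 by rewrite -!expnD; congr expn; clear; lia.
    apply: leq_trans (leq_mul (leq_mul l4 l4) (leqnn _)) _.
    have -> : 4 * N ^ 2 * (4 * N ^ 2) * 4 ^ 11 = 4 ^ 13 * (N ^ 2 * N ^ 2).
      by rewrite (_ : 13 = 2 + 11) // expnD; move: (4 ^ 11) (N ^ 2) => x y; ring.
    by rewrite leq_mul2l -expnD leq_pexp2l // orbT.
  have rV i : i <= 2 * l + 11 -> r ^ i <= V.
    move=> il; apply: leq_trans (pV _ il); case: i il => // i _.
    by rewrite leq_exp2r //; move: r14; clear; lia.
  have p2V i : i <= 2 * l + 11 -> 2 ^ i <= V.
    move=> il; apply: leq_trans (pV _ il); case: i il => // i _.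
    by rewrite leq_exp2r.
  pose Inv j (s' : store F) :=
    [/\ ir s' 55 = r ^ j, ir s' 56 = 2 ^ j, (fr s' 4 * (r ^ j)%:R = 1)%R &
     forall i, i < j -> [/\ it s' (2, ikey [:: i]) = r ^ i, it s' (3, ikey [:: i]) = 2 ^ i
       & (ft s' (7, ikey [:: i]) * (r ^ i)%:R = 1)%R]].
  apply: (@ok_seq _ _ _ _ _ (static_cost pow_start) (400 * N + 1900) _ (Inv 0)).
  + apply: ok_lf => //=; first by split=> //; move: V1000 N0; clear; lia.
    by rewrite /Inv /= (eo_f E2) // f4 !expn0 mulr1.
  + move=> s3 E3 I0.
    have g6 : ir s3 6 = r by rewrite (eo_i E3) // (eo_i E2).
    have g7 : ir s3 7 = l by rewrite (eo_i E3).
    have h5 : fr s3 5 = fr s1 5 by rewrite (eo_f E3) // (eo_f E2).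
    apply: (@ok_for F V 54 _ _ s3 (2 * l + 11) _ (static_cost pow_step) Inv) => //.
    * by rewrite /= g7.
    * by move: lN V1000; clear; lia.
    * move=> j s4 jl E4 [i1 i2 i3 i4].
      have k6 : ir s4 6 = r by rewrite (eo_i E4).
      have k5 : fr s4 5 = fr s1 5 by rewrite (eo_f E4).
      have j1 := ltnW jl.
      apply: ok_lf => //=.
        rewrite i1 i2 k6 -!expnSr; do !split=> //.
        + exact: rV.
        + exact: p2V.
        + exact: rV.
        exact: p2V.
      rewrite /Inv /= i1 i2 k6 -!expnSr; split=> //.
        by rewrite k5 expnSr natrM mulrACA i3 f5 mulr1.
      move=> i; rewrite ltnS leq_eqVlt => /orP[/eqP ->|lt].
        by rewrite !eqxx /= i3; split=> //; rewrite i2.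
      have ne : (i == j) = false by apply: ltn_eqF.
      have nk (t : nat) : ((t, [:: inl i]) == (t, [:: inl j]) :> cell F) = false.
        by rewrite xpair_eqE eqxx /= eqseq_cons /= andbT; apply/negP => /eqP[E];
          rewrite E ltnn in lt.
      have [q1 q2 q3] := i4 i lt.
      by rewrite /= in q1 q2 q3; rewrite !nk q1 q2 q3.
    * move=> s4 E4 [i1 i2 i3 i4]; exists r, l; rewrite (eo_i E4) // g7; split=> //.
      split; rewrite ?(eo_i E4) // => i il; have [|q1 q2 q3] := i4 i; rewrite ?q1 ?q2 ?q3 //;
        by move: il; clear; lia.
    by rewrite [static_cost _]/= [expr_cost _]/=; move: lN; clear; lia.
  by rewrite [static_cost _]/= /T3; clear; lia.
rewrite [static_cost _]/= /T2 /T3; clear; lia.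
Qed.

Lemma kset_ok s r l t : pre_tabs s r (2 * l + 10) -> ir s 7 = l -> ir s 57 = t -> 0 < t ->
  t <= 2 ^ l.+1 -> 2 * l + 10 <= V ->
  ok V kset s (100 * l.+1) (fun s' => exists K,
    [/\ ir s' 41 = K, ir s' 58 = 2 ^ K, K <= l.+1, t <= 2 ^ K & 2 ^ K <= 2 * t]).
Proof.
move=> PT e7 e57 t0 tl lV.
pose Inv j (s' : store F) := let K := ir s' 41 in
  [/\ K <= j, (t <= 2 ^ K) || (K == j) & 2 ^ K <= 2 * t].
apply: (@ok_seq _ _ _ _ _ 3 (50 * l.+1) _ (Inv 0)).
- by apply: ok_lf => //=; rewrite /Inv /= expn0 eqxx orbT muln_gt0 t0.
- move=> s1 E1 I0; apply: (@ok_seq _ _ _ _ _ (40 * l.+1) 10 _ (Inv l.+1)).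
  + apply: (@ok_for F V 54 _ _ s1 l.+1 _ (static_cost kset_step) Inv) => //.
    * by rewrite /= (eo_i E1) // e7 addn1.
    * by move: lV; clear; lia.
    * move=> j s2 jl E2 [i1 i2 i3]; set K := ir s2 41 in i1 i2 i3.
      have f57 : ir s2 57 = t by rewrite (eo_i E2) // (eo_i E1).
      have p2 : it s2 (3, [:: inl K]) = 2 ^ K.
        rewrite (eo_it E2) // (eo_it E1) //; apply: (pt_p2 PT).
        by move: i1 jl; clear; lia.
      apply: ok_lf => //=; rewrite f57 -/K p2.
        split=> //; case: ifP => //= _; rewrite -/K; move: i1 jl lV; clear; lia.
      rewrite /Inv; case: ltnP => lt /=; rewrite -/K ?addn1.
        rewrite ltnS eqSS i1 expnS leq_mul2l (ltnW lt); split=> //.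
        by case/orP: i2 => [h|->]; [move: lt; rewrite ltnNge h|rewrite orbT].
      by rewrite (leqW i1) lt i3.
    by rewrite [static_cost _]/= [expr_cost _]/=; clear; lia.
  + move=> s2 E2 [i1 i2 i3]; set K := ir s2 41 in i1 i2 i3.
    have p2 : it s2 (3, [:: inl K]) = 2 ^ K.
      rewrite (eo_it E2) // (eo_it E1) //; apply: (pt_p2 PT).
      by move: i1; clear; lia.
    apply: ok_conseq (ok_lf (c := ILd 58 3 [:: KE (EV 41)]) (s := s2) (Q := fun s' =>
      ir s' 41 = K /\ ir s' 58 = 2 ^ K) _ _ _) _ _ => //.
    move=> s3 E3 [k1 k2]; exists K; split=> //.
    by case/orP: i2 => // /eqP ->.
  by clear; lia.
by clear; lia.
Qed.

End Prelude.

(** * Grouping the points and the message *)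

(** Register 8 counts the distinct first coordinates; the one of index e is in cell e
of field table 20, and index table 4 maps it back to e + 1, where 0 means that
it has not been seen.  The second coordinates over it are in row e of field table
21, of length cell e of index table 5.  Index tables 6 and 7 record the
row and the column of every point. *)
Definition insert_cmd : cmd := seqs
  [:: FSt 20 [:: KE (EV 8)] 1; ISet 8 (EAdd (EV 8) (EC 1)); ISt 4 [:: KR 1] (EV 8); ISet 55 (EV 8)].
Definition lookup_cmd : cmd := seqs
  [:: FLd 1 1 [:: KE (EV 54)]; FLd 2 2 [:: KE (EV 54)]; ILd 55 4 [:: KR 1];
      IfLt (EV 55) (EC 1) insert_cmd Skip; ISet 55 (ESub (EV 55) (EC 1))].
Definition record_cmd : cmd := seqs
  [:: ILd 56 5 [:: KE (EV 55)]; FSt 21 [:: KE (EV 55); KE (EV 56)] 2;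
      ISt 6 [:: KE (EV 54)] (EV 55); ISt 7 [:: KE (EV 54)] (EV 56);
      ISt 5 [:: KE (EV 55)] (EAdd (EV 56) (EC 1))].
Definition bucket : cmd := For 54 (EV 3) (Seq lookup_cmd record_cmd).

Definition scatter : cmd := For 54 (EV 4) (seqs
  [:: ILd 55 0 [:: KE (EV 54)]; ILd 56 1 [:: KE (EV 54)]; FLd 1 3 [:: KE (EV 54)];
      FLd 2 22 [:: KE (EV 56); KE (EV 55)]; FBin OpAdd 1 1 2; FSt 22 [:: KE (EV 56);
        KE (EV 55)] 1]).

Section Bucket.
Variables (F : finFieldType) (V n : nat) (px py : nat -> F).
Implicit Types (s : store F).
Hypothesis nV : n.+1 <= V.

Definition cnt j x := count (fun l => px l == x) (iota 0 j).

Lemma cntS j x : cnt j.+1 x = cnt j x + (px j == x).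
Proof. by rewrite /cnt -addn1 iotaD count_cat /= addn0. Qed.

Lemma cnt_le j x : cnt j x <= j.
Proof. by rewrite -[X in _ <= X](size_iota 0) count_size. Qed.

(** The index of a coordinate is found in table 4 by using the field element as a key. *)
Definition index_inv m s := let u := ir s 8 in
  [/\ u <= m,
      forall x e, it s (4, [:: inr x]) = e.+1 -> e < u /\ ft s (20, [:: inl e]) = x,
      forall e, e < u -> it s (4, [:: inr (ft s (20, [:: inl e]))]) = e.+1
    & forall l, l < m -> 0 < it s (4, [:: inr (px l)])].

Definition count_inv j s := let u := ir s 8 in
  forall e, it s (5, [:: inl e]) = if e < u then cnt j (ft s (20, [:: inl e])) else 0.

Definition place_inv j s := forall l, l < j ->
  let e := it s (6, [:: inl l]) in let c := it s (7, [:: inl l]) in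
  [/\ e < ir s 8, ft s (20, [:: inl e]) = px l, c < cnt j (px l)
    & ft s (21, [:: inl e; inl c]) = py l].

Lemma key1 (i j : nat) : (([:: inl i] : seq (nat + F)) == [:: inl j]) = (i == j).
Proof. by rewrite eqseq_cons andbT. Qed.
Lemma key1r (x y : F) : (([:: inr x] : seq (nat + F)) == [:: inr y]) = (x == y).
Proof. by rewrite eqseq_cons andbT. Qed.
Lemma key2 (i j i' j' : nat) : (([:: inl i; inl j] : seq (nat + F)) == [:: inl i';
  inl j']) = (i == i') && (j == j').
Proof. by rewrite !eqseq_cons andbT. Qed.

Lemma lookup_ok j s : j < n -> ir s 54 = j -> ft s (1, [:: inl j]) = px j ->
  ft s (2, [:: inl j]) = py j ->
  index_inv j s -> count_inv j s -> place_inv j s ->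
  ok V lookup_cmd s (static_cost lookup_cmd) (fun s' =>
    [/\ index_inv j.+1 s', count_inv j s', place_inv j s',
     fr s' 2 = py j & ir s' 55 < ir s' 8 /\ ft s' (20, [:: inl (ir s' 55)]) = px j]).
Proof.
move=> jn e54 ex ey [u1 u2 u3 u4] I5 I6.
case Ee: (it s (4, [:: inr (px j)])) => [|e].
  have new e : e < ir s 8 -> ft s (20, [:: inl e]) != px j.
    by move=> lt; apply/eqP => E; move: (u3 e lt); rewrite E Ee.
  apply: ok_lf => //=; rewrite ?e54 ?ex ?ey Ee /=.
    by move: u1 jn nV; clear; lia.
  split.
  - split=> /=.
    + by move: u1; clear; lia.
    + move=> x e; rewrite !xpair_eqE !eqxx /= key1r key1.
      case: eqP => [->|ne].
        by rewrite addn1 => -[<-]; rewrite eqxx ltnSn.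
      by move=> /u2[lt <-]; rewrite ltn_eqF // addn1 ltnW.
    + move=> e; rewrite addn1 ltnS leq_eqVlt !xpair_eqE !eqxx /= key1r key1.
      case/orP=> [/eqP ->|lt]; first by rewrite eqxx eqxx.
      by rewrite (ltn_eqF lt) (negbTE (new _ lt)) u3.
    + move=> l; rewrite ltnS leq_eqVlt !xpair_eqE !eqxx /= key1r.
      case: (px l =P px j) => [_ _|ne]; first by rewrite addn1.
      case/orP=> [/eqP E|]; last exact: u4.
      by case: ne; rewrite E.
  - move=> e /=; rewrite !xpair_eqE !eqxx /= key1 addn1 ltnS leq_eqVlt I5.
    case: eqP => [->|_] /=; last by [].
    rewrite ltnn /cnt; apply/esym/eqP; rewrite -leqn0 leqNgt -has_count.
    apply/hasP => -[l]; rewrite mem_iota add0n /= => lj /eqP E.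
    by move: (u4 l lj); rewrite E Ee.
  - move=> l lj /=; have [p1 p2 p3 p4] := I6 l lj.
    by rewrite !xpair_eqE /= key1 (ltn_eqF p1) addn1; split=> //; apply: leqW.
  - by [].
  - by rewrite /= addn1 subn1 /= ltnS leqnn eqxx.
have [lt E20] := u2 _ _ Ee.
apply: ok_lf => //=; rewrite ?e54 ?ex ?ey Ee /=.
  by move: u1 jn nV lt; clear; lia.
rewrite subn1 /=; split=> //; split=> //=; first exact: leqW.
by move=> l; rewrite ltnS leq_eqVlt => /orP[/eqP ->|]; [rewrite Ee|exact: u4].
Qed.

Lemma record_ok j s : j < n -> ir s 54 = j ->
  [/\ index_inv j.+1 s, count_inv j s, place_inv j s,
     fr s 2 = py j & ir s 55 < ir s 8 /\ ft s (20, [:: inl (ir s 55)]) = px j] ->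
  ok V record_cmd s (static_cost record_cmd) (fun s' =>
     [/\ index_inv j.+1 s', count_inv j.+1 s' & place_inv j.+1 s']).
Proof.
move=> jn e54 [[u1 u2 u3 u4] I5 I6 ey [lt ex]].
have Ec : it s (5, [:: inl (ir s 55)]) = cnt j (px j) by rewrite I5 lt ex.
have cj := cnt_le j (px j).
apply: ok_lf => //=; rewrite ?e54 Ec /=.
  by move: u1 jn nV lt cj; clear; lia.
split=> //.
- move=> e /=; rewrite !xpair_eqE !eqxx /= key1 cntS.
  case: eqP => [->|ne]; first by rewrite lt ex eqxx.
  rewrite I5; case: ifP => // ltu; case: eqP => [E|_]; last by rewrite addn0.
  by have := u3 _ ltu; rewrite -E -ex u3 // => -[E']; rewrite E' in ne.
- move=> l; rewrite ltnS leq_eqVlt /= !xpair_eqE !eqxx /= !key1.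
  case: eqP => [-> _|ne /= lj]; first by rewrite key2 !eqxx cntS eqxx addn1 ltnSn.
  have [p1 p2 p3 p4] := I6 l lj.
  rewrite key2 cntS ltn_addr //; case: andP => // -[/eqP E1 /eqP E2].
  by move: p3; rewrite E2 -p2 E1 ex ltnn.
Qed.

(** The recorded coordinates are distinct, so there are at most q of them. *)
Lemma bucket_ok s : ir s 3 = n -> ir s 8 = 0 ->
  (forall l, l < n -> ft s (1, [:: inl l]) = px l) ->
  (forall l, l < n -> ft s (2, [:: inl l]) = py l) ->
  (forall ks, it s (4, ks) = 0) -> (forall ks, it s (5, ks) = 0) ->
  ok V bucket s (100 * n.+1) (fun s' =>
    [/\ ir s' 8 <= n, ir s' 8 <= #|F| & place_inv n s']).
Proof.
move=> e3 e8 ex ey z4 z5.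
pose Inv j s' := [/\ index_inv j s', count_inv j s' & place_inv j s'].
apply: (@ok_for F V 54 _ _ s n _ (static_cost lookup_cmd + static_cost record_cmd) Inv) => //.
- by apply: leq_trans nV.
- split=> //; first by split; rewrite ?e8 // => x e; rewrite z4.
  by move=> e; rewrite e8 z5.
- move=> j s1 jn E1 [I1 I2 I3].
  have H : ok V lookup_cmd (seti 54 j s1) (static_cost lookup_cmd) (fun s' =>
    [/\ index_inv j.+1 s', count_inv j s', place_inv j s',
     fr s' 2 = py j & ir s' 55 < ir s' 8 /\ ft s' (20, [:: inl (ir s' 55)]) = px j]).
    by apply: lookup_ok => //=; rewrite (eo_ft E1) ?ex ?ey.
  apply: (ok_seq (T2 := static_cost record_cmd)) H _ _ => //.
  move=> s2 E2 I; apply: record_ok => //.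
  by rewrite (eo_i E2) //= eqxx.
- move=> s1 E1 [[u1 u2 u3 u4] I5 I6]; split=> //.
  set f := fun e => ft s1 (20, [:: inl e]).
  have uf : uniq [seq f e | e <- iota 0 (ir s1 8)].
    rewrite map_inj_in_uniq ?iota_uniq // => e e'; rewrite !mem_iota !add0n /= => l1 l2 E.
    by have := u3 _ l1; rewrite -/(f e) E u3 // => -[].
  by rewrite -(size_iota 0 (ir s1 8)) -(size_map f) -(card_uniqP uf) max_card.
by rewrite [static_cost _]/= [static_cost record_cmd]/= [expr_cost _]/=; clear; lia.
Qed.

End Bucket.

Section Scatter.
Variables (F : finFieldType) (V k : nat) (xexp yexp : nat -> nat) (msg : nat -> F).
Implicit Types (s : store F).
Hypothesis kV : k <= V.

Definition scattered m i j : F := (\sum_(l < m | (xexp l == i) && (yexp l == j)) msg l)%R.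

Lemma scatter_ok s : ir s 4 = k ->
  (forall l, l < k -> it s (0, [:: inl l]) = xexp l) ->
  (forall l, l < k -> it s (1, [:: inl l]) = yexp l) ->
  (forall l, l < k -> ft s (3, [:: inl l]) = msg l) ->
  (forall ks, ft s (22, ks) = 0%R) ->
  ok V scatter s (100 * k.+1) (fun s' => forall i j,
    ft s' (22, [:: inl j; inl i]) = scattered k i j).
Proof.
move=> e4 Ei Ej Em z.
pose Inv m s' := forall i j, ft s' (22, [:: inl j; inl i]) = scattered m i j.
pose B := seqs
  [:: ILd 55 0 [:: KE (EV 54)]; ILd 56 1 [:: KE (EV 54)]; FLd 1 3 [:: KE (EV 54)];
      FLd 2 22 [:: KE (EV 56); KE (EV 55)]; FBin OpAdd 1 1 2; FSt 22 [:: KE (EV 56); KE (EV 55)] 1].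
apply: (@ok_for F V 54 _ _ s k _ (static_cost B) Inv) => //.
- by move=> i j; rewrite z /scattered big_ord0.
- move=> m s1 mk E1 I1.
  apply: ok_lf => //= i j /=.
  rewrite !(eo_it E1) // Ei // Ej // (eo_ft E1) // Em //.
  rewrite xpair_eqE eqxx key2 /= !I1 /scattered [in RHS]big_mkcond big_ord_recr -big_mkcond /=.
  rewrite ![_ == i]eq_sym ![_ == j]eq_sym [RHS]addrC andbC.
  by case: andP => [[/eqP -> /eqP ->]|_]; rewrite ?add0r.
by rewrite [static_cost _]/= [expr_cost _]/=; clear; lia.
Qed.
End Scatter.

(** * The two evaluation phases *)

(** Polynomial j of the first phase is f_j, the coefficient of Y^j; all share their points. *)
Definition cF1 : cmd := FLd 0 22 [:: KE (EV 50); KE (EV 51)].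
Definition cX1 : cmd := FLd 0 20 [:: KE (EMod (EV 50) (EV 58))].
Definition init1 : cmd :=
  Seq (ISet 40 (EV 0)) (ISet 57 (EAdd (EAdd (EV 8) (EDiv (EV 2) (EV 0))) (EC 1))).
Definition save1 : cmd := ISet 59 (EV 58).
Definition phase1 : cmd := Seq init1 (Seq kset (Seq save1 (mpe cF1 cX1))).

(** Polynomial e of the second phase is the sum of the f_j(x_e) Y^j for j < a; register 59
holds the length of the rows of values of the first phase. *)
Definition cF2 : cmd := IfLt (EV 51) (EV 0)
  (FLd 0 14 [:: KE (EC 0); KE (EAdd (EMul (EV 51) (EV 59)) (EV 50)); KE (EC 0)]) (FCst 0 false).
Definition cX2 : cmd := FLd 0 21 [:: KE (EDiv (EV 50) (EV 58)); KE (EMod (EV 50) (EV 58))].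
(** There is one instance more than there are coordinates, so that their number is
positive. *)
Definition init2 : cmd := Seq (ISet 40 (EAdd (EV 8) (EC 1))) (ISet 57 (EV 0)).
Definition phase2 : cmd := Seq init2 (Seq kset (mpe cF2 cX2)).

Definition out_step : cmd := seqs
  [:: ILd 55 6 [:: KE (EV 54)]; ILd 56 7 [:: KE (EV 54)];
      FLd 1 14 [:: KE (EC 0); KE (EAdd (EMul (EV 55) (EV 58)) (EV 56)); KE (EC 0)];
      FSt 4 [:: KE (EV 54)] 1].
Definition write_codeword : cmd := For 54 (EV 3) out_step.

Definition encoder : cmd :=
  Seq prelude (Seq bucket (Seq scatter (Seq phase1 (Seq phase2 write_codeword)))).

(** The logarithmic factors of an evaluation, for heights bounded by l + 1. *)
Lemma mpe_P_le c J K l X : J * 2 ^ K <= X -> K <= l.+1 ->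
  c * (K.+1 * mpe_P J K) <= c * ((l + 4) ^ 5 * X).
Proof.
move=> JX Kl; rewrite leq_mul2l; apply/orP; right; rewrite /mpe_P.
have K4 : (K + 3) ^ 4 <= (l + 4) ^ 4 by rewrite leq_exp2r //; move: Kl; clear; lia.
have K1 : K.+1 <= l + 4 by move: Kl; clear; lia.
by rewrite expnS -[X in _ <= X]mulnA (mulnC (_ ^ 4) X); apply: leq_mul K1 (leq_mul JX K4).
Qed.

Lemma mpe_V J K N V : J <= N -> 2 ^ K <= 2 * N -> 4 ^ 13 * N ^ 6 <= V ->
  J * 2 ^ K * 4 ^ (K + K + 8) <= V.
Proof.
move=> JN KN; apply: leq_trans.
have -> : 4 ^ (K + K + 8) = (2 ^ K) ^ 4 * 4 ^ 8.
  by rewrite !expnD -[4 ^ K]/((2 ^ 2) ^ K) expnAC; move: (2 ^ K) (4 ^ 8) => x y; ring.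
have K4 : (2 ^ K) ^ 4 <= (2 * N) ^ 4 by rewrite leq_exp2r.
apply: leq_trans (leq_mul (leq_mul JN KN) (leq_mul K4 (leqnn _))) _.
apply: (@leq_trans (2 ^ 5 * 4 ^ 8 * N ^ 6)).
  by rewrite eq_leq //; move: (4 ^ 8) => y; ring.
have h x y : 2 ^ 5 * x * y <= 4 ^ 5 * x * y by rewrite leq_mul2r leq_mul2r !orbT.
rewrite [13](_ : 13 = 5 + 8); last by [].
rewrite (expnD 4 5 8); exact: h.
Qed.

Section Phases.
Variables (F : finFieldType) (V : nat).
Implicit Types (s : store F).
Variables (r l a u m N : nat).
Hypothesis a0 : 0 < a.
Hypothesis amN : a + u + m < N.
Hypothesis Nl : N <= 2 ^ l.
Hypothesis lN : 2 ^ l <= 2 * N.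
Hypothesis NV : 4 ^ 13 * N ^ 6 <= V.

Lemma N_V : 4 ^ 13 * N <= V.
Proof.
apply: leq_trans NV; rewrite leq_mul2l; apply/orP; right.
by rewrite -{1}(expn1 N) leq_pexp2l //; move: amN; clear; lia.
Qed.

Lemma l_V : 2 * l + 10 <= V.
Proof.
have l2 : l < 2 ^ l by apply: ltn_expl.
apply: leq_trans N_V; apply: (@leq_trans (100 * N)); last by rewrite leq_mul2r orbC.
by move: l2 lN amN; clear; lia.
Qed.

Lemma phase1_ok s : pre_tabs s r (2 * l + 10) -> ir s 7 = l -> ir s 0 = a ->
  ir s 2 = m -> ir s 8 = u ->
  ok V phase1 s (100 * l.+1 + 100 + mpe_K cF1 cX1 * ((l + 4) ^ 5 * (2 * (a * u + m + a))))
   (fun s' => exists S, [/\ ir s' 59 = S, u < S, m %/ a < S &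
     forall j e, j < a -> e < S -> ft s' (14, ikey [:: 0; j * S + e; 0]) =
       (\fsum_(k < S) (ft s (22, [:: inl j; inl (k : nat)]) * ft s (20, [:: inl e]) ^+ k))%R]).
Proof.
move=> PT e7 ea em eu; have NV' := N_V; have lV := l_V.
have N1000 : 1000 * N <= V by apply: leq_trans NV'; rewrite leq_mul2r orbC.
pose t := u + m %/ a + 1.
have ma : m %/ a <= m by apply: leq_div.
have tN : t <= N by rewrite /t; move: ma amN; clear; lia.
pose TM := mpe_K cF1 cX1 * ((l + 4) ^ 5 * (2 * (a * u + m + a))).
apply: (@ok_seq _ _ _ _ _ (static_cost init1) (100 * l.+1 + (4 + TM)) _ (fun s' =>
  ir s' 40 = a /\ ir s' 57 = t)).
- apply: ok_lf => //=; rewrite ?ea ?em ?eu ?addn1 //.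
    by move: amN N1000 tN; rewrite /t addn1; clear; lia.
  by rewrite /t addn1.
- move=> s1 E1 [e40 e57].
  have PT1 := pre_tabs_eqoff PT E1 isT isT isT isT.
  have Hk : ok V kset s1 (100 * l.+1) (fun s' => exists K,
    [/\ ir s' 41 = K, ir s' 58 = 2 ^ K, K <= l.+1, t <= 2 ^ K & 2 ^ K <= 2 * t]).
    apply: kset_ok PT1 _ e57 _ _ lV; rewrite ?(eo_i E1) //; first by rewrite /t addn1.
    by apply: leq_trans (leq_trans tN Nl) _; rewrite leq_exp2l.
  apply: (ok_seq (T2 := 4 + TM) Hk); last exact: leqnn.
  move=> s2 E2 [K [e41 e58 Kl tK Kt]].
  have KN : 2 ^ K <= 2 * N by apply: leq_trans Kt _; rewrite leq_mul2l tN orbT.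
  apply: (@ok_seq _ _ _ _ _ (static_cost save1) TM _ (fun s' => ir s' 59 = 2 ^ K)).
  + by apply: ok_lf => //=; rewrite e58 //; move: KN N1000; clear; lia.
  + move=> s3 E3 e59.
    have f40 : ir s3 40 = a by rewrite (eo_i E3) // (eo_i E2).
    have f41 : ir s3 41 = K by rewrite (eo_i E3).
    have f58 : ir s3 58 = 2 ^ K by rewrite (eo_i E3).
    have PT3 : pre_tabs s3 r (2 * l + 10).
      apply: pre_tabs_eqoff E3 isT isT isT isT.
      exact: pre_tabs_eqoff PT1 E2 isT isT isT isT.
    have g22 ks : ft s3 (22, ks) = ft s (22, ks).
      by rewrite (eo_ft E3) // (eo_ft E2) // (eo_ft E1).
    have g20 ks : ft s3 (20, ks) = ft s (20, ks).
      by rewrite (eo_ft E3) // (eo_ft E2) // (eo_ft E1).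
    have Klim : K + K + 8 <= 2 * l + 10 by move: Kl; clear; lia.
    have aN : a <= N by move: amN; clear; lia.
    have Hm := @mpe_ok F V r (2 * l + 10) a K a0 Klim lV (mpe_V aN KN NV) s3 cF1 cX1
      (fun j k => ft s (22, [:: inl j; inl k])) (fun v => ft s (20, [:: inl (v %% 2 ^ K)]))
      isT isT (fun s' => I) (fun s' => I) PT3 f40 f41.
    apply: ok_conseq (Hm _ _) _ _.
    * by move=> s' j k [k1 k2 k3] e50 e51 jJ kK; rewrite /= e50 e51 k3.
    * by move=> s' v [k1 k2 k3] e50 vJ; rewrite /= e50 k3 // k1 // f58 g20 sub_divn_mod.
    * apply: mpe_P_le => //.
      apply: leq_trans (leq_mul (leqnn a) Kt) _; rewrite mulnCA leq_mul2l /=.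
      by rewrite /t !mulnDr muln1 leq_add2r leq_add2l mulnC leq_trunc_div.
    move=> s4 E4 H; exists (2 ^ K); split=> //.
    * by rewrite (eo_i E4).
    * by apply: leq_trans tK; rewrite /t addn1 ltnS leq_addr.
    * by apply: leq_trans tK; rewrite /t addn1 ltnS leq_addl.
    move=> j e ja eK; rewrite H; last by apply: leq_trans (leq_mul ja (leqnn _));
      rewrite mulSn addnC ltn_add2r.
    by rewrite divnMDl ?expn_gt0 // divn_small // addn0 modnMDl modn_small.
  by rewrite [static_cost _]/=; clear; lia.
by rewrite [static_cost _]/= /TM; move: (mpe_K _ _ * _) => X; clear; lia.
Qed.

Lemma phase2_ok s S : pre_tabs s r (2 * l + 10) -> ir s 7 = l -> ir s 0 = a ->
  ir s 8 = u -> ir s 59 = S -> u < S ->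
  ok V phase2 s (100 * l.+1 + 100 + mpe_K cF2 cX2 * ((l + 4) ^ 5 * (2 * (a * u + a))))
   (fun s' => exists S2, [/\ ir s' 58 = S2, a <= S2 &
     forall e c, e < u -> c < S2 -> ft s' (14, ikey [:: 0; e * S2 + c; 0]) =
       (\fsum_(k < a) (ft s (14, ikey [:: 0; (k * S + e)%N; 0]) * ft s (21, [:: inl e;
         inl c]) ^+ k))%R]).
Proof.
move=> PT e7 ea eu e59 uS; have NV' := N_V; have lV := l_V.
have N1000 : 1000 * N <= V by apply: leq_trans NV'; rewrite leq_mul2r orbC.
have aN : a <= N by move: amN; clear; lia.
pose TM := mpe_K cF2 cX2 * ((l + 4) ^ 5 * (2 * (a * u + a))).
apply: (@ok_seq _ _ _ _ _ (static_cost init2) (100 * l.+1 + TM) _ (fun s' =>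
  ir s' 40 = u.+1 /\ ir s' 57 = a)).
- apply: ok_lf => //=; rewrite ?ea ?eu ?addn1 //.
  by move: amN N1000; clear; lia.
- move=> s1 E1 [e40 e57].
  have PT1 := pre_tabs_eqoff PT E1 isT isT isT isT.
  have Hk : ok V kset s1 (100 * l.+1) (fun s' => exists K,
    [/\ ir s' 41 = K, ir s' 58 = 2 ^ K, K <= l.+1, a <= 2 ^ K & 2 ^ K <= 2 * a]).
    apply: kset_ok PT1 _ e57 _ _ lV; rewrite ?(eo_i E1) //.
    by apply: leq_trans (leq_trans aN Nl) _; rewrite leq_exp2l.
  apply: (ok_seq (T2 := TM) Hk); last exact: leqnn.
  move=> s3 E3 [K [e41 f58 Kl tK Kt]].
  have KN : 2 ^ K <= 2 * N by apply: leq_trans Kt _; rewrite leq_mul2l aN orbT.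
  have f40 : ir s3 40 = u.+1 by rewrite (eo_i E3).
  have PT3 : pre_tabs s3 r (2 * l + 10).
    exact: pre_tabs_eqoff PT1 E3 isT isT isT isT.
  have f0 : ir s3 0 = a by rewrite (eo_i E3) // (eo_i E1).
  have f59 : ir s3 59 = S by rewrite (eo_i E3) // (eo_i E1).
  have g14 ks : ft s3 (14, ks) = ft s (14, ks) by rewrite (eo_ft E3) // (eo_ft E1).
  have g21 ks : ft s3 (21, ks) = ft s (21, ks) by rewrite (eo_ft E3) // (eo_ft E1).
  have Klim : K + K + 8 <= 2 * l + 10 by move: Kl; clear; lia.
  have uN : u.+1 <= N by move: amN; clear; lia.
  pose f e k := if k < a then ft s (14, ikey [:: 0; (k * S + e)%N; 0]) else 0%R.
  have sF (s' : store F) : safe V cF2 s' by rewrite /=; case: ifP.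
  have Hm := @mpe_ok F V r (2 * l + 10) u.+1 K (ltn0Sn u) Klim lV (mpe_V uN KN NV) s3 cF2 cX2
      f (fun v => ft s (21, [:: inl (v %/ 2 ^ K); inl (v %% 2 ^ K)]))
      isT isT sF (fun s' => I) PT3 f40 e41.
  apply: ok_conseq (Hm _ _) _ _.
  + move=> s' j k [k1 k2 k3] e50 e51 jJ kK; rewrite /= e50 e51 !k1 // f0 /f.
    by case: ifP => _ //=; rewrite ?e50 ?e51 k3 // ?k1 // f59 g14.
  + by move=> s' v [k1 k2 k3] e50 vJ; rewrite /= e50 k3 // k1 // f58 g21 sub_divn_mod.
  + apply: mpe_P_le => //.
    by apply: leq_trans (leq_mul (leqnn u.+1) Kt) _; rewrite eq_leq //; ring.
  move=> s4 E4 H; exists (2 ^ K); split=> //; first by rewrite (eo_i E4).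
  move=> e c eu' cK; rewrite H; last first.
    by apply: leq_trans (leq_mul (ltnW eu' : e.+1 <= u.+1) (leqnn _));
      rewrite mulSn addnC ltn_add2r.
  rewrite divnMDl ?expn_gt0 // divn_small // addn0 modnMDl modn_small //.
  rewrite (big_ord_widen _ (fun k => (ft s (14, ikey [:: 0; (k * S + e)%N;
    0]) * ft s (21, [:: inl e; inl c]) ^+ k)%R) tK).
  rewrite [RHS]big_mkcond; apply: eq_bigr => k _; rewrite /f.
  by case: ifP => // _; rewrite mul0r.
by rewrite [static_cost _]/= /TM; move: (mpe_K _ _ * _) => X; clear; lia.
Qed.

End Phases.

(** * The encoder *)

Definition encoder_K := 5 * 1000 + 4 * (mpe_K cF1 cX1 + mpe_K cF2 cX2).
Definition encoder_T (a m n q : nat) :=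
  encoder_K * ((trunc_log 2 (2 * (a + m + (n + q))) + 4) ^ 5 * (a * q + m + n)).

Lemma encoder_arith a u m n q k l N L K1 K2 : 0 < a -> 0 < q -> u <= q -> k <= n -> l <= L ->
  N = a + m + (n + q) ->
  500 * N + 3000 + (100 * n.+1 + (100 * k.+1 +
   (100 * l.+1 + 100 + K1 * ((l + 4) ^ 5 * (2 * (a * u + m + a))) +
   (100 * l.+1 + 100 + K2 * ((l + 4) ^ 5 * (2 * (a * u + a))) +
   (100 * n.+1))))) <= (5 * 1000 + 4 * (K1 + K2)) * ((L + 4) ^ 5 * (a * q + m + n)).
Proof.
move=> a0 q0 uq kn lL EN; set X := a * q + m + n; set Z := (L + 4) ^ 5 * X.
have aX : a <= a * q by rewrite leq_pmulr.
have qX : a + q <= a * q + 1 by case: (a) (q) a0 q0 => // x [|y] // _ _; nia.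
have X1 : 0 < X by rewrite /X; move: aX a0; clear; lia.
have ll : (l + 4) ^ 5 <= (L + 4) ^ 5 by rewrite leq_exp2r // leq_add2r.
have au : a * u <= a * q by rewrite leq_mul2l uq orbT.
have XZ : X <= Z by rewrite leq_pmull // expn_gt0 addn4.
have lZ : l + 4 <= Z.
  apply: leq_trans (leq_pmulr _ X1); apply: leq_trans ll.
  by rewrite -[X in X <= _]expn1 leq_pexp2l // addn4.
have e4 : 4 * Z = (L + 4) ^ 5 * (4 * X) by rewrite mulnCA.
have h1 : K1 * ((l + 4) ^ 5 * (2 * (a * u + m + a))) <= K1 * (4 * Z).
  rewrite leq_mul2l e4; apply/orP; right; apply: leq_mul ll _.
  by rewrite /X; move: au aX; clear; lia.
have h2 : K2 * ((l + 4) ^ 5 * (2 * (a * u + a))) <= K2 * (4 * Z).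
  rewrite leq_mul2l e4; apply/orP; right; apply: leq_mul ll _.
  by rewrite /X; move: au aX; clear; lia.
have NZ : N <= 2 * Z.
  by rewrite EN; move: qX X1 XZ; rewrite /X; generalize Z; clear; lia.
have nZ : n.+1 <= 2 * Z.
  by move: X1 XZ; rewrite /X; generalize Z; clear; lia.
have Ec c : (c + 4 * (K1 + K2)) * Z = c * Z + (K1 * (4 * Z) + K2 * (4 * Z)) by ring.
rewrite Ec.
move: h1 h2; move: (K1 * _) (K1 * (4 * Z)) (K2 * _) (K2 * (4 * Z)) => A1 A2 B1 B2.
move: kn NZ nZ lZ (leq_trans X1 XZ); clear; lia.
Qed.

Section Eval.
Variables (F : finFieldType) (k S a : nat) (xexp yexp : nat -> nat) (msg : nat -> F) (x y : F).

Lemma scatter_eval : (forall t, t < k -> xexp t < S /\ yexp t < a) ->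
  (\fsum_(j < a) ((\fsum_(i < S) (scattered xexp yexp msg k i j * x ^+ i)) * y ^+ j) =
   \fsum_(t < k) (msg t * x ^+ xexp t * y ^+ yexp t))%R.
Proof.
move=> H; pose c (t j i : nat) : F :=
  if (xexp t == i) && (yexp t == j) then (msg t * x ^+ i * y ^+ j)%R else 0%R.
transitivity (\fsum_(j < a) \fsum_(i < S) \fsum_(t < k) c t j i)%R.
  apply: eq_bigr => j _; rewrite mulr_suml; apply: eq_bigr => i _.
  rewrite /scattered !mulr_suml big_mkcond; apply: eq_bigr => t _.
  by rewrite /c; case: ifP.
under eq_bigr do rewrite exchange_big; rewrite exchange_big; apply: eq_bigr => t _.
have [i1 j1] := H t (ltn_ord t).
rewrite (bigD1 (Ordinal j1)) //= (bigD1 (Ordinal i1)) //= {1}/c !eqxx /=.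
rewrite big1 ?addr0 => [|i ne]; last first.
  by rewrite /c; case: eqP => // E; case/eqP: ne; apply: val_inj.
rewrite big1 ?addr0 // => j ne; apply: big1 => i _.
by rewrite /c andbC; case: eqP => // E; case/eqP: ne; apply: val_inj.
Qed.
End Eval.

Section Encoder.
Variables (F : finFieldType) (V a m n k : nat).
Implicit Types (s : store F).
Variables (xexp yexp : nat -> nat) (px py msg : nat -> F).
Let N := a + m + (n + #|F|).
Hypothesis a0 : 0 < a.
Hypothesis NV : 4 ^ 13 * N ^ 6 <= V.
Hypothesis kn : k <= n.
Hypothesis fiber : forall l, l < n -> cnt px n (px l) <= a.
Hypothesis exps : forall t, t < k -> xexp t <= m %/ a /\ yexp t < a.

Lemma encoder_ok s : ir s 0 = a -> ir s 2 = m -> ir s 3 = n -> ir s 4 = k -> ir s 5 = #|F| ->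
  ir s 8 = 0 ->
  (forall l, l < k -> it s (0, [:: inl l]) = xexp l) ->
  (forall l, l < k -> it s (1, [:: inl l]) = yexp l) ->
  (forall ks, it s (4, ks) = 0) -> (forall ks, it s (5, ks) = 0) ->
  (forall l, l < n -> ft s (1, [:: inl l]) = px l) ->
  (forall l, l < n -> ft s (2, [:: inl l]) = py l) ->
  (forall l, l < k -> ft s (3, [:: inl l]) = msg l) ->
  (forall ks, ft s (22, ks) = 0%R) ->
  ok V encoder s (encoder_T a m n #|F|) (fun s' => forall l, l < n ->
    ft s' (4, [:: inl l]) = (\fsum_(t < k) (msg t * px l ^+ xexp t * py l ^+ yexp t))%R).
Proof.
move=> e0 e2 e3 e4 e5 e8 Ei Ej z4 z5 ex ey em z22.
have q0 : 0 < #|F| by apply/card_gt0P; exists 0%R.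
have N0 : 0 < N by rewrite /N; move: a0; clear; lia.
have EN : ir s 0 + ir s 2 + (ir s 3 + ir s 5) = N by rewrite e0 e2 e3 e5.
have NV1 : N <= V.
  apply: leq_trans NV; apply: leq_trans (leq_pmull _ _); last by rewrite expn_gt0.
  by rewrite -{1}(expn1 N) leq_pexp2l.
have nV : n.+1 <= V by apply: leq_trans NV1; rewrite /N; move: a0; clear; lia.
set Q := (fun s' => _).
suff [l [u [lN uq H]]] : exists l u, [/\ 2 ^ l <= 2 * N, u <= #|F| & ok V encoder s
   (500 * N + 3000 + (100 * n.+1 + (100 * k.+1 +
   (100 * l.+1 + 100 + mpe_K cF1 cX1 * ((l + 4) ^ 5 * (2 * (a * u + m + a))) +
   (100 * l.+1 + 100 + mpe_K cF2 cX2 * ((l + 4) ^ 5 * (2 * (a * u + a))) +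
   (100 * n.+1)))))) Q].
  apply: ok_conseq H _ _ => //; apply: encoder_arith => //.
  by apply: trunc_log_max.
have [sf1 co1 [r [l [PT1 e7 Nl lN]]]] := @prelude_ok F V s N EN N0 NV.
have E1 := run_eqoff prelude s; set s1 := run prelude s in E1 PT1 e7.
have Hb : ok V bucket s1 (100 * n.+1) (fun s' =>
    [/\ ir s' 8 <= n, ir s' 8 <= #|F| & place_inv px py n s']).
  apply: bucket_ok => // [||l' ?|l' ?|ks|ks].
  - by rewrite (eo_i E1).
  - by rewrite (eo_i E1).
  - by rewrite (eo_ft E1) // ex.
  - by rewrite (eo_ft E1) // ey.
  - by rewrite (eo_it E1).
  - by rewrite (eo_it E1).
have [sf2 co2 [un uq I2]] := Hb.
have E2 := run_eqoff bucket s1; set s2 := run bucket s1 in E2 un uq I2.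
set u := ir s2 8 in un uq.
exists l, u; split; [exact: lN|exact: uq|].
have amN : a + u + m < N by rewrite /N; move: un q0; clear; lia.
have E0_2 : forall x, x \notin mod_ireg prelude -> x \notin mod_ireg bucket -> ir s2 x = ir s x.
  by move=> x n1 n2; rewrite (eo_i E2) // (eo_i E1).
have PT2 := pre_tabs_eqoff PT1 E2 isT isT isT isT.
pose T6 := 100 * n.+1.
pose T5 := 100 * l.+1 + 100 + mpe_K cF2 cX2 * ((l + 4) ^ 5 * (2 * (a * u + a))) + T6.
pose T4 := 100 * l.+1 + 100 + mpe_K cF1 cX1 * ((l + 4) ^ 5 * (2 * (a * u + m + a))) + T5.
pose T3 := 100 * k.+1 + T4.
apply: (@ok_seq _ _ _ _ _ (500 * N + 3000) (100 * n.+1 + T3) _ (fun s' => s' = s1) Q);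
  last exact: leqnn.
  by split; [exact: sf1|exact: co1|].
move=> _ _ ->.
apply: (@ok_seq _ _ _ _ _ (100 * n.+1) T3 _ (fun s' => s' = s2) Q); last exact: leqnn.
  by split; [exact: sf2|exact: co2|].
move=> _ _ ->.
have Hs : ok V scatter s2 (100 * k.+1) (fun s' => forall i j,
    ft s' (22, [:: inl j; inl i]) = scattered xexp yexp msg k i j).
  apply: scatter_ok => [||l' ?|l' ?|l' ?|ks].
  - by apply: leq_trans nV; apply: leqW.
  - by rewrite E0_2.
  - by rewrite (eo_it E2) // (eo_it E1) // Ei.
  - by rewrite (eo_it E2) // (eo_it E1) // Ej.
  - by rewrite (eo_ft E2) // (eo_ft E1) // em.
  - by rewrite (eo_ft E2) // (eo_ft E1).
apply: (ok_seq (T2 := T4) Hs); last exact: leqnn.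
move=> s3 E3 H22.
have PT3 := pre_tabs_eqoff PT2 E3 isT isT isT isT.
have H1 : ok V phase1 s3 (100 * l.+1 + 100 + mpe_K cF1 cX1 * ((l + 4) ^ 5 * (2 * (a * u + m + a))))
   (fun s' => exists S, [/\ ir s' 59 = S, u < S, m %/ a < S &
     forall j e, j < a -> e < S -> ft s' (14, ikey [:: 0; j * S + e; 0]) =
       (\fsum_(k < S) (ft s3 (22, [:: inl j; inl (k : nat)]) * ft s3 (20, [:: inl e]) ^+ k))%R]).
  apply: (phase1_ok a0 amN Nl lN NV) PT3 _ _ _ _.
  - by rewrite (eo_i E3) // (eo_i E2).
  - by rewrite (eo_i E3) // E0_2.
  - by rewrite (eo_i E3) // E0_2.
  - by rewrite (eo_i E3).
apply: (ok_seq (T2 := T5) H1); last exact: leqnn.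
move=> s4 E4 [S [e59 uS mS H14]].
have PT4 := pre_tabs_eqoff PT3 E4 isT isT isT isT.
have H2 : ok V phase2 s4 (100 * l.+1 + 100 + mpe_K cF2 cX2 * ((l + 4) ^ 5 * (2 * (a * u + a))))
   (fun s' => exists S2, [/\ ir s' 58 = S2, a <= S2 &
     forall e c, e < u -> c < S2 -> ft s' (14, ikey [:: 0; e * S2 + c; 0]) =
       (\fsum_(k < a) (ft s4 (14, ikey [:: 0; (k * S + e)%N; 0]) * ft s4 (21, [:: inl e;
         inl c]) ^+ k))%R]).
  apply: (phase2_ok a0 amN Nl lN NV) PT4 _ _ _ e59 uS.
  - by rewrite (eo_i E4) // (eo_i E3) // (eo_i E2).
  - by rewrite (eo_i E4) // (eo_i E3) // E0_2.
  - by rewrite (eo_i E4) // (eo_i E3).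
apply: (ok_seq (T2 := T6) H2); last exact: leqnn.
move=> s5 E5 [S2 [e58 aS2 H14']].
have g3 : ir s5 3 = n.
  by rewrite (eo_i E5) // (eo_i E4) // (eo_i E3) // E0_2.
pose Inv j s' := forall l, l < j ->
    ft s' (4, [:: inl l]) = (\fsum_(t < k) (msg t * px l ^+ xexp t * py l ^+ yexp t))%R.
apply: (@ok_for F V 54 _ _ s5 n _ (static_cost out_step) Inv) => //.
- exact: ltnW.
- move=> j s6 jn E6 I6; have [p1 p2 p3 p4] := I2 j jn.
  set e := it s2 (6, [:: inl j]) in p1 p2 p4; set c := it s2 (7, [:: inl j]) in p3 p4.
  have k6 : it s6 (6, [:: inl j]) = e by rewrite (eo_it E6) // (eo_it E5) // (eo_it E4) //
    (eo_it E3).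
  have k7 : it s6 (7, [:: inl j]) = c by rewrite (eo_it E6) // (eo_it E5) // (eo_it E4) //
    (eo_it E3).
  have f58 : ir s6 58 = S2 by rewrite (eo_i E6).
  apply: ok_lf => //= i; rewrite ltnS leq_eqVlt /= xpair_eqE eqxx key1 /= k6 k7 f58.
  case: (i =P j) => [-> _|ne /= lj]; last exact: I6.
  have ca : c < a by apply: leq_trans p3 (fiber jn).
  rewrite (eo_ft E6) // (H14' e c) //; last by apply: leq_trans ca aS2.
  rewrite -(scatter_eval (S := S) (a := a)); last first.
    by move=> t /exps[t1 t2]; split=> //; apply: leq_ltn_trans t1 mS.
  have -> : ft s4 (21, [:: inl e; inl c]) = py j by rewrite (eo_ft E4) // (eo_ft E3).
  apply: eq_bigr => t _; congr (_ * _)%R; rewrite H14 //; last by apply: ltn_trans uS.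
  by apply: eq_bigr => i' _; rewrite H22 (eo_ft E3) // p2.
by rewrite [static_cost _]/= [expr_cost _]/=; clear; lia.
Qed.

End Encoder.

(** * Encoding a C_ab code *)

(** If X^i Y^a occurs in H, then a i + b a <= a b, so i = 0: the coefficient of Y^a in
H(x, Y) is a nonzero constant. *)
Lemma fiber_size (C : cab_code) x : count (fun p => p.1 == x) (cc_P C) <= cc_a C.
Proof.
set a := cc_a C; set b := cc_b C; set H := cc_H C; have a0 : 0 < a := cc_a_gt0 C;
  have b0 : 0 < b := cc_b_gt0 C.
have [[_ Ha] Hw _] := cc_Cab C; rewrite -/H -/a -/b in Ha Hw.
pose h := (H.[x%:P])%R.
have hE j : (h`_j = \sum_(i < size H) H`_i`_j * x ^+ i)%R.
  by rewrite /h horner_coef coef_sum; apply: eq_bigr => i _; rewrite -polyC_exp coefMC.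
have szh : size h <= a.+1.
  apply/leq_sizeP => j aj; rewrite hE big1 // => i _.
  have [->|/eqP nz] := eqVneq (H`_i`_j)%R 0%R; first by rewrite mul0r.
  have := Hw i j; rewrite /in_suppXY /wdeg /=; move/eqP: nz => -> /(_ isT) le.
  have : b * j <= a * b by apply: leq_trans le; rewrite leq_addl.
  by rewrite mulnC leq_mul2r leqNgt aj orbF => /eqP b00; rewrite b00 in b0.
have ha : (h`_a != 0)%R.
  have sH : 0 < size H.
    by rewrite lt0n size_poly_eq0; apply: contra Ha => /eqP ->; rewrite coef0 coef0.
  rewrite hE (bigD1 (Ordinal sH)) //= expr0 mulr1 big1 ?addr0 // => i ne.
  have [->|/eqP nz] := eqVneq (H`_i`_a)%R 0%R; first by rewrite mul0r.
  have := Hw i a; rewrite /in_suppXY /wdeg /=; move/eqP: nz => -> /(_ isT).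
  rewrite (mulnC b) -[X in _ <= X]add0n leq_add2r leqn0 muln_eq0 => /orP[/eqP a00|/eqP i0].
    by rewrite a00 in a0.
  by case/eqP: ne; apply: val_inj.
have h0 : (h != 0)%R by apply: contraNneq ha => ->; rewrite coef0.
pose Px := [seq p <- cc_P C | p.1 == x].
have uP : uniq [seq p.2 | p <- Px].
  rewrite map_inj_in_uniq ?filter_uniq ?cc_P_uniq // => -[u1 u2] [v1 v2].
  by rewrite !mem_filter /= => /andP[/eqP -> _] /andP[/eqP -> _] ->.
rewrite -size_filter -/Px -(size_map snd) -ltnS; apply: leq_trans szh.
apply: max_poly_roots h0 _ uP; apply/allP => y /mapP[[u v]].
rewrite mem_filter /= => /andP[/eqP -> /tnthP[l El]] ->.
by have := cc_P_curve l; rewrite -El /= => E; apply/rootP.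
Qed.

Lemma size_fibers (T : finType) (U : Type) (s : seq (T * U)) :
  size s = \sum_x count (fun p => p.1 == x) s.
Proof.
elim: s => [|p s IH] /=; first by rewrite big1.
rewrite big_split /= -IH (bigD1 p.1) //= eqxx big1 // => x.
by rewrite eq_sym => /negbTE ->.
Qed.

Lemma n_le_aq (C : cab_code) : cc_n C <= cc_a C * #|cc_F C|.
Proof.
rewrite -[X in X <= _](size_tuple (cc_P C)) size_fibers mulnC -sum_nat_const.
by apply: leq_sum => x _; apply: fiber_size.
Qed.

Lemma k_le_n (C : cab_code) : cc_k C <= cc_n C.
Proof.
have nE : cc_n C = \dim (fullv : {vspace 'rV[cc_F C]_(cc_n C)}) by rewrite dimvf dim_matrix mul1r.
by rewrite cc_dim [X in _ <= X]nE; apply: dimvS; apply: subvf.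
Qed.

Section Code.
Variable I : enc_input.
Let a := cc_a I.
Let b := cc_b I.
Let m := cc_m I.
Let n := cc_n I.
Let k := cc_k I.
Let F := cc_F I.
Let q := #|F|.

Definition px (l : nat) : F := (nth (0, 0)%R (cc_P I) l).1.
Definition py (l : nat) : F := (nth (0, 0)%R (cc_P I) l).2.
Definition xexp (l : nat) : nat := (nth (0, 0) (cc_Bhat I) l).1.
Definition yexp (l : nat) : nat := (nth (0, 0) (cc_Bhat I) l).2.
Definition message_at (l : nat) : F := if insub l is Some o then ei_msg I 0%R o else 0%R.

Lemma cnt_px x : cnt px n x = count (fun p => p.1 == x) (cc_P I).
Proof.
have sP : n = size (cc_P I) by rewrite size_tuple.
rewrite -[in RHS](mkseq_nth (0, 0)%R (cc_P I)) count_map size_tuple.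
exact: eq_count.
Qed.

Lemma encodeE (l : 'I_n) :
  (encode (ei_msg I) 0 l = \sum_(t < k) message_at t * px l ^+ xexp t * py l ^+ yexp t)%R.
Proof.
rewrite mxE /msg_poly !horner_sum; apply: eq_bigr => t _.
rewrite /message_at valK /px /py /xexp /yexp -!tnth_nth /monXY !hornerE /=.
by [].
Qed.

Lemma expo_ok t : t < k -> a * xexp t + b * yexp t <= m /\ yexp t < a.
Proof.
move=> tk; have := cc_Bhat_sub (mem_nth (0, 0) (_ : t < size (cc_Bhat I))).
rewrite size_tuple => /(_ tk); rewrite /xexp /yexp; case: (nth _ _ _) => i j.
by rewrite mem_Cab_basis ?cc_a_gt0 // => /andP[].
Qed.

Definition init_store : store F := Store (enc_ireg I) (fun=> 0%R) (@enc_itab I) (@enc_ftab I).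

Definition size_N := (a + b + m + n + q).+2.
(** The numbers that the encoder stores are at most the 20th power of the bound on
its input; its expressions have degree at most 12, and 12 * 20 < 241. *)
Definition value_bound := size_N ^ 20.

Lemma size_N_ge : 6 <= size_N.
Proof.
have q2 : 1 < q by rewrite /q; apply: card_finNzRing_gt1.
by move: q2 (cc_a_gt0 I) (cc_b_gt0 I); rewrite /size_N /a /b; clear; lia.
Qed.

Lemma size_N_value_bound : size_N <= value_bound.
Proof. by rewrite /value_bound -{1}(expn1 size_N) leq_pexp2l. Qed.

Lemma init_store_wf : wf value_bound init_store.
Proof.
have NV := size_N_value_bound; split=> [r|[t ks]] /=.
  apply: leq_trans NV; rewrite /enc_ireg /size_N.
  have := k_le_n I; rewrite -/k -/n -/a -/b -/m -/F -/q.
  by case: r => [|[|[|[|[|[|r]]]]]] /=; rewrite -/k -/n -/a -/b -/m -/F -/q ?nth_nil;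
    move: (k); clear; lia.
have E l : xexp l <= size_N /\ yexp l <= size_N.
  have [lk|kl] := ltnP l k; last by rewrite /xexp /yexp nth_default ?size_tuple.
  have [h1 h2] := expo_ok lk; have a0 := cc_a_gt0 I; rewrite -/a in a0.
  have : xexp l <= a * xexp l by rewrite leq_pmull.
  by move: h1 h2; rewrite /size_N; move: (a * _) (b * _); clear; lia.
case: t => [|[|t]] //=; case: ks => [|[l|x] [|? ?]] //=;
  by apply: leq_trans NV; case: (E l).
Qed.

Lemma encoder_init_ok : ok value_bound encoder init_store (encoder_T a m n q) (fun s' =>
  forall l, l < n ->
    ft s' (4, [:: inl l]) = (\sum_(t < k) message_at t * px l ^+ xexp t * py l ^+ yexp t)%R).
Proof.
have N6 := size_N_ge.
apply: (encoder_ok (cc_a_gt0 I) _ (k_le_n I)) => //.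
- rewrite /value_bound (_ : 20 = 14 + 6) // expnD; apply: leq_mul.
    apply: (@leq_trans (4 ^ 14)); first by rewrite leq_pexp2l.
    by rewrite leq_exp2r //; apply: leq_trans N6.
  by rewrite leq_exp2r // /size_N /a /b /m /n /q /F; clear; lia.
- by move=> l ln; rewrite cnt_px; apply: fiber_size.
move=> t /expo_ok[h1 h2]; split=> //.
rewrite leq_divRL ?cc_a_gt0 // mulnC; apply: leq_trans h1; exact: leq_addr.
Qed.

Definition encoder_code : program := compile 0 temp0 encoder.

Lemma encoder_wf : cmd_wf encoder. Proof. by vm_compute. Qed.

Lemma encoder_encodes : encodes_in encoder_code 241 I (cost encoder init_store).
Proof.
have [sf _ Q] := encoder_init_ok; have N6 := size_N_ge.
have V10 : 9 < value_bound.
  rewrite /value_bound; apply: (@leq_trans (6 ^ 2)) => //; apply: leq_trans (_ : size_N ^ 2 <= _).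
    by rewrite leq_exp2r.
  by rewrite leq_pexp2l.
have VW : value_bound ^ max_deg < word_capacity 241 I.
  rewrite /value_bound /max_deg -expnM /word_capacity -/a -/b -/m -/n -/F -/q -/size_N ltn_exp2l //.
have sm : sim (enc_init I) init_store by split.
have at0 : at_ encoder_code 0 encoder_code by rewrite /at_ drop0 take_size.
have [s' [[[E H] [_ _ _ sf'] _] P]] := compile_correct V10 VW (leqnn temp0) encoder_wf
  init_store_wf sf sm erefl at0.
exists s'.
  split; [exact: E| |exact: H].
  rewrite /halted P add0n /encoder_code size_compile; exact: leqnn.
by move=> l; rewrite sf' Q ?ltn_ord ?encodeE.
Qed.

End Code.

(** * Asymptotics *)

Local Open Scope ring_scope.

(** (a - 1) a <= (a - 1) (b - 1) <= 2 n + 1. *)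
Lemma sqr_a_le (a b n : nat) : (0 < a < b)%N -> (0 < n)%N -> (Cab_genus a b <= n)%N ->
  (a * a <= 9 * n)%N.
Proof.
rewrite /Cab_genus; case: a => // a; case: b => // b /=; rewrite ltnS => ab n0 gn.
have ab' : (a * a.+1 <= a * b)%N by rewrite leq_mul2l ab orbT.
have e := odd_double_half (a * b); have o : (odd (a * b) <= 1)%N by case: odd.
have aa : (a <= a * a)%N by case: (a) => // x; rewrite leq_pmull.
have abn : (a * b <= 2 * n + 1)%N by move: e o gn; generalize (odd (a * b) : nat) (a * b)./2;
  clear; lia.
have -> : (a.+1 * a.+1 = a * a + 2 * a + 1)%N by ring.
move: ab' abn n0 aa; rewrite mulnS; generalize (a * b)%N (a * a)%N; clear; lia.
Qed.

Section Analysis.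
Variable R : realType.

(** The logarithm of 16 n is at most 4 ln 2 + 2 ln h. *)
Lemma log_bound (L n : nat) (h : R) : (2 ^ L <= 16 * n)%N -> 0 < h -> n%:R <= h ^+ 2 ->
  (L + 4)%:R <= (8 + 2 / ln 2) * Num.max 1 (ln h).
Proof.
move=> Ln h0 nh; set M := Num.max 1 (ln h).
have l2 : 0 < ln (2 : R) by rewrite ln_gt0 // ltr1n.
have M1 : 1 <= M by rewrite le_max lexx.
have Mh : ln h <= M by rewrite le_max lexx orbT.
have h2 : 0 < h ^+ 2 by rewrite exprn_gt0.
have le : 2 ^+ L <= 2 ^+ 4 * h ^+ 2 :> R.
  apply: (@le_trans _ _ (16 * n)%:R); first by rewrite -natrX ler_nat.
  by rewrite natrM -natrX ler_wpM2l.
have : ln (2 ^+ L) <= ln (2 ^+ 4 * h ^+ 2) :> R.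
  by rewrite ler_ln // posrE ?mulr_gt0 ?exprn_gt0.
have e1 : ln (2 ^+ L) = L%:R * ln 2 :> R by rewrite lnXn // mulr_natl.
have e2 : ln (2 ^+ 4 * h ^+ 2) = 4 * ln 2 + 2 * ln h :> R.
  by rewrite lnM ?posrE ?exprn_gt0 // (lnXn 4) // (lnXn 2) // -[ln 2 *+ 4]mulr_natl -[ln h *+
    2]mulr_natl.
rewrite e1 e2 => H.
have e3 : (8 + 2 / ln 2) * M * ln 2 = 8 * (ln 2 * M) + 2 * M :> R.
  by rewrite mulrAC mulrDl divfK ?gt_eqF // mulrDl mulrA.
rewrite -(ler_pM2r l2) e3 natrD mulrDl.
have t : ln (2 : R) <= ln 2 * M by rewrite ler_peMr // ltW.
move: H t Mh; generalize (L%:R * ln (2 : R)) (ln (2 : R) * M) (ln (2 : R)) (ln h) M; clear;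
  move=> *; lra.
Qed.

Lemma encoder_T_bound (a m n q : nat) (h := q%:R * Num.sqrt n%:R : R) :
  (0 < a)%N -> (0 < n)%N -> (0 < q)%N -> (q <= n)%N -> (a * a <= 9 * n)%N ->
  (n <= a * q)%N -> (m <= 3 * n)%N ->
  (encoder_T a m n q)%:R <=
    encoder_K%:R * (8 + 2 / ln 2) ^+ 5 * 15 * (h * Num.max 1 (ln h) ^+ 5).
Proof.
move=> a0 n0 q0 qn aa naq mn; set M := Num.max 1 (ln h).
have r0 : 0 < Num.sqrt n%:R :> R by rewrite sqrtr_gt0 ltr0n.
have h0 : 0 < h by rewrite mulr_gt0 // ltr0n.
have nh : n%:R <= h ^+ 2.
  by rewrite exprMn sqr_sqrtr ?ler0n // ler_peMl ?ler0n // -natrX ler1n expn_gt0 q0.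
have ar : a%:R <= 3 * Num.sqrt n%:R :> R.
  rewrite -(@ler_pXn2r _ 2) ?nnegrE ?ler0n ?mulr_ge0 ?(ltW r0) // exprMn sqr_sqrtr ?ler0n //.
  have : (a * a)%:R <= (9 * n)%:R :> R by rewrite ler_nat.
  have -> : 3 ^+ 2 = 9 :> R by ring.
  by rewrite !natrM -expr2.
have an : (a <= 3 * n)%N.
  rewrite leqNgt; apply/negP => lt; have := leq_mul lt lt; move: aa n0; clear; nia.
have Xh : (a * q + m + n)%:R <= 15 * h.
  apply: (@le_trans _ _ (5 * (a * q))%:R); first by rewrite ler_nat; move: naq mn; clear; lia.
  have := ler_wpM2r (ler0n R q) ar; rewrite /h !natrM; nra.
have := @trunc_logP 2 (2 * (a + m + (n + q))) isT;
  rewrite muln_gt0 addn_gt0 addn_gt0 a0 => /(_ isT).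
set L := trunc_log _ _ => HL.
have Lb : (L + 4)%:R <= (8 + 2 / ln 2) * M.
  apply: (@log_bound L n) => //; apply: leq_trans HL _; move: an mn qn; clear; lia.
clearbody h; set c := 8 + 2 / ln 2 in Lb *.
have E (K : R) : K * c ^+ 5 * 15 * (h * M ^+ 5) = K * ((c * M) ^+ 5 * (15 * h)).
  by rewrite exprMn; ring.
rewrite E /encoder_T -/L 2!natrM ler_wpM2l ?ler0n //.
by apply: ler_pM; rewrite ?ler0n // natrX lerXn2r ?nnegrE ?ler0n ?(le_trans _ Lb).
Qed.

Lemma sqrt_le_32 (n q : nat) : (0 < n)%N -> (q <= n)%N ->
  q%:R * Num.sqrt n%:R <= (n%:R : R) `^ (3 / 2).
Proof.
move=> n0 qn; have -> : 3 / 2 = 1 + 2^-1 :> R by field.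
rewrite powRD; last by rewrite pnatr_eq0 -lt0n n0 implybT.
by rewrite powRr1 ?ler0n // powR12_sqrt ?ler0n // ler_wpM2r ?sqrtr_ge0 // ler_nat.
Qed.

End Analysis.

Theorem mainTheorem4 :
  exists (A : program) (d : nat) (T : enc_input -> nat),
    (forall I : enc_input, (cc_a I < cc_b I)%N -> encodes_in A d I (T I)) /\
    (forall R : realType,
       let D (I : enc_input) : Prop :=
         [/\ (cc_a I < cc_b I)%N,
             (#|cc_F I| <= cc_n I)%N
           & (Cab_genus (cc_a I) (cc_b I) <= cc_n I)%N] in
       let q_sqrt_n (I : enc_input) : R :=
         #|cc_F I|%:R * Num.sqrt (cc_n I)%:R in
       let n_3_2 (I : enc_input) : R := (cc_n I)%:R `^ (3 / 2) in
       softO D (fun I => (T I)%:R) q_sqrt_n /\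
       (forall f : enc_input -> R, softO D f q_sqrt_n -> softO D f n_3_2)).
Proof.
exists encoder_code, 241%N, (fun I => cost encoder (init_store I)).
split=> [I _|R D h h2]; first exact: encoder_encodes.
have Dn I : D I -> (0 < cc_n I)%N.
  by case=> _ qn _; apply: leq_trans qn; apply: ltnW; apply: card_finNzRing_gt1.
split.
  exists (encoder_K%:R * (8 + 2 / ln 2) ^+ 5 * 15), 5%N => I DI; have n0 := Dn I DI.
  case: DI => ab qn gn; rewrite ger0_norm ?ler0n //.
  have [_ co _] := encoder_init_ok I.
  apply: (@le_trans _ _ (encoder_T (cc_a I) (cc_m I) (cc_n I) #|cc_F I|)%:R);
    first by rewrite ler_nat.
  apply: encoder_T_bound => //.
  - exact: cc_a_gt0.
  - by apply: ltnW; apply: card_finNzRing_gt1.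
  - by apply: sqr_a_le gn => //; rewrite cc_a_gt0.
  - exact: n_le_aq.
  apply: ltnW; apply: leq_trans (cc_m_bound I) _.
  by rewrite (_ : 3 = 1 + 2)%N // mulnDl mul1n leq_add2l leq_mul2l.
move=> f [C [c H]]; exists `|C|, c => I DI; apply: le_trans (H I DI) _.
have n0 := Dn I DI; have [_ qn _] := DI.
have q0 : (0 < #|cc_F I|)%N by apply: ltnW; apply: card_finNzRing_gt1.
have h0 : 0 < h I by rewrite mulr_gt0 ?sqrtr_gt0 ?ltr0n.
have hh : h I <= h2 I by apply: sqrt_le_32.
have h20 := lt_le_trans h0 hh.
have M0 (x : R) : 0 <= Num.max 1 x by rewrite le_max ler01.
apply: (@le_trans _ _ (`|C| * (h I * Num.max 1 (ln (h I)) ^+ c))).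
  by rewrite ler_wpM2r ?ler_norm // mulr_ge0 ?exprn_ge0 ?M0 ?(ltW h0).
rewrite ler_wpM2l // ler_pM ?exprn_ge0 ?M0 ?(ltW h0) // lerXn2r ?nnegrE //.
by rewrite ge_max le_max lexx /= le_max ler_ln // hh orbT.
Qed.
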